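(* There is a certifying algorithm with running time $O(|V|+|E|)$ to determine whether an input chordal graph $G=(V,E)$ is star $3$-colorable.
   Context: Graphs are finite, with no loops or parallel edges. A star coloring of $G$ is a proper vertex coloring in which no path on four vertices (as a not necessarily induced subgraph) uses only two colors; $G$ is star $k$-colorable if it has a star coloring using at most $k$ colors. A graph is chordal if it has no induced cycle of length at least four. A recognition algorithm is certifying if, besides a yes/no answer, it returns a certificate allowing the user to verify the answer. Here a yes-certificate is a star $3$-coloring of $G$, and a no-certificate is an induced subgraph of $G$ isomorphic to one of the following graphs: $K_4$; the kite (diamond plus a pendant vertex attached to a vertex of degree $2$ of the diamond); the gem (a path on four vertices plus a vertex adjacent to all of it); $X_{127}$ (two triangles $\{v,a,b\}$, $\{v,c,d\}$ sharing exactly the vertex $v$, plus one pendant vertex adjacent to $a$ and another adjacent to $b$); or $D_k$ for some integer $k\ge4$, where $D_k$ is obtained from the graph with vertices $u_1,\dots,u_k,v_1,\dots,v_k$ and edges $u_iv_i$ ($1\le i\le k$), $u_iu_{i+1}$ ($1\le i<k$) by identifying $v_1$ with $v_2$ and $v_{k-1}$ with $v_k$. *)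

(* Defs.v *)
From mathcomp Require Import all_boot.

Set Implicit Arguments.
Unset Strict Implicit.
Unset Printing Implicit Defensive.

(** * Graphs: an edge relation on a finite type *)

Definition simple_graph (T : finType) (e : rel T) : Prop :=
  symmetric e /\ irreflexive e.

Definition edge_set (T : finType) (e : rel T) : {set {set T}} :=
  [set [set xy.1; xy.2] | xy : T * T & e xy.1 xy.2].

(** [g] is an isomorphism from the graph [h] onto the subgraph of [e] induced
    by [W]. *)
Definition induced_iso (U T : finType) (h : rel U) (e : rel T) (W : {set T}) :
    Prop :=
  exists g : U -> T,
    [/\ injective g, g @: [set: U] = W & forall x y, e (g x) (g y) = h x y].

Definition cycle_graph (k : nat) : rel 'I_k :=
  fun i j => (j == i.+1 %% k :> nat) || (i == j.+1 %% k :> nat).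

Definition chordal (T : finType) (e : rel T) : Prop :=
  forall (k : nat) (W : {set T}), 4 <= k -> ~ induced_iso (@cycle_graph k) e W.

(** * Star colorings *)

Definition proper_coloring (T C : finType) (e : rel T) (f : T -> C) : Prop :=
  forall x y, e x y -> f x != f y.

Definition star_coloring (T C : finType) (e : rel T) (f : T -> C) : Prop :=
  proper_coloring e f /\
  forall a b c d, uniq [:: a; b; c; d] -> e a b -> e b c -> e c d ->
    2 < #|f @: [set a; b; c; d]|.

Definition star_colorable (k : nat) (T : finType) (e : rel T) : Prop :=
  exists f : T -> 'I_k, star_coloring e f.

(** * The obstructions *)

Definition graph_of_edges (n : nat) (s : seq (nat * nat)) : rel 'I_n :=
  fun i j => ((i : nat, j : nat) \in s) || ((j : nat, i : nat) \in s).

Definition K4 : rel 'I_4 := fun i j => i != j.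

(** The diamond is {0,1,2,3}, with 2 and 3 of degree 2. *)
Definition kite : rel 'I_5 :=
  @graph_of_edges 5 [:: (0, 1); (0, 2); (0, 3); (1, 2); (1, 3); (2, 4)].

Definition gem : rel 'I_5 :=
  @graph_of_edges 5 [:: (0, 1); (1, 2); (2, 3); (4, 0); (4, 1); (4, 2); (4, 3)].

(** v, a, b, c, d are 0, 1, 2, 3, 4; the pendant vertices are 5 and 6. *)
Definition X127 : rel 'I_7 :=
  @graph_of_edges 7
    [:: (0, 1); (0, 2); (1, 2); (0, 3); (0, 4); (3, 4); (1, 5); (2, 6)].

(** With indices starting at 0, [inl i] is u_i, and v_i is
    [inr (minn i.-1 (k - 3))]: among v_0, ..., v_(k-1), this map identifies
    v_0 with v_1 and v_(k-2) with v_(k-1), and nothing else, when [4 <= k]. *)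
Definition D_graph (k : nat) : rel ('I_k + 'I_(k - 2)) := fun x y =>
  match x, y with
  | inl i, inl j => (j == i.+1 :> nat) || (i == j.+1 :> nat)
  | inl i, inr j | inr j, inl i => j == minn i.-1 (k - 3) :> nat
  | inr _, inr _ => false
  end.

Definition obstruction (T : finType) (e : rel T) (W : {set T}) : Prop :=
  [\/ induced_iso K4 e W \/ induced_iso kite e W,
      induced_iso gem e W,
      induced_iso X127 e W |
      exists2 k, 4 <= k & induced_iso (@D_graph k) e W].

(** * A word RAM

    While programs over registers and arrays, both numbered by [nat].  Words
    have [w] bits: constants and sums are taken modulo [2 ^ w], and [Sub] is
    truncated at 0.  The cost of a run counts every evaluated node of an
    expression or a test and every executed elementary command.  A program
    mentions finitely many registers and arrays, so that this is, up to a
    constant factor, the usual RAM with one memory. *)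

Inductive expr :=
  | Const (k : nat)
  | Reg (x : nat)
  | Get (a : nat) (i : expr)
  | Add (e1 e2 : expr)
  | Sub (e1 e2 : expr).

Inductive test :=
  | TEq (e1 e2 : expr)
  | TLt (e1 e2 : expr)
  | TNot (b : test)
  | TAnd (b1 b2 : test).

Inductive cmd :=
  | Skip
  | Assign (x : nat) (e : expr)
  | Store (a : nat) (i e : expr)
  | Seq (c1 c2 : cmd)
  | If (b : test) (c1 c2 : cmd)
  | While (b : test) (c : cmd).

Record state := State { regs : nat -> nat; arrs : nat -> nat -> nat }.

Definition set_reg (s : state) (x v : nat) : state :=
  State (fun y => if y == x then v else regs s y) (arrs s).

Definition set_arr (s : state) (a i v : nat) : state :=
  State (regs s)
    (fun b j => if (b == a) && (j == i) then v else arrs s b j).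

Fixpoint eval (w : nat) (s : state) (e : expr) : nat :=
  match e with
  | Const k => k %% 2 ^ w
  | Reg x => regs s x
  | Get a i => arrs s a (eval w s i)
  | Add e1 e2 => (eval w s e1 + eval w s e2) %% 2 ^ w
  | Sub e1 e2 => eval w s e1 - eval w s e2
  end.

Fixpoint holds (w : nat) (s : state) (b : test) : bool :=
  match b with
  | TEq e1 e2 => eval w s e1 == eval w s e2
  | TLt e1 e2 => eval w s e1 < eval w s e2
  | TNot b => ~~ holds w s b
  | TAnd b1 b2 => holds w s b1 && holds w s b2
  end.

Fixpoint expr_cost (e : expr) : nat :=
  match e with
  | Const _ | Reg _ => 1
  | Get _ i => (expr_cost i).+1
  | Add e1 e2 | Sub e1 e2 => (expr_cost e1 + expr_cost e2).+1
  end.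

Fixpoint test_cost (b : test) : nat :=
  match b with
  | TEq e1 e2 | TLt e1 e2 => (expr_cost e1 + expr_cost e2).+1
  | TNot b => (test_cost b).+1
  | TAnd b1 b2 => (test_cost b1 + test_cost b2).+1
  end.

(** [exec w c s t s']: started in [s] with [w]-bit words, [c] terminates in
    [s'] at cost [t]. *)
Inductive exec (w : nat) : cmd -> state -> nat -> state -> Prop :=
  | ExecSkip s : exec w Skip s 1 s
  | ExecAssign x e s :
      exec w (Assign x e) s (expr_cost e).+1 (set_reg s x (eval w s e))
  | ExecStore a i e s :
      exec w (Store a i e) s (expr_cost i + expr_cost e).+1
        (set_arr s a (eval w s i) (eval w s e))
  | ExecSeq c1 c2 s1 s2 s3 t1 t2 :
      exec w c1 s1 t1 s2 -> exec w c2 s2 t2 s3 ->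
      exec w (Seq c1 c2) s1 (t1 + t2) s3
  | ExecIf b c1 c2 s s' t :
      exec w (if holds w s b then c1 else c2) s t s' ->
      exec w (If b c1 c2) s (test_cost b + t).+1 s'
  | ExecWhileFalse b c s :
      ~~ holds w s b -> exec w (While b c) s (test_cost b).+1 s
  | ExecWhileTrue b c s1 s2 s3 t1 t2 :
      holds w s1 b -> exec w c s1 t1 s2 -> exec w (While b c) s2 t2 s3 ->
      exec w (While b c) s1 (test_cost b + t1 + t2).+1 s3.

(** * Input and output *)

Definition adjacency_lists (n : nat) (e : rel 'I_n) (adj : 'I_n -> seq 'I_n) :
    Prop :=
  forall x, uniq (adj x) /\ forall y, (y \in adj x) = e x y.

(** The number of vertices, then for each vertex its degree followed by its
    neighbours, listed in an arbitrary order. *)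
Definition encode_graph (n : nat) (adj : 'I_n -> seq 'I_n) : seq nat :=
  n :: flatten [seq size (adj x) :: [seq val y | y <- adj x] | x <- enum 'I_n].

(** The input is stored in array 0; everything else is 0. *)
Definition input_state (n : nat) (adj : 'I_n -> seq 'I_n) : state :=
  State (fun _ => 0)
    (fun a i => if a == 0 then nth 0 (encode_graph adj) i else 0).

(** Array 1 lists the colors of the vertices 0, ..., n - 1. *)
Definition yes_certificate (n : nat) (e : rel 'I_n) (s : state) : Prop :=
  exists f : 'I_n -> 'I_3,
    star_coloring e f /\ forall x : 'I_n, arrs s 1 x = f x.

(** Register 1 holds the number of vertices of the returned induced subgraph,
    and array 1 lists these vertices without repetition. *)
Definition no_certificate (n : nat) (e : rel 'I_n) (s : state) : Prop :=
  exists r : seq 'I_n,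
    [/\ uniq r,
        [seq val x | x <- r] = [seq arrs s 1 i | i <- iota 0 (regs s 1)] &
        obstruction e [set x in r]].

(** Register 0 holds the answer, 1 for yes and 0 for no. *)
Definition certified_answer (n : nat) (e : rel 'I_n) (s : state) : Prop :=
  [/\ regs s 0 = 1, star_colorable 3 e & yes_certificate e s] \/
  [/\ regs s 0 = 0, ~ star_colorable 3 e & no_certificate e s].

(* Main.v *)
From Stdlib Require Import FunctionalExtensionality.
Require Import Defs.
From mathcomp Require Import all_boot zify.

Set Implicit Arguments.
Unset Strict Implicit.
Unset Printing Implicit Defensive.

(** Every obstruction has no star 3-coloring, so it is enough to find, in a
    chordal graph, either an obstruction or a star 3-coloring, both by a
    constant number of passes over the arcs.

    Grow a breadth-first forest, starting each component at a vertex of degree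
    at least three if it has one.  If [x] is joined to a later vertex [y] by an
    edge outside the forest, the parent of [y] was found before [x], and a path
    of earlier vertices joins it to [x]; since [y] sees nothing inside that
    path, chordality makes the parent of [y] adjacent to [x]
    ([nontree_triangle]).  Hence either [x] and [y] are siblings, or two
    triangles share an edge and one of their two tips has degree at least
    three.  A third neighbor of that tip then gives K4, the gem or the kite
    ([diamond_tip]).  The same happens when a vertex of degree at least three
    is the end of a path of three siblings.  Once neither occurs, every
    triangle is an edge between siblings together with their parent, and every
    other edge is a bridge from a vertex to its parent.

    A 3-coloring is a star coloring if each edge has an end for which the other
    end is the only neighbor of its color ([star_coloring_only]): the middle
    edge of a two-colored path on four vertices has no such end.  The coloring
    goes down the forest.  A vertex takes either the color of its grandparent
    or the color that neither its parent nor its grandparent has, and one bit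
    per vertex records the choice.  Siblings in a triangle choose differently;
    which of the two repeats the grandparent's color depends on their degrees
    and on whether the parent is shared, that is, lies in two triangles that
    meet in it alone.  This fails only if a shared vertex lies in a triangle
    whose two other vertices have degree at least three, which is X127, or if
    two shared vertices are adjacent, which is D_4.

    For a bridge, call a vertex hot if it is in a triangle or if some hot child
    without siblings has claimed it.  The edge above a hot vertex without
    siblings is served by its upper end.  An end of degree at least three can do
    so for one child only, which therefore claims it.  A claim on a parent that is
    already hot fails.  In that case the chains of claims lead from both ends of
    the edge down to triangles, and the union of the two chains, of one pendant
    vertex at each inner vertex and of the two triangles is an induced D_k
    ([D_collision]): each edge of the chain is a bridge, which keeps the parts
    on its two sides apart.  If no claim fails, the bits can be chosen so that
    every edge is served ([only_edge]).

    For the running time, every pass is a loop with a loop-free body over a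
    counter that runs to a fixed multiple of the size of the input, so that the
    cost of a run follows from the text of the program ([prun_exec]), and
    correctness is an invariant of the counter ([loop_rule]).  Breadth-first
    search fits this form because each of its steps consumes one arc, one
    queue entry or one candidate root. *)

(** * Chordal graphs given by neighbor lists *)

(** Arithmetic goals arise below among many hypotheses on graphs; only the order
    relations and equations between naturals are handed to [lia]. *)
Ltac plia :=
  first [ solve [ repeat match goal with
    | H : is_true (leq _ _) |- _ => revert H
    | H : is_true (andb (leq _ _) (leq _ _)) |- _ => revert H
    | H : @eq nat _ _ |- _ => revert H
    end; clear; intros; lia ] | lia ].

Section Definitions.

Variables (V : eqType) (nb : V -> seq V).

Definition adj x y := y \in nb x.
(** In a triangle, such a vertex has a neighbor outside the triangle.  This is
    where the pendant vertices of the obstructions come from. *)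
Definition big x := 2 < size (nb x).

Definition hole (s : seq V) : Prop :=
  [/\ 3 < size s, uniq s &
      forall x0 i j, i < size s -> j < size s ->
        adj (nth x0 s i) (nth x0 s j) =
        (j == i.+1 %% size s) || (i == j.+1 %% size s)].

Record chordal_lists : Prop := ChordalLists {
  nb_uniq : forall x, uniq (nb x);
  adj_sym : symmetric adj;
  adj_irr : irreflexive adj;
  no_hole : forall s, ~ hole s }.

End Definitions.

Lemma bigE (V : eqType) (nb : V -> seq V) x : big nb x = (2 < size (nb x)).
Proof. by []. Qed.

Section Chordal.

Variables (V : eqType) (nb : V -> seq V).
Hypothesis G : chordal_lists nb.
Local Notation e := (adj nb).
Local Notation big := (big nb).
Let eC : symmetric e := adj_sym G.
Let eI : irreflexive e := adj_irr G.

Lemma adj_neq x y : e x y -> x != y.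
Proof. by apply: contraTneq => ->; rewrite eI. Qed.

Lemma bigP x a b c :
  e x a -> e x b -> e x c -> a != b -> a != c -> b != c -> big x.
Proof.
move=> xa xb xc ab ac bc; rewrite /big.
apply: (@uniq_leq_size _ [:: a; b; c]); first by rewrite /= !inE negb_or ab ac bc.
by move=> z; rewrite !inE => /or3P[] /eqP->.
Qed.

Lemma not_bigP x a b z :
  ~~ big x -> e x a -> e x b -> a != b -> e x z -> z = a \/ z = b.
Proof.
move=> nx xa xb ab xz; case: (eqVneq z a) => [|za]; first by left.
case: (eqVneq z b) => [|zb]; first by right.
by case/negP: nx; apply: (bigP xa xb xz); rewrite // eq_sym.
Qed.

(** Chordality, in the form in which the search uses it.  In a shortest
    counterexample the walk has no chord and no repetition, so that it closes
    through [y] to a hole. *)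
Lemma detour y (w : nat -> V) m :
  (forall i, i < m -> e (w i) (w i.+1)) ->
  (forall i, 0 < i < m -> ~~ e y (w i) && (w i != y)) ->
  e y (w 0) -> e y (w m) -> w 0 != w m -> e (w 0) (w m).
Proof.
elim/ltn_ind: m w => m IH w we wn y0 ym w0m.
pose P i j := [&& i.+1 < j, ~~ ((i == 0) && (j == m)) & e (w i) (w j)].
case: (boolP [exists i : 'I_m.+1, exists j : 'I_m.+1, P i j]) =>
  [/existsP[[i /= im] /existsP[[j /= jm] /and3P[/= ij nij eij]]]|chord].
  (* a chord shortens the walk, and so does a repetition below *)
  pose w' k := if k <= i then w k else w (k + (j - i.+1)).
  pose m' := m - (j - i.+1).
  have w0 : w' 0 = w 0 by [].
  have wm : w' m' = w m by rewrite /w' ifF; [congr w|]; lia.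
  rewrite -w0 -wm; apply: IH; rewrite ?w0 ?wm //; first by lia.
    move=> k km; rewrite /w'; case: (ltngtP k i) => ki.
    - by apply: we; lia.
    - by rewrite addSn; apply: we; lia.
    - rewrite ki.
      by have -> : i.+1 + (j - i.+1) = j by lia.
  by move=> k km; rewrite /w'; case: ifP => ki; apply: wn; lia.
pose Q i j := [&& i < j, ~~ ((i == 0) && (j == m)) & w i == w j].
case: (boolP [exists i : 'I_m.+1, exists j : 'I_m.+1, Q i j]) =>
  [/existsP[[i /= im] /existsP[[j /= jm] /and3P[/= ij nij /eqP eij]]]|rep].
  pose w' k := if k <= i then w k else w (k + (j - i)).
  pose m' := m - (j - i).
  have w0 : w' 0 = w 0 by [].
  have wm : w' m' = w m.
    rewrite /w'; case: ifP => mi; last by congr w; lia.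
    have jm' : j = m by lia.
    by rewrite -jm' -eij; congr w; lia.
  rewrite -w0 -wm; apply: IH; rewrite ?w0 ?wm //; first by lia.
    move=> k km; rewrite /w'; case: (ltngtP k i) => ki.
    - by apply: we; lia.
    - by rewrite addSn; apply: we; lia.
    - rewrite ki eij.
      have -> : i.+1 + (j - i) = j.+1 by lia.
      by apply: we; lia.
  by move=> k km; rewrite /w'; case: ifP => ki; apply: wn; lia.
apply/negPn/negP => n0m.
have m2 : 1 < m.
  move: w0m n0m we; case: (m) => [|[|//]]; first by rewrite eqxx.
  by move=> _ n01 /(_ 0 isT) e01; rewrite e01 in n01.
have wch i j : i <= m -> j <= m -> i < j -> e (w i) (w j) = (j == i.+1).
  move=> im jm ij; apply/idP/eqP => [eij|->]; last by apply: we; lia.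
  apply/eqP; rewrite eqn_leq ij andbT leqNgt; apply/negP => ij'.
  case/negP: chord; apply/existsP; exists (Ordinal (im : i < m.+1)).
  apply/existsP; exists (Ordinal (jm : j < m.+1)); apply/and3P; split=> //=.
  by apply/negP => /andP[/eqP i0 /eqP jm']; rewrite -i0 -jm' eij in n0m.
have winj i j : i <= m -> j <= m -> i < j -> w i != w j.
  move=> im jm ij; apply/negP => eij.
  case: (boolP ((i == 0) && (j == m))) => [/andP[/eqP i0 /eqP jm']|nij].
    by rewrite i0 jm' (negbTE w0m) in eij.
  case/negP: rep; apply/existsP; exists (Ordinal (im : i < m.+1)).
  apply/existsP; exists (Ordinal (jm : j < m.+1)); exact/and3P.
have wy i : i <= m -> e y (w i) = (i == 0) || (i == m).
  move=> im; case: (eqVneq i 0) => [->//|i0].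
  case: (eqVneq i m) => [->//|im'].
  by apply/negbTE; have /andP[] : ~~ e y (w i) && (w i != y) by apply: wn; lia.
have wne i : i <= m -> w i != y.
  move=> im; case: (eqVneq i 0) => [->|i0]; first by rewrite eq_sym adj_neq.
  case: (eqVneq i m) => [->|im']; first by rewrite eq_sym adj_neq.
  by have /andP[] : ~~ e y (w i) && (w i != y) by apply: wn; lia.
have sz : size (y :: mkseq w m.+1) = m.+2 by rewrite /= size_map size_iota.
have nthE x0 k : k < m.+1 -> nth x0 (y :: mkseq w m.+1) k.+1 = w k.
  by move=> km; rewrite -[RHS](nth_mkseq x0 w km).
have nth0E x0 : nth x0 (y :: mkseq w m.+1) 0 = y by [].
(* the walk is now an induced path, which [y] closes to a hole *)
apply: (@no_hole _ _ G ( y :: mkseq w m.+1)); split.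
- by rewrite sz.
- rewrite cons_uniq; apply/andP; split.
    apply/negP => /mapP[i]; rewrite mem_iota => im yw.
    by have := wne i; rewrite -yw eqxx => /(_ _)/negP; apply=> //; lia.
  rewrite map_inj_in_uniq ?iota_uniq // => i j.
  rewrite !mem_iota => im jm; case: (ltngtP i j) => // ij E.
    by have := winj i j; rewrite E eqxx => /(_ _ _ _)/negP; case=> //; lia.
  by have := winj j i; rewrite E eqxx => /(_ _ _ _)/negP; case=> //; lia.
move=> x0 i j; rewrite sz => im jm.
have md k : k < m.+1 -> k.+1 %% m.+2 = k.+1 by move=> km; rewrite modn_small.
have md' : m.+2 %% m.+2 = 0 by rewrite modnn.
case: i im => [|i] im; case: j jm => [|j] jm; rewrite ?nth0E ?nthE //.
- rewrite wy; last by lia.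
  rewrite modn_small // eqSS; congr (_ || _).
  case: (eqVneq j m) => [->|jm']; first by rewrite md'.
  by rewrite md //; lia.
- rewrite eC wy; last by lia.
  rewrite orbC (@modn_small 1) // eqSS; congr (_ || _).
  case: (eqVneq i m) => [->|jm']; first by rewrite md'.
  by rewrite md //; lia.
have mds k l : k < m.+1 -> l < m.+1 -> (l.+1 == k.+2 %% m.+2) = (l == k.+1).
  move=> km lm; case: (eqVneq k m) => [->|km']; first by rewrite md'; lia.
  by rewrite md //; lia.
rewrite !mds //; case: (ltngtP i j) => [ij|ij|->].
- by rewrite wch; lia.
- by rewrite eC wch; lia.
by rewrite eI; lia.
Qed.

Lemma no_C4 a b c d : e a b -> e b c -> e c d -> e d a ->
  a != c -> b != d -> e a c \/ e b d.
Proof.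
move=> ab bc cd da ac bd; case: (boolP (e a c)) => [|nac]; [by left | right].
apply: (@detour a (fun i => nth d [:: b; c; d] i) 2) => //=; last by rewrite eC.
  by case=> [|[|i]].
by case=> [|[|i]] //=; rewrite nac eq_sym.
Qed.

End Chordal.

(** * Breadth-first forests of chordal graphs *)

(** [pos] is the time at which a vertex is found, counted from 1, and 0 for the
    vertices outside the graph; roots are their own parents.  [par_first] and
    [par_mono] express the order of a queue, [root_cut] that a root opens a new
    component, and [root_big] that the candidates of degree at least three are
    tried as roots before the others. *)
Record bfs_forest (V : eqType) (nb : V -> seq V) (pos : V -> nat)
    (par : V -> V) : Prop := BfsForest {
  pos_edge : forall x y, adj nb x y -> 0 < pos x;
  pos_inj : forall x y, 0 < pos x -> pos x = pos y -> x = y;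
  par_edge : forall y, 0 < pos y -> par y != y ->
    adj nb y (par y) && (pos (par y) < pos y);
  par_first : forall u y, adj nb u y -> pos u < pos y ->
    (par y != y) && (pos (par y) <= pos u);
  par_mono : forall y z, 0 < pos y -> par y != y -> par z != z ->
    pos y < pos z -> pos (par y) <= pos (par z);
  root_cut : forall r u v, 0 < pos r -> par r = r -> adj nb u v ->
    pos u < pos r -> pos v < pos r;
  root_big : forall r z, 0 < pos r -> par r = r -> ~~ big nb r ->
    pos r <= pos z -> ~~ big nb z }.

Section Forest.

Variables (V : eqType) (nb : V -> seq V) (pos : V -> nat) (par : V -> V).
Hypothesis G : chordal_lists nb.
Hypothesis F : bfs_forest nb pos par.
Local Notation e := (adj nb).
Local Notation big := (big nb).
Let eC : symmetric e := adj_sym G.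
Let eI : irreflexive e := adj_irr G.

Lemma adj_pos x y : e x y -> pos x < pos y \/ pos y < pos x.
Proof.
move=> xy; case: (ltngtP (pos x) (pos y)) => [|| E]; [by left | by right |].
by have := adj_neq G xy; rewrite (pos_inj F (pos_edge F xy) E) eqxx.
Qed.

Lemma par_adj y : 0 < pos y -> par y != y -> e (par y) y.
Proof. by move=> vy ny; have /andP[] := par_edge F vy ny; rewrite eC. Qed.

Lemma par_lt y : 0 < pos y -> par y != y -> pos (par y) < pos y.
Proof. by move=> vy ny; have /andP[] := par_edge F vy ny. Qed.

Lemma to_root z : 0 < pos z -> exists r s,
  [/\ path e z s, last z s = r, par r = r, 0 < pos r &
      all (fun u => pos u <= pos z) (z :: s)].
Proof.
have [k] := ubnP (pos z); elim: k z => // k IH z zk vz.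
case: (eqVneq (par z) z) => [rz|nz].
  by exists z, [::]; split=> //=; rewrite leqnn.
have pz := par_adj vz nz; have lz := par_lt vz nz.
have [|//|r [s [ps ls rr vr als]]] := IH (par z).
- by apply: (leq_trans lz); rewrite -ltnS.
- exact: (pos_edge F pz).
exists r, (par z :: s); split=> //; first by rewrite /= eC pz.
rewrite /= leqnn; apply: sub_all als => u /leq_trans; apply; exact: ltnW.
Qed.

Lemma path_root_cut r z s : 0 < pos r -> par r = r -> path e z s ->
  pos r <= pos z -> pos r <= pos (last z s).
Proof.
move=> vr rr; elim: s z => //= y s IH z /andP[zy ys] rz; apply: IH => //.
rewrite leqNgt; apply/negP => yr.
by have := root_cut F vr rr (_ : e y z) yr; rewrite eC => /(_ zy); plia.
Qed.

(** Both vertices climb to roots without leaving the vertices found by time [K],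
    and the two roots agree because no root is found later than the vertices
    that it separates. *)
Lemma conn_below K a b : 0 < pos a <= K -> 0 < pos b <= K ->
  (forall r, 0 < pos r <= K -> par r = r -> pos r <= pos a /\ pos r <= pos b) ->
  exists s, [/\ path e a s, last a s = b & all (fun u => pos u <= K) (a :: s)].
Proof.
move=> /andP[va ka] /andP[vb kb] rK.
have [r [s [ps ls rr vr als]]] := to_root va.
have [r' [s' [ps' ls' rr' vr' als']]] := to_root vb.
have ra : pos r <= pos a.
  by have /allP/(_ _ (mem_last a s)) := als; rewrite ls.
have rb : pos r' <= pos b.
  by have /allP/(_ _ (mem_last b s')) := als'; rewrite ls'.
have [|_ rb'] := rK r _ rr; first by rewrite vr (leq_trans ra).
have [|ra' _] := rK r' _ rr'; first by rewrite vr' (leq_trans rb).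
have E : r = r'.
  have := path_root_cut vr rr ps' rb'; have := path_root_cut vr' rr' ps ra'.
  by rewrite ls ls' => ? ?; apply: (pos_inj F vr); plia.
have als2 : all (fun u => pos u <= K) (b :: s').
  by apply: sub_all als' => u /leq_trans; apply.
exists (s ++ rev (belast b s')); split.
- rewrite cat_path ps ls E -ls' rev_path.
  by rewrite (@eq_path _ _ e) // => x y /=; rewrite eC.
- rewrite last_cat ls; case: s' ls' {ps' als' als2} => [|c s'] /= E'.
    by rewrite /= E -E'.
  by rewrite rev_cons last_rcons.
- rewrite -cat_cons all_cat; apply/andP; split.
    by apply: sub_all als => u /leq_trans; apply.
  rewrite all_rev.
  apply/allP => u uin; move/allP: als2; apply.
  by rewrite lastI mem_rcons inE uin orbT.
Qed.

(** The grandparent of [y] and the parent of [x] are joined by vertices found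
    before the parent of [y].  None of them is adjacent to [y], whose parent is
    its first neighbor, so [detour] applies to the path from the parent of [y]
    to [x] through them. *)
Lemma nontree_triangle x y : e x y -> pos x < pos y -> par y != x ->
  [/\ par y != y, par x != x & e (par y) x].
Proof.
move=> xy lxy nyx; have vx := pos_edge F xy.
have vy : 0 < pos y by apply: leq_trans lxy.
have /andP[ny ly] := par_first F xy lxy.
have py := par_adj vy ny.
have vp := pos_edge F py.
have lpx : pos (par y) < pos x.
  by rewrite ltn_neqAle ly andbT; apply: contra nyx => /eqP/(pos_inj F vp)->.
have nx : par x != x.
  apply/eqP => rx; have := root_cut F vx rx py lpx; plia.
split=> //.
have px := par_adj vx nx; have vpx := pos_edge F px.
have lpp : pos (par x) <= pos (par y) by exact: (par_mono F).
case: (eqVneq (par x) (par y)) => [<-//|npp].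
have {}lpp : pos (par x) < pos (par y).
  by rewrite ltn_neqAle lpp andbT; apply: contra npp => /eqP/(pos_inj F vpx)->.
have np : par (par y) != par y.
  apply/eqP => rp; have := root_cut F vp rp px lpp; plia.
have pp := par_adj vp np; have lp := par_lt vp np.
have vpp := pos_edge F pp.
(* the vertices found before the parent of [y] *)
pose K := (pos (par y)).-1.
have [||r /andP[vr rK] rr|s [ps ls als]] :=
  @conn_below K (par (par y)) (par x).
- plia.
- plia.
- split; rewrite leqNgt; apply/negP => lr.
    by have := root_cut F vr rr pp lr; plia.
  by have := root_cut F vr rr px lr; plia.
have nyK u : pos u <= K -> ~~ e y u && (u != y).
  move=> uK; apply/andP; split; last by apply/eqP => E; move: uK; rewrite E; plia.
  apply/negP; rewrite eC => uy.
  have uly : pos u < pos y by plia.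
  by have /andP[_] := par_first F uy uly; plia.
pose w := nth x (par y :: par (par y) :: rcons s x).
have sw : size (rcons s x) = (size s).+1 by rewrite size_rcons.
have pw : path e (par y) (par (par y) :: rcons s x).
  by rewrite /= eC pp rcons_path ps ls px.
have wm : w (size s).+2 = x by rewrite /w /= nth_rcons ltnn eqxx.
rewrite -[X in e _ X]wm -[X in e X _]/(w 0).
apply: (detour G (y := y)) => //.
- by move=> i im; rewrite /w; apply: (pathP x pw); rewrite /= sw.
- case=> // i /andP[_ im]; apply: nyK.
  have -> : w i.+1 = nth x (par (par y) :: s) i.
    rewrite /w /=; case: i im => // i im /=; rewrite nth_rcons ifT //.
  by have /all_nthP/(_ i) := als; apply.
- by rewrite /w /= eC.
- by rewrite wm eC.
- by rewrite wm /w /=; apply/eqP => E; move: lpx; rewrite E ltnn.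
Qed.

End Forest.

(** * Forests of triangles and their colorings *)

Section Siblings.

Variables (V : eqType) (nb : V -> seq V) (pos : V -> nat) (par : V -> V).
Hypothesis G : chordal_lists nb.
Hypothesis F : bfs_forest nb pos par.
Local Notation e := (adj nb).
Local Notation big := (big nb).
Let eC : symmetric e := adj_sym G.
Let eI : irreflexive e := adj_irr G.

Definition tri u a b := [&& e u a, e u b & e a b].

Lemma triC u a b : tri u a b = tri u b a.
Proof. by rewrite /tri (eC a b) andbCA. Qed.

Lemma tri_rot u a b : tri u a b = tri a u b.
Proof. by rewrite /tri (eC u a); case: (e a u); rewrite //= andbC. Qed.

Definition sib x y := [&& e x y, par x != y & par y != x].

Lemma sibC x y : sib x y = sib y x.
Proof. by rewrite /sib eC (andbC (par x != y)). Qed.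

Definition diamond a b c d :=
  [&& tri a b c, tri a b d, c != d & big c].

(** If the parents differ, the parent of [x] also sees the parent of [y], and two
    triangles share the edge from [x] to the parent of [y].  The tip [par x] has
    a third neighbor: its own parent, or, if it is a root, a neighbor that it has
    because [x], found later, has degree at least three. *)
Lemma nontree_diamond x y : e x y -> pos x < pos y -> par y != x ->
  par y != par x -> diamond (par y) x (par x) y.
Proof.
move=> xy lxy nyx npp; have [ny nx px] := nontree_triangle G F xy lxy nyx.
have vx := pos_edge F xy; have vy : 0 < pos y by plia.
have pe := par_adj G F vy ny; have pxe := par_adj G F vx nx.
have vp := pos_edge F pe; have vpx := pos_edge F pxe.
have lpx : pos (par y) < pos x.
  have /andP[_] := par_first F xy lxy.
  rewrite leq_eqVlt => /orP[/eqP/(pos_inj F vp) E|//].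
  by rewrite E eqxx in nyx.
have npp' : par x != par y by rewrite eq_sym.
have [_ _ ppx] := nontree_triangle G F px lpx npp'.
have lpxx := par_lt F vx nx.
have lpp : pos (par x) < pos (par y).
  have := par_mono F vx nx ny lxy; rewrite leq_eqVlt => /orP[/eqP|//].
  by move=> /(pos_inj F vpx) E; rewrite E eqxx in npp'.
have ne u v : pos u != pos v -> u != v by apply: contraNneq => ->.
rewrite /diamond /tri px pe xy (eC (par y) (par x)) ppx (eC x) pxe /=.
apply/andP; split; first by apply: ne; plia.
case: (eqVneq (par (par x)) (par x)) => [rx|nrx].
  apply: contraT => nb'; have /negP[] := root_big F vpx rx nb' (ltnW lpxx).
  by apply: (bigP (a := par x) (b := par y) (c := y)); rewrite // 1?eC //;
    apply: ne; plia.
have e3 := par_adj G F vpx nrx; have l3 := par_lt F vpx nrx.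
by apply: (bigP (a := par (par x)) (b := par y) (c := x)); rewrite // 1?eC //;
  apply: ne; plia.
Qed.

Hypothesis S : forall x y, e x y -> [|| par y == x, par x == y | par x == par y].

Lemma sib_par x y : sib x y ->
  [/\ e x y, par x = par y, par x != x, par y != y & 0 < pos x].
Proof.
move=> /and3P[xy nx ny]; have := S xy.
rewrite (negbTE nx) (negbTE ny) /= => /eqP E; split=> //.
- by rewrite E.
- by rewrite -E.
exact: (pos_edge F xy).
Qed.

Lemma sib_up x y : sib x y -> tri (par x) x y.
Proof.
move=> xy; have [exy E nx ny vx] := sib_par xy.
have vy : 0 < pos y by apply: (pos_edge F (y := x)); rewrite eC.
by rewrite /tri exy {2}E !(par_adj G F).
Qed.

Lemma edgeP x y : e x y ->
  [\/ par y = x /\ pos x < pos y, par x = y /\ pos y < pos x |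
      sib x y /\ [/\ par x = par y, pos (par x) < pos x & pos (par x) < pos y]].
Proof.
move=> xy; have vx := pos_edge F xy.
have vy : 0 < pos y by apply: (pos_edge F (y := x)); rewrite eC.
have nxy := adj_neq G xy.
case: (eqVneq (par y) x) => [E|nyx].
  by constructor 1; split=> //; rewrite -E; apply: (par_lt F) => //; rewrite E.
case: (eqVneq (par x) y) => [E|nx].
  constructor 2; split=> //; rewrite -{1}E; apply: (par_lt F) => //.
  by rewrite E eq_sym.
have xyS : sib x y by apply/and3P.
have [_ E n1 n2 _] := sib_par xyS.
by constructor 3; split=> //; split=> //; [|rewrite E]; apply: (par_lt F).
Qed.

Hypothesis star : forall x y d, sib x y -> sib y d -> d != x -> ~~ big x.

(** The three edges cannot all join siblings: then one of the three vertices
    would see two siblings and its parent, against [star]. *)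
Lemma triP u a b : tri u a b ->
  [\/ sib a b /\ par a = u, sib u a /\ par u = b | sib u b /\ par u = a].
Proof.
move=> /and3P[ua ub ab].
have nua := adj_neq G ua; have nub := adj_neq G ub; have nab := adj_neq G ab.
case: (edgeP ua) => [[p1 l1]|[p1 l1]|[s1 [p1 l1 l1']]];
case: (edgeP ub) => [[p2 l2]|[p2 l2]|[s2 [p2 l2 l2']]];
case: (edgeP ab) => [[p3 l3]|[p3 l3]|[s3 [p3 l3 l3']]];
  try (by exfalso; have := (f_equal pos p1); have := (f_equal pos p2); have := (f_equal pos p3); move=> *; plia);
  try (by exfalso; move/eqP: nua; move/eqP: nub; move/eqP: nab; congruence);
  try (by constructor 1); try (by constructor 2); try (by constructor 3).
exfalso; have := @star a u b; rewrite sibC s1 s2 eq_sym nab => /(_ isT isT isT).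
have va : 0 < pos a by have [] := sib_par s3.
have [_ _ nx _ _] := sib_par s3.
move=> /negP[]; apply: (bigP (a := par a) (b := u) (c := b)) => //.
- by rewrite eC (par_adj G F).
- by rewrite eC.
- by apply/eqP => E; move: l1; rewrite p1 E ltnn.
- by apply/eqP => E; move: l3'; rewrite E ltnn.
Qed.

(** If the common edge joins siblings, both tips are their parent.  Otherwise both
    tips are siblings of its lower end, and [star] applies to them. *)
Lemma tip_small a b c d : tri a b c -> tri a b d -> c != d -> ~~ big c.
Proof.
move=> tc td cd; apply/negP => bc.
have key x y z t : sib x y -> tri x y z -> tri x y t -> z != t -> False.
  move=> xy; have [_ E n1 n2 vx] := sib_par xy.
  have vy : 0 < pos y by have := sibC x y; rewrite xy => /esym/sib_par[].
  have l1 := par_lt F vx n1; have l2 := par_lt F vy n2.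
  have up w : tri x y w -> w = par x.
    move=> /triP[[yw px]|[_ -> //]|[xw py]].
    - by move: n1; rewrite E px eqxx.
    - by move: n2; rewrite -E py eqxx.
  by move=> /up-> /up->; rewrite eqxx.
have down x y z t : par y = x -> tri x y z -> tri x y t -> z != t -> ~ big z.
  move=> pyx tz tt zt bz.
  have yS w : tri x y w -> sib y w.
    move=> tw; case/triP: (tw) => [[//]|[xy _]|[xw px]].
      by case: (key _ _ _ _ xy tz tt zt).
    case/and3P: tw => xy _ _; case: (edgeP xy) => [[_ l1]|[E l1]|[xy' _]].
    - have [_ _ n1 _ vx] := sib_par xw.
      have := par_lt F vx n1; rewrite px; plia.
    - have [_ _ n1 _ vx] := sib_par xw.
      have ny : par y != y.
        by apply: contraTneq l1 => ny; rewrite -[in pos y]ny pyx ltnn.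
      have vy := pos_edge F (_ : e y x).
      have := par_lt F (vy _) ny; rewrite pyx eC => /(_ xy); plia.
    - by case: (key _ _ _ _ xy' tz tt zt).
  have := star (_ : sib z y) (yS _ tt) _.
  by rewrite sibC eq_sym => /(_ (yS _ tz) zt) /negP[].
case/and3P: (tc) => ab _ _; case: (edgeP ab) => [[p _]|[p _]|[s _]].
- exact: (down _ _ _ _ p tc td cd).
- by apply: (down _ _ _ _ p _ _ cd bc); rewrite tri_rot.
- exact: (key _ _ _ _ s tc td cd).
Qed.

Definition lone x := forall y, ~~ sib x y.

Lemma lone_tri x a b : 0 < pos x -> par x != x -> lone x ->
  tri x a b -> a != par x.
Proof.
move=> vx nx lx t; apply/eqP => E; have l := par_lt F vx nx.
case: (triP t) => [[ab pa]|[xa _]|[xb _]].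
- have [_ _ na _ va] := sib_par ab; have := par_lt F va na.
  by rewrite pa E; plia.
- by have := lx a; rewrite xa.
- by have := lx b; rewrite xb.
Qed.

Variables (T sh : pred V) (hp sb : V -> option V).

Hypothesis sbP : forall x y, sb x = Some y -> sib x y.
Hypothesis sbN : forall x y, sb x = None -> ~~ sib x y.
Hypothesis TI : forall u a b, tri u a b -> T u.
Hypothesis TE : forall u, T u -> exists a b, tri u a b.
Hypothesis shI : forall u a b c d, tri u a b -> tri u c d ->
  a != c -> a != d -> b != c -> b != d -> sh u.
Hypothesis shX : forall u a b, tri u a b -> sh u -> ~~ big a \/ ~~ big b.
Hypothesis shD : forall u v, e u v -> sh u -> sh v -> False.
Hypothesis hpP : forall p x, hp p = Some x -> ~~ T p && big p.
Hypothesis hpH : forall x, 0 < pos x -> par x != x -> sb x = None ->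
  T x || hp x -> ~~ T (par x) /\ (big (par x) -> hp (par x) = Some x).

(** A linear order that refines the order by degree, so that siblings compare
    differently in the two directions. *)
Definition lower x y := (size (nb x) < size (nb y)) ||
  ((size (nb x) == size (nb y)) && (pos x < pos y)).
(** The bit of a vertex with a sibling.  Below a shared parent the lower sibling
    takes the third color: it has degree two, so it serves its own edges, and
    the larger one repeats its grandparent's color and serves its edge upwards.
    Below any other parent the larger sibling takes the third color; it is then
    the only neighbor of its parent with that color. *)
Definition role x y := sh (par x) == lower x y.

(** Below a vertex in a triangle, all children outside the triangle agree: they
    avoid the bit of the parent if the parent has a sibling, and repeat the
    color of the grandparent if it has none.  Below a vertex [p] in no triangle,
    the bit is set for the child that claims [p], or for all children if no
    child does.  The counter only allows the recursion to stop: the second call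
    is made on a vertex with a sibling. *)
Fixpoint bitn k x :=
  if sb x is Some y then role x y else
  if T (par x) then
    if k is k'.+1 then (sb (par x) : bool) && ~~ bitn k' (par x) else true
  else (hp (par x) == None) || (hp (par x) == Some x).
Definition bit := bitn 1.

Variable f : V -> nat.
(** The color of the grandparent of a child of [p], and some color different from
    that of [p] when [p] is a root. *)
Definition alpha p := if par p == p then 1 else f (par p).
Definition beta p := 3 - (f p + alpha p).
Hypothesis fE : forall x, 0 < pos x -> f x =
  if par x == x then 0 else if bit x then beta (par x) else alpha (par x).

Lemma par_vis x : 0 < pos x -> 0 < pos (par x).
Proof.
move=> vx; case: (eqVneq (par x) x) => [->//|nx].
exact: (pos_edge F (par_adj G F vx nx)).
Qed.

Lemma f_range x : 0 < pos x -> [/\ f x < 3, alpha x < 3 & f x != alpha x].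
Proof.
have [k] := ubnP (pos x); elim: k x => // k IH x xk vx.
case: (boolP (par x == x)) => rx.
  by have := fE vx; rewrite /alpha rx => ->.
have lx := par_lt F vx rx; have lk : pos (par x) < k by plia.
have := fE vx; rewrite {2 3}/alpha (negbTE rx).
have [] := IH (par x) lk (par_vis vx).
by rewrite /beta; case: ifP => _ *; split; plia.
Qed.

Lemma fN x : 0 < pos x -> par x != x ->
  f x = if bit x then beta (par x) else alpha (par x).
Proof. by move=> vx nx; rewrite fE // (negbTE nx). Qed.

Lemma alphaN p : par p != p -> alpha p = f (par p).
Proof. by rewrite /alpha => /negbTE->. Qed.

Lemma beta_neq p : 0 < pos p -> beta p != f p /\ beta p != alpha p.
Proof. by move=> /f_range[]; rewrite /beta; plia. Qed.

Lemma f_par x : 0 < pos x -> par x != x -> f x != f (par x).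
Proof.
move=> vx nx; rewrite fN //; have [b1 b2] := beta_neq (par_vis vx).
have [_ _] := f_range (par_vis vx).
by case: ifP => // _; rewrite eq_sym.
Qed.

Lemma lowerC x y : e x y -> lower x y = ~~ lower y x.
Proof.
move=> xy; rewrite /lower.
by case: (adj_pos G F xy) => ?; case: (ltngtP (size (nb x)) (size (nb y))) => //=; plia.
Qed.

(** The two siblings and the parent of [x] are three neighbors of [x], and [star]
    applies to both ends of the path of siblings. *)
Lemma sib_big x y z : sib x y -> sib x z -> y != z ->
  [/\ big x, ~~ big y & ~~ big z].
Proof.
move=> xy xz yz; have [exy E n1 _ vx] := sib_par xy.
have [exz E' _ _ _] := sib_par xz.
have [eyx _ n2 _ vy] : [/\ e y x, par y = par x, par y != y, par x != x & 0 < pos y].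
  by apply: sib_par; rewrite sibC.
have [ezx _ n3 _ vz] : [/\ e z x, par z = par x, par z != z, par x != x & 0 < pos z].
  by apply: sib_par; rewrite sibC.
split.
- apply: (bigP (a := par x) (b := y) (c := z)) => //.
  + by rewrite eC (par_adj G F).
  + by rewrite E.
  + by rewrite E'.
- by apply: (star (x := y) (y := x) (d := z)); rewrite // 1?sibC // eq_sym.
- by apply: (star (x := z) (y := x) (d := y)); rewrite // 1?sibC.
Qed.

Lemma bit_sib x y : sib x y -> bit x = role x y.
Proof.
move=> xy; rewrite /bit /=; case E: (sb x) => [z|]; last first.
  by have := sbN y E; rewrite xy.
have xz := sbP E; case: (eqVneq z y) => [->//|zy].
have [bx bz by'] := sib_big xz xy zy.
rewrite /role /lower; congr (_ == _); move: bx bz by'.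
rewrite !bigE; plia.
Qed.

Lemma bit_opp x y : sib x y -> bit x = ~~ bit y.
Proof.
move=> xy; have yx : sib y x by rewrite sibC.
have [exy E _ _ _] := sib_par xy.
by rewrite (bit_sib xy) (bit_sib yx) /role E (lowerC exy); case: sh lower => [] [].
Qed.

Lemma bit_child x : sb x = None -> bit x =
  if T (par x) then (sb (par x) : bool) && ~~ bit (par x)
  else (hp (par x) == None) || (hp (par x) == Some x).
Proof.
move=> sx; rewrite {1}/bit /= sx; case: ifP => // _.
by rewrite /bit /=; case: (sb (par x)).
Qed.

(** The end [x] serves the edge [xy]. *)
Definition only x y := forall z, e x z -> f z = f y -> z = y.

Lemma childP x z : e x z ->
  [\/ z = par x /\ par x != x, sib x z | [/\ par z = x, par z != z & 0 < pos z]].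
Proof.
move=> xz; have := adj_neq G xz.
have vz : 0 < pos z by apply: (pos_edge F (y := x)); rewrite eC.
case: (edgeP xz) => [[p l]|[p l]|[s _]] n.
- by constructor 3; rewrite p.
- by constructor 1; rewrite p eq_sym.
- by constructor 2.
Qed.

Lemma sib_T x y : sib x y -> T x /\ T (par x).
Proof.
by move=> /sib_up t; split; [move: t; rewrite tri_rot|move: t]; apply: TI.
Qed.

Lemma sb_none x y : ~~ T x -> sib x y = false.
Proof. by move=> Tx; apply: contraNF Tx => /sib_T[]. Qed.

(** No child claims [x], hence all children of [x] take the third color, which is
    not the color of the parent of [x]. *)
Lemma only_cold x : 0 < pos x -> par x != x -> ~~ T x -> hp x = None ->
  only x (par x).
Proof.
move=> vx nx Tx hx z xz fz; case: (childP xz) => [[]//|s|[pz nz vz]].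
  by rewrite sb_none in s.
have sz : sb z = None.
  case E: (sb z) => [y|//]; have [_] := sib_T (sbP E).
  by rewrite pz (negbTE Tx).
have := fN vz nz; rewrite (bit_child sz) pz (negbTE Tx) hx /= fz.
by have [_] := beta_neq vx; rewrite (alphaN nx) => /eqP nb' /esym.
Qed.

(** The parent either has degree at most two, or it is claimed by [x] alone, and then the
    other children repeat the color of the grandparent. *)
Lemma only_hot x : 0 < pos x -> par x != x -> sb x = None -> T x || hp x ->
  only (par x) x.
Proof.
move=> vx nx sx hx; have [Tp hpp] := hpH vx nx sx hx.
have vp := par_vis vx.
have px := par_adj G F vx nx.
have [nb1 nb2] := beta_neq vp.
have fx : f x = beta (par x).
  rewrite fN // bit_child // (negbTE Tp).
  case: (boolP (big (par x))) => [/hpp->|bp]; first by rewrite eqxx orbT.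
  case E: (hp (par x)) => [y|//]; have /andP[_] := hpP E.
  by rewrite (negbTE bp).
move=> z pz fz; case: (childP pz) => [[zp np]|s|[pzz nz vz]].
- by move: nb2; rewrite -fx -fz zp alphaN // eqxx.
- by rewrite sb_none in s.
have sz : sb z = None.
  case E: (sb z) => [y|//]; have [_] := sib_T (sbP E).
  by rewrite pzz (negbTE Tp).
case: (boolP (big (par x))) => [/hpp E|bp].
  have := fN vz nz; rewrite bit_child // pzz (negbTE Tp) E /=.
  case: eqP => [[//]|_] fz'; move: nb2.
  by rewrite -fx -fz fz' eqxx.
case: (eqVneq (par (par x)) (par x)) => [rp|np].
  have := root_big F vp rp bp (ltnW (par_lt F vx nx)).
  case/orP: hx => [/TE[a [b t]]|]; last first.
    by case E: (hp x) => [y|//] _; have /andP[_ ->] := hpP E.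
  have lx : lone x by move=> w; apply: sbN.
  have na := lone_tri vx nx lx t.
  have nb' : b != par x by move: t; rewrite triC; apply: lone_tri.
  case/and3P: t => xa xb ab /negP[].
  apply: (bigP (a := par x) (b := a) (c := b)); rewrite // 1?eq_sym //.
    by rewrite eC.
  by rewrite eq_sym (adj_neq G).
have pp := par_adj G F vp np; rewrite eC in pp.
case: (not_bigP bp pp px _ pz) => // [|zp].
  apply: contraTneq (par_lt F vp np) => ->.
  by rewrite -leqNgt ltnW // (par_lt F).
by move: nz; rewrite pzz zp => ?; move: nb2; rewrite -fx -fz zp alphaN ?eqxx.
Qed.

Lemma only_small y x : sib y x -> ~~ big y -> only y x /\ only y (par y).
Proof.
move=> yx by'; have [eyx E n1 n2 vy] := sib_par yx.
have vx : 0 < pos x by move: yx; rewrite sibC => /sib_par[].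
have yp : e y (par y) by rewrite eC (par_adj G F).
have fx := f_par vx n2; rewrite -E in fx.
have xp : x != par y by rewrite E eq_sym.
split=> z yz fz; case: (not_bigP by' eyx yp xp yz) => // zE;
  by move: fx; rewrite -zE fz ?eqxx // eq_sym -zE fz eqxx.
Qed.

Lemma child_of_sib x y z : sib x y -> ~~ sh x ->
  par z = x -> par z != z -> 0 < pos z ->
  f z = if bit x then alpha x else beta x.
Proof.
move=> xy shx pz nz vz; rewrite fN // pz.
have sz : sb z = None.
  case E: (sb z) => [w|//]; case/negP: shx.
  have zw := sib_up (sbP E); rewrite pz in zw.
  have xy' := sib_up xy; rewrite tri_rot in xy'.
  have [_ _ nx _ vx] := sib_par xy.
  have lx := par_lt F vx nx; have lz := par_lt F vz nz; rewrite pz in lz.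
  have [_ E' _ nw vw] := sib_par (sbP E).
  have vw' : 0 < pos w by move: (sbP E); rewrite sibC => /sib_par[].
  have lw := par_lt F vw' nw; rewrite -E' pz in lw.
  have [_ Ey _ ny _] := sib_par xy.
  have nyx : par y != x by rewrite -Ey.
  apply: (shI xy' zw); apply/eqP => H.
  - by move: lx; rewrite H; plia.
  - by move: lx; rewrite H; plia.
  - by move: nyx; rewrite H pz eqxx.
  - by move: nyx; rewrite H -E' pz eqxx.
rewrite bit_child // pz; have [-> _] := sib_T xy.
have -> : (sb x : bool) by case E: (sb x) => [//|]; have := sbN y E; rewrite xy.
by case: (bit x).
Qed.

(** As [x] is not shared, its children have the opposite bit, hence the third
    color, and its siblings differ from the parent anyway. *)
Lemma only_up x y : sib x y -> ~~ sh x -> ~~ bit x -> only x (par x).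
Proof.
move=> xy shx bx z xz fz; have [_ _ nx _ vx] := sib_par xy.
case: (childP xz) => [[]//|s|[pz nz vz]].
  have [_ E _ nz _] := sib_par s.
  have vz : 0 < pos z by move: s; rewrite sibC => /sib_par[].
  by have := f_par vz nz; rewrite -E fz eqxx.
have := child_of_sib xy shx pz nz vz; rewrite fz (negbTE bx) => E.
by have [_] := beta_neq vx; rewrite alphaN // E eqxx.
Qed.

Lemma sib_big_par x y : sib x y -> big x -> big (par x).
Proof.
move=> xy bx; have [exy E nx ny vx] := sib_par xy.
have vy : 0 < pos y by move: xy; rewrite sibC => /sib_par[].
have vp := par_vis vx; have lx := par_lt F vx nx; have ly := par_lt F vy ny.
case: (eqVneq (par (par x)) (par x)) => [rp|np].
  apply: contraT => bp; have := root_big F vp rp bp (ltnW lx).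
  by rewrite bx.
have lp := par_lt F vp np; rewrite -E in ly.
apply: (bigP (a := par (par x)) (b := x) (c := y)).
- by rewrite eC (par_adj G F).
- exact: (par_adj G F).
- by rewrite E (par_adj G F).
- by apply/eqP => H; move: lp; rewrite H; plia.
- by apply/eqP => H; move: lp; rewrite H; plia.
exact: (adj_neq G).
Qed.

(** The new case is the edge from a large sibling [x] in a triangle to its parent.
    Below a shared parent, [x] is not shared by [shD] and serves the edge.  Below
    any other parent, the parent serves it if [x] has the third color; if not,
    the sibling of [x] is large as well, and [shX] lets [x] serve it. *)
Lemma only_edge x y : e x y -> only x y \/ only y x.
Proof.
have sharers u a b : sib a b -> par a = u -> sh u -> ~~ big a \/ ~~ big b.
  by move=> ab <-; apply: shX; apply: sib_up.
have tree x' : 0 < pos x' -> par x' != x' -> only x' (par x') \/ only (par x') x'.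
  move=> vx nx; case sx: (sb x') => [y'|]; last first.
    case: (boolP (T x' || hp x')) => [hx|]; first by right; apply: only_hot.
    rewrite negb_or => /andP[Tx]; case E: (hp x') => // _; left.
    exact: only_cold.
  have xy := sbP sx; have [exy E _ ny _] := sib_par xy.
  have yx : sib y' x' by rewrite sibC.
  case: (boolP (big x')) => [bx|bx]; last by left; have [] := only_small xy bx.
  have bp := sib_big_par xy bx.
  case: (boolP (sh (par x'))) => shp.
    have shx : ~~ sh x'.
      apply/negP => shx; apply: (shD _ shx shp).
      by rewrite eC (par_adj G F).
    left; apply: (only_up xy shx).
    rewrite (bit_sib xy) /role shp eq_sym eqb_id /lower.
    case: (sharers _ _ _ xy erefl shp) => [|bgy]; first by rewrite bx.
    by move: bx bgy; rewrite !bigE; plia.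
  case: (boolP (bit x')) => bitx; last first.
    left; apply: (only_up xy) => //; apply/negP => shx.
    have lxy : lower x' y'.
      by move: bitx; rewrite (bit_sib xy) /role (negbTE shp); case: lower.
    have by' : big y' by move: bx lxy; rewrite /lower !bigE; plia.
    have t := sib_up xy; rewrite tri_rot in t.
    by case: (shX t shx); rewrite ?bp ?by'.
  right=> z pz fz; have vp := par_vis vx.
  have [nb1 nb2] := beta_neq vp.
  have fx : f x' = beta (par x') by rewrite fN // bitx.
  have nosib w : ~~ sib (par x') w.
    apply/negP => pw; case/negP: shp.
    have [_ Ew np _ _] := sib_par pw.
    have t1 := sib_up xy; have t2 := sib_up pw; rewrite tri_rot in t2.
    have lp := par_lt F vp np.
    have lx := par_lt F vx nx.
    have vy : 0 < pos y' by move: yx => /sib_par[].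
    have ly := par_lt F vy ny; rewrite -E in ly.
    have nw : par w != par x' by rewrite -Ew.
    apply: (shI t1 t2); apply/eqP => H.
    - by move: lp; rewrite -H; plia.
    - by move: nw; rewrite -H eqxx.
    - by move: lp; rewrite -H; plia.
    - by move: nw; rewrite -H E eqxx.
  case: (childP pz) => [[zp np]|s|[pzz nz vz]].
  - by move: nb2; rewrite -fx -fz zp alphaN // eqxx.
  - by have := nosib z; rewrite s.
  have bz : bit z.
    have := fN vz nz; rewrite pzz fz fx; case: ifP => // _ E'.
    by move: nb2; rewrite E' eqxx.
  case sz: (sb z) => [z'|]; last first.
    move: bz; rewrite bit_child // pzz; have [_ ->] := sib_T xy.
    by case E': (sb (par x')) => [w|//]; have := nosib w; rewrite (sbP E').
  have zz' := sbP sz; have [_ Ez _ _ _] := sib_par zz'.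
  have t1 := sib_up xy; have t2 := sib_up zz'; rewrite pzz in t2.
  case: (eqVneq x' z) => [//|xz]; case: (eqVneq y' z) => [yz|yz].
    by have := bit_opp xy; rewrite bitx yz bz.
  case: (eqVneq x' z') => [xz'|xz'].
    by have := bit_opp zz'; rewrite -xz' bitx bz.
  case: (eqVneq y' z') => [yz'|yz']; last first.
    by case/negP: shp; apply: (shI t1 t2).
  have := zz'; rewrite -yz' sibC => yz2.
  by have [_] := sib_big yx yz2 xz; rewrite bx.
move=> xy; case: (edgeP xy) => [[p l]|[p l]|[s _]].
- rewrite -p; apply/or_comm; apply: tree.
    exact: (leq_trans _ l).
  by rewrite p (adj_neq G).
- rewrite -p; apply: tree; first exact: (leq_trans _ l).
  by rewrite p eq_sym (adj_neq G).
have key a b : sib a b -> bit a -> only a b \/ only b a.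
  move=> ab ba; have bab : sib b a by rewrite sibC.
  case: (boolP (big a)) => bga; last by left; have [] := only_small ab bga.
  case: (boolP (big b)) => bgb; last by right; have [] := only_small bab bgb.
  have bp := sib_big_par bab bgb.
  have [_ E na nb' va] := sib_par ab.
  have vb : 0 < pos b by move: bab => /sib_par[].
  have t := sib_up bab; rewrite tri_rot in t.
  have fb := f_par vb nb'.
  have shb : ~~ sh b by apply/negP => /(shX t); rewrite bp bga => -[].
  have nbit : ~~ bit b by rewrite -(bit_opp ab).
  have fa := f_par va na.
  have pa : f a != f b.
    by rewrite (fN va na) (fN vb nb') ba (negbTE nbit) E;
      have [] := beta_neq (par_vis vb).
  have sha : ~~ sh a.
    by apply/negP; rewrite tri_rot triC in t; move: (sib_up ab); rewrite tri_rot
      => /shX sx /sx; rewrite E bp bgb => -[].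
  left=> z az fz; case: (childP az) => [[zp _]|s'|[pz nz vz]].
  - by move: fb; rewrite -fz zp E eqxx.
  - case: (eqVneq b z) => [//|bz].
    by have [_] := sib_big ab s' bz; rewrite bgb.
  have := child_of_sib ab sha pz nz vz; rewrite ba alphaN // fz E => fb'.
  by rewrite fb' eqxx in fb.
by case: (boolP (bit x)) => bx; [exact: key | apply/or_comm; apply: key;
  rewrite 1?sibC // (bit_opp (y := x)) // sibC].
Qed.

End Siblings.

(** * Copies of the small obstructions *)

Section Copies.

Variables (V : eqType) (nb : V -> seq V).
Hypothesis G : chordal_lists nb.
Local Notation e := (adj nb).
Local Notation big := (big nb).
Local Notation tri := (tri nb).
Let eC : symmetric e := adj_sym G.
Let eI : irreflexive e := adj_irr G.

(** The list [l] consists of the vertices of an induced copy of [h]; only the set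
    of its entries and its length count, since that is all that a certificate
    has to provide. *)
Definition copy (U : finType) (h : rel U) (l : seq V) : Prop :=
  exists g : U -> V,
    [/\ injective g, forall x y, e (g x) (g y) = h x y,
        l =i [seq g x | x <- enum U] & size l = #|U|].

Lemma copy_uniq (U : finType) (h : rel U) l : copy h l -> uniq l.
Proof.
case=> g [gi _ lE sl]; apply: (leq_size_uniq (s1 := [seq g x | x <- enum U])).
- by rewrite map_inj_uniq ?enum_uniq.
- by move=> x; rewrite lE.
- by rewrite size_map -cardE sl.
Qed.

Lemma copy_eq (U : finType) (h : rel U) l l' : l =i l' -> size l = size l' ->
  copy h l -> copy h l'.
Proof.
move=> ll sll [g [gi ge lE sl]]; exists g; split=> //; last by rewrite -sll.
by move=> x; rewrite -ll.
Qed.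

Lemma copy_list k (h : rel 'I_k) x0 l : size l = k -> uniq l ->
  (forall i j : 'I_k, h i j = h j i) -> (forall i : 'I_k, h i i = false) ->
  (forall i j : 'I_k, i < j -> e (nth x0 l i) (nth x0 l j) = h i j) -> copy h l.
Proof.
move=> sl ul hC hI he; exists (fun i : 'I_k => nth x0 l i); split.
- move=> i j /eqP; rewrite nth_uniq ?sl // => /eqP; exact: ord_inj.
- move=> i j; case: (ltngtP i j) => ij; first exact: he.
    by rewrite eC hC he.
  by rewrite (ord_inj ij) eI hI.
- move=> x; rewrite -{1}(mkseq_nth x0 l) /mkseq sl -val_enum_ord -map_comp.
  by [].
- by rewrite card_ord.
Qed.

Definition obs (l : seq V) : Prop :=
  [\/ copy K4 l \/ copy kite l, copy gem l, copy X127 l |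
      exists2 k, 4 <= k & copy (@D_graph k) l].

Lemma graph_of_edgesC n s (i j : 'I_n) : graph_of_edges s i j = graph_of_edges s j i.
Proof. by rewrite /graph_of_edges orbC. Qed.

Lemma K4_copy a b c d : e a b -> e a c -> e a d -> e b c -> e b d -> e c d ->
  copy K4 [:: a; b; c; d].
Proof.
move=> ab ac ad bc bd cd; have N := adj_neq G.
apply: (copy_list (x0 := a)) => //=.
- by rewrite !inE !negb_or !N.
- by move=> i j; rewrite /K4 eq_sym.
- by move=> i; rewrite /K4 eqxx.
by case=> [[|[|[|[|i]]]] hi] // [[|[|[|[|j]]]] hj] //= _; rewrite ?ab ?ac ?ad ?bc ?bd ?cd.
Qed.

(** If the third neighbor [z] of the tip [c] saw the other tip [d], then the
    cycles [z c a d] and [z c b d] would make it adjacent to both [a] and [b]. *)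
Lemma diamond_tip a b c d z : tri a b c -> tri a b d -> c != d -> ~~ e c d ->
  e c z -> z != a -> z != b ->
  [/\ e z a -> ~~ e z b -> copy gem [:: z; c; b; d; a],
      ~~ e z a -> e z b -> copy gem [:: z; c; a; d; b] &
      ~~ e z a -> ~~ e z b -> copy kite [:: a; b; c; d; z]].
Proof.
move=> tc td ncd cd cz za zb; have N := adj_neq G.
have [ab ac bc] : [/\ e a b, e a c & e b c] by apply/and3P.
have [_ ad bd] : [/\ e a b, e a d & e b d] by apply/and3P.
have zd : z != d by apply: contraNneq cd => <-.
have ca : e c a by rewrite eC.
have cb : e c b by rewrite eC.
have da : e d a by rewrite eC.
have db : e d b by rewrite eC.
have ba : e b a by rewrite eC.
have zc : e z c by rewrite eC.
have dc : ~~ e d c by rewrite eC.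
have nzd x : z != x -> e c x -> e x d -> ~~ e z x -> ~~ e z d.
  move=> zx cx xd nzx; apply/negP => dz; rewrite eC in dz; rewrite eq_sym in zx.
  case: (no_C4 G cx xd dz zc ncd zx); first by rewrite (negbTE cd).
  by rewrite eC (negbTE nzx).
have symm x y : e x y = e y x := eC x y.
split=> za' zb'.
- have zd' := nzd b zb cb bd zb'.
  apply: (copy_list (x0 := a)) => //=.
  + by rewrite !inE !negb_or ncd zd za zb !N.
  + exact: graph_of_edgesC.
  + by case=> [[|[|[|[|[|i]]]]] hi].
  case=> [[|[|[|[|[|i]]]]] hi] // [[|[|[|[|[|j]]]]] hj] //= _; exact: negbTE.
- have zd' := nzd a za ca ad za'.
  apply: (copy_list (x0 := a)) => //=.
  + by rewrite !inE !negb_or ncd zd za zb !N.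
  + exact: graph_of_edgesC.
  + by case=> [[|[|[|[|[|i]]]]] hi].
  case=> [[|[|[|[|[|i]]]]] hi] // [[|[|[|[|[|j]]]]] hj] //= _; exact: negbTE.
- have zd' := nzd b zb cb bd zb'.
  have [az bz dz] : [/\ ~~ e a z, ~~ e b z & ~~ e d z].
    by rewrite !(symm _ z).
  apply: (copy_list (x0 := a)) => //=.
  + by rewrite !inE !negb_or ncd !(eq_sym _ z) zd za zb !N.
  + exact: graph_of_edgesC.
  + by case=> [[|[|[|[|[|i]]]]] hi].
  case=> [[|[|[|[|[|i]]]]] hi] // [[|[|[|[|[|j]]]]] hj] //= _; exact: negbTE.
Qed.

Hypothesis tips : forall a b c d, tri a b c -> tri a b d -> c != d -> ~~ big c.

(** Any further edge among the seven vertices would either put two triangles on a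
    common edge with a large tip, or close a cycle of length four without
    chords. *)
Lemma X127_copy u v w c d p q : tri u v w -> tri u c d ->
  v \notin [:: c; d] -> w \notin [:: c; d] ->
  e v p -> p != u -> p != w -> e w q -> q != u -> q != v ->
  copy X127 [:: u; v; w; c; d; p; q].
Proof.
move=> t1 t2; rewrite !inE !negb_or => /andP[vc vd] /andP[wc wd].
move=> vp pu pw wq qu qv; have N := adj_neq G.
have [uv uw vw] : [/\ e u v, e u w & e v w] by apply/and3P.
have [uc ud cd] : [/\ e u c, e u d & e c d] by apply/and3P.
have vu : e v u by rewrite eC.
have wu : e w u by rewrite eC.
have wv : e w v by rewrite eC.
have dc : e d c by rewrite eC.
have cu : e c u by rewrite eC.
have du : e d u by rewrite eC.
have pv : e p v by rewrite eC.
have qw : e q w by rewrite eC.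
have bv : big v by apply: (bigP vu vw vp); rewrite 1?eq_sym // N.
have bw : big w by apply: (bigP wu wv wq); rewrite 1?eq_sym // N.
have bu : big u by apply: (bigP uv uw uc); rewrite // N.
have noc x y t : tri u x y -> y != t -> e u t -> big y -> ~~ e x t.
  move=> t3 yt ut; apply: contraL => xt; apply: (@tips u x y t) => //.
  by case/and3P: t3 => ux _ _; rewrite /tri ux ut xt.
have t1' : tri u w v by rewrite /tri uw uv wv.
have nvc : ~~ e v c by apply: (noc _ w).
have nvd : ~~ e v d by apply: (noc _ w).
have nwc : ~~ e w c by apply: (noc _ v).
have nwd : ~~ e w d by apply: (noc _ v).
have t3 : tri v w u by rewrite /tri vw vu wu.
have alone x y z t : tri x y z -> big z -> e y t -> t != z -> ~~ e x t.
  move=> xyz bz yt tz; apply/negP => xt.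
  have t4 : tri x y t by case/and3P: xyz => xy _ _; rewrite /tri xy xt yt.
  by rewrite eq_sym in tz; have := tips xyz t4 tz; rewrite bz.
have nup : ~~ e u p by apply: (alone _ v w).
have nuq : ~~ e u q by apply: (alone _ w v).
have nwp : ~~ e w p by apply: (alone _ v u); rewrite // /tri wv wu vu.
have nvq : ~~ e v q by apply: (alone _ w u).
have fork x y z t : e x y -> e y z -> e z t -> ~~ e x z -> ~~ e y t -> x != z ->
    y != t -> ~~ e x t.
  move=> xy yz zt nxz nyt xz yt; rewrite eC; apply/negP => tx.
  by case: (no_C4 G xy yz zt tx xz yt); apply/negP.
have npu : ~~ e p u by rewrite eC.
have nqu : ~~ e q u by rewrite eC.
have npw : ~~ e p w by rewrite eC.
have npc : ~~ e c p by rewrite eC; apply: (fork p v u c); rewrite // 1?eq_sym.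
have npd : ~~ e d p by rewrite eC; apply: (fork p v u d); rewrite // 1?eq_sym.
have nqc : ~~ e c q by rewrite eC; apply: (fork q w u c); rewrite // 1?eq_sym.
have nqd : ~~ e d q by rewrite eC; apply: (fork q w u d); rewrite // 1?eq_sym.
have npq : ~~ e p q by apply: (fork p v w q); rewrite // 1?eq_sym.
have ne x y z : e x y -> ~~ e x z -> y != z by move=> xy; apply: contraNneq => <-.
have [cp dp] : c != p /\ d != p by rewrite !(ne u).
have [cq dq] : c != q /\ d != q by rewrite !(ne u).
have pq : p != q by rewrite (ne v).
apply: (copy_list (x0 := u)) => //=.
+ by rewrite !inE !negb_or vc vd wc wd cp dp cq dq pq !(eq_sym _ p) !(eq_sym _ q) pu pw qu qv !N.
+ exact: graph_of_edgesC.
+ by case=> [[|[|[|[|[|[|[|i]]]]]]] hi].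
by case=> [[|[|[|[|[|[|[|i]]]]]]] hi] // [[|[|[|[|[|[|[|j]]]]]]] hj] //= _; exact: negbTE.
Qed.

End Copies.

(** * Copies of the graphs D_k *)

Section Spines.

Variables (V : eqType) (nb : V -> seq V).
Hypothesis G : chordal_lists nb.
Local Notation e := (adj nb).
Local Notation big := (big nb).
Local Notation tri := (tri nb).
Let eC : symmetric e := adj_sym G.
Let eI : irreflexive e := adj_irr G.

Section OneSpine.

Variables (m : nat) (s lf : nat -> V) (a c : V).
Hypothesis m0 : 0 < m.

(** The vertices of D_k, for [k = m + 3], are grouped around its inner spine
    [s 0, ..., s m]: bag [i] holds [s i], the vertex [lf i] hanging from it and, at the
    two ends, the remaining vertex [a] or [c] of the triangle.  Two different
    bags are joined at most by the spine edge, so a copy of D_k is recognized by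
    comparing bags. *)
Definition in_bag i x :=
  [|| x == s i, x == lf i, (i == 0) && (x == a) | (i == m) && (x == c)].

Section Bags.

Hypothesis leafE : forall i, i <= m -> e (s i) (lf i).
Hypothesis triA : tri (s 0) (lf 0) a.
Hypothesis triC : tri (s m) (lf m) c.
Hypothesis cross : forall i j x y, i < j <= m -> in_bag i x -> in_bag j y ->
  (x != y) && (e x y == [&& j == i.+1, x == s i & y == s j]).

Let U := ('I_m.+3 + 'I_m.+1)%type.

Definition D_map (u : U) : V :=
  match u with
  | inl i => if i == 0 :> nat then a else if i == m.+2 :> nat then c else s i.-1
  | inr j => lf j
  end.
Definition bag_of (u : U) : nat :=
  match u with inl i => minn i.-1 m | inr j => j end.
Definition on_spine (u : U) : bool :=
  if u is inl i then 0 < i < m.+2 else false.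

Lemma bag_of_le u : bag_of u <= m.
Proof. by case: u => [i|j] /=; [plia | case: j]. Qed.

Lemma D_map_bag u : in_bag (bag_of u) (D_map u).
Proof.
case: u => [[i im]|[j jm]]; rewrite /in_bag /=; last by rewrite eqxx orbT.
case: (posnP i) => [->|i0] /=; first by rewrite min0n !eqxx !orbT.
case: (eqVneq i m.+2) => [->|im'] /=.
  by rewrite (_ : minn m.+1 m = m) ?eqxx ?orbT //; plia.
by rewrite (_ : minn i.-1 m = i.-1) ?eqxx //; plia.
Qed.

Lemma D_map_spine u : (D_map u == s (bag_of u)) = on_spine u.
Proof.
have [sa _ _] := and3P triA; have [sc _ _] := and3P triC.
have [_ sa' _] := and3P triA; have [_ sc' _] := and3P triC.
case: u => [[i im]|[j jm]] /=; last first.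
  by apply/negbTE; rewrite eq_sym (adj_neq G) ?leafE.
case: (posnP i) => [->|i0] /=.
  by rewrite min0n; apply/negbTE; rewrite eq_sym (adj_neq G).
case: (eqVneq i m.+2) => [->|im'] /=.
  rewrite (_ : minn m.+1 m = m) ?ltnn; last by plia.
  by apply/negbTE; rewrite eq_sym (adj_neq G).
rewrite (_ : minn i.-1 m = i.-1) ?eqxx; plia.
Qed.

Lemma D_graph_lt u v : bag_of u < bag_of v -> @D_graph m.+3 u v =
  [&& bag_of v == (bag_of u).+1, on_spine u & on_spine v].
Proof.
case: u v => [[i im]|[i im]] [[j jm]|[j jm]] /=; rewrite ?subSS ?subn0 ?andbF //; plia.
Qed.

Lemma D_graph_eq u v : bag_of u = bag_of v -> @D_graph m.+3 u v = (u != v).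
Proof.
case: u v => [[i im]|[i im]] [[j jm]|[j jm]] /= E; rewrite ?subSS ?subn0 //.
- rewrite -[inl _ != _]/(i != j); move: E; plia.
- apply/eqP; plia.
- apply/eqP; plia.
by apply/esym/negbTE; rewrite negbK; apply/eqP; congr inr; apply: ord_inj.
Qed.

Lemma D_map_eq u v : bag_of u = bag_of v -> u != v -> e (D_map u) (D_map v).
Proof.
have [sa sa' la] := and3P triA; have [sc sc' lc] := and3P triC.
wlog: u v / match u, v with inl i, inl j => i < j | inr i, inl j => false | _, _ => true end.
  move=> W; case: u v => [i|i] [j|j] E N.
  - case: (ltngtP i j) => ij; first exact: W.
      by rewrite eC; apply: W; rewrite // eq_sym.
    by case/eqP: N; congr inl; apply: ord_inj.
  - exact: W.
  - by rewrite eC; apply: W; rewrite // eq_sym.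
  - exact: W.
case: u v => [[i im]|[i im]] [[j jm]|[j jm]] //=.
- move=> ij E _; case: (posnP i) => i0.
    have -> : j = 1 by plia.
    by rewrite /= eC.
  have -> : i = m.+1 by plia.
  have -> : j = m.+2 by plia.
  by rewrite /= eqxx ifF //; plia.
- move=> _ E _; case: (posnP i) => i0; first by rewrite -E i0 min0n eC.
  case: eqP => im'; first by rewrite -E im' (_ : minn _ _ = m) 1?eC //; plia.
  by rewrite -E (_ : minn i.-1 m = i.-1) ?leafE //; plia.
by move=> _ E; rewrite -[inr _ != _]/(i != j) E eqxx.
Qed.

Lemma D_copy l : size l = (m.+2).*2 ->
  l =i a :: c :: [seq s i | i <- iota 0 m.+1] ++ [seq lf i | i <- iota 0 m.+1] ->
  copy nb (@D_graph m.+3) l.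
Proof.
move=> sl lE; exists D_map; split.
- move=> u v E; apply/eqP; apply: contraT => uv.
  case: (ltngtP (bag_of u) (bag_of v)) => b.
  + have := @cross (bag_of u) (bag_of v) (D_map u) (D_map v).
    by rewrite b bag_of_le !D_map_bag E eqxx => /(_ isT isT isT).
  + have := @cross (bag_of v) (bag_of u) (D_map v) (D_map u).
    by rewrite b bag_of_le !D_map_bag E eqxx => /(_ isT isT isT).
  + by have := D_map_eq b uv; rewrite E eI.
- have lt u v : bag_of u < bag_of v -> e (D_map u) (D_map v) = @D_graph m.+3 u v.
    move=> b; have := @cross (bag_of u) (bag_of v) (D_map u) (D_map v).
    rewrite b bag_of_le !D_map_bag => /(_ isT isT isT) /andP[_ /eqP->].
    by rewrite D_graph_lt // !D_map_spine.
  move=> u v; case: (ltngtP (bag_of u) (bag_of v)) => b; first exact: lt.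
    rewrite eC lt //; case: (u) (v) => [i|i] [j|j] //=.
    by rewrite orbC.
  rewrite D_graph_eq //; case: (eqVneq u v) => [->|uv]; first exact: eI.
  exact: D_map_eq.
- move=> x; rewrite lE; apply/idP/mapP => [|[u _ ->]]; last first.
    rewrite in_cons in_cons mem_cat; case: u => [[i im]|[j jm]]; last first.
      by rewrite (map_f lf (_ : j \in iota 0 m.+1)) ?orbT // mem_iota.
    rewrite /D_map -[nat_of_ord _]/i.
    case: (posnP i) => i0; first by rewrite eqxx.
    case: (eqVneq i m.+2) => im'; first by rewrite eqxx orbT.
    by rewrite (map_f s (_ : i.-1 \in iota 0 m.+1)) ?orbT // mem_iota; plia.
  have mem (u : U) : u \in enum {: U} by rewrite mem_enum.
  rewrite in_cons in_cons mem_cat => /or4P[/eqP->|/eqP->|/mapP[i]|/mapP[i]].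
  + by exists (inl ord0); rewrite ?mem.
  + by exists (inl ord_max); rewrite ?mem //= eqxx.
  + rewrite mem_iota => /andP[_ im] ->; have im' : i.+1 < m.+3 by plia.
    exists (inl (Ordinal im')); rewrite ?mem //= ifF //; plia.
  + rewrite mem_iota => /andP[_ im] ->; by exists (inr (Ordinal im)).
by rewrite sl card_sum !card_ord; plia.
Qed.

End Bags.

Variable A : nat -> pred V.
Hypothesis spE : forall i, i < m -> e (s i) (s i.+1).
Hypothesis sideP : forall i, i < m -> A i (s i) && ~~ A i (s i.+1).
Hypothesis sideE : forall i x y, i < m -> e x y -> A i x -> ~~ A i y ->
  x = s i /\ y = s i.+1.
Hypothesis turn : forall i, i.+2 <= m -> s i != s i.+2.

Lemma side_after i j : i < j <= m -> ~~ A i (s j).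
Proof.
have [d] := ubnP (j - i); elim/ltn_ind: d i j => d IH i j dij /andP[ij jm].
have im : i < m by plia.
case: (eqVneq j i.+1) => [->|ji1]; first by have /andP[] := sideP im.
have jE : j.-1.+1 = j by plia.
have jm' : j.-1 < m by plia.
have nA : ~~ A i (s j.-1) by apply: (IH (j.-1 - i).+1); plia.
apply/negP => Aj; have := spE jm'; rewrite jE eC => ej.
have [E1 E2] := sideE im ej Aj nA.
case: (eqVneq j i.+2) => [E|ji2].
  have := @turn i; rewrite -E E1 eqxx => /(_ jm); by [].
have im1 : i.+1 < m by plia.
have : ~~ A i.+1 (s j.-1) by apply: (IH (j.-1 - i.+1).+1); plia.
by rewrite E2; have /andP[->] := sideP im1.
Qed.

Lemma spine_inj i j : i <= m -> j <= m -> s i = s j -> i = j.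
Proof.
wlog: i j / i < j.
  move=> W im jm E; case: (ltngtP i j) => // ij; first exact: W.
  by apply/esym/W.
move=> ij im jm E; have im' : i < m by plia.
have : ~~ A i (s j) by rewrite side_after // ij.
by rewrite -E; have /andP[->] := sideP im'.
Qed.

Lemma side_spine i j : i < m -> j <= m -> A i (s j) = (j <= i).
Proof.
move=> im jm; case: (leqP j i) => ji; last by apply/negbTE/side_after; rewrite ji.
have [d] := ubnP (i - j); elim: d j jm ji => // d IH j jm ji dj.
case: (eqVneq j i) => [->|nji]; first by have /andP[] := sideP im.
have A1 : A i (s j.+1) by apply: IH; plia.
apply: contraT => nA; have jm' : j < m by plia.
have := spE jm'; rewrite eC => ej.
have [E1 E2] := sideE im ej A1 nA.
by have := spine_inj _ _ E2; plia.
Qed.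

Lemma side_leaf i j x : i < m -> j <= m -> e (s j) x ->
  (j < m -> x != s j.+1) -> (0 < j -> x != s j.-1) -> A i x = (j <= i).
Proof.
move=> im jm jx n1 n2; have := side_spine im jm; case: (leqP j i) => ji Aj.
  apply: contraT => Ax; have [E1 E2] := sideE im jx Aj Ax.
  have E := spine_inj jm (ltnW im) E1; subst j.
  by have := n1 im; rewrite E2 eqxx.
apply/negbTE/negP => Ax; have := Aj => /negbT Aj'; rewrite eC in jx.
have [E1 E2] := sideE im jx Ax Aj'.
have E := spine_inj jm im E2; subst j.
by have := n2 isT; rewrite E1 eqxx.
Qed.

Hypothesis leafE : forall i, i <= m -> e (s i) (lf i).
Hypothesis leafN : forall i, i < m -> lf i != s i.+1 /\ lf i.+1 != s i.
Hypothesis triA : tri (s 0) (lf 0) a.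
Hypothesis triC : tri (s m) (lf m) c.
Hypothesis aN : a != s 1.
Hypothesis cN : c != s m.-1.

Lemma side_bag i j x : i < m -> j <= m -> in_bag j x -> A i x = (j <= i).
Proof.
move=> im jm /or4P[/eqP->|/eqP->|/andP[/eqP-> /eqP->]|/andP[/eqP jE /eqP->]].
- exact: side_spine.
- apply: side_leaf; rewrite // ?leafE // => j0.
    by have [] := leafN j0.
  by have jm' : j.-1 < m; [plia | have [_] := leafN jm'; rewrite prednK].
- by apply: side_leaf => //; have /and3P[] := triA.
- rewrite jE; apply: side_leaf => //; rewrite ?ltnn //.
  by have /and3P[] := triC.
Qed.

Lemma cross_spine i j x y : i < j <= m -> in_bag i x -> in_bag j y ->
  (x != y) && (e x y == [&& j == i.+1, x == s i & y == s j]).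
Proof.
move=> /andP[ij jm] bx by'; have im : i < m by plia.
have im' : i <= m by plia.
have Ax := side_bag im im' bx; have Ay := side_bag im jm by'.
rewrite leqnn in Ax; have {}Ay : ~~ A i y by rewrite Ay -ltnNge.
apply/andP; split; first by apply: contraNneq Ay => <-.
apply/eqP; apply/idP/and3P => [xy|[/eqP-> /eqP-> /eqP->]]; last exact: spE.
have [-> Ey] := sideE im xy Ax Ay.
have jE : j = i.+1.
  apply/eqP; rewrite eqn_leq ij andbT leqNgt; apply/negP => ij1.
  have im1 : i.+1 < m by plia.
  have := side_bag im1 jm by'; rewrite Ey; have /andP[-> _] := sideP im1.
  by move/esym; rewrite leqNgt ij1.
by rewrite {2}jE Ey jE !eqxx.
Qed.

(** The predicates [A i] are the two sides of the graph after removal of the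
    bridge between [s i] and [s i.+1].  A bag lies on one side of each of these
    bridges, so that edges between different bags are spine edges. *)
Lemma D_spine l : size l = (m.+2).*2 ->
  l =i a :: c :: [seq s i | i <- iota 0 m.+1] ++ [seq lf i | i <- iota 0 m.+1] ->
  copy nb (@D_graph m.+3) l.
Proof. exact: (D_copy leafE triA triC cross_spine). Qed.

End OneSpine.

Hypothesis tips : forall a b c d, tri a b c -> tri a b d -> c != d -> ~~ big c.

(** Here the spine edge need not be a bridge: the bags are separated because a
    further edge would complete a diamond with a large tip, or a cycle of length
    four without chords. *)
Lemma D4_copy u v a b c d : e u v -> tri u a b -> tri v c d ->
  v \notin [:: a; b] -> u \notin [:: c; d] ->
  copy nb (@D_graph 4) [:: u; a; b; v; c; d].
Proof.
move=> uv t1 t2; rewrite !inE !negb_or => /andP[va vb] /andP[uc ud].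
have [ua ub ab] := and3P t1; have [vc vd cd] := and3P t2.
have vu : e v u by rewrite eC.
have bv : big v by apply: (bigP vu vc vd); rewrite // (adj_neq G).
have bu : big u by apply: (bigP uv ua ub); rewrite // (adj_neq G).
have nv x y : tri u x y -> v != x -> v != y -> ~~ e x v.
  move=> t nx ny; apply/negP => xv.
  have t' : tri u x v by case/and3P: t => ux _ _; rewrite /tri ux uv xv.
  by have := tips t' t ny; rewrite bv.
have nu x y : tri v x y -> u != x -> u != y -> ~~ e u x.
  move=> t nx ny; apply/negP => xu; rewrite eC in xu.
  have t' : tri v x u by case/and3P: t => vx _ _; rewrite /tri vx vu xu.
  by have := tips t' t ny; rewrite bu.
have t1' : tri u b a by rewrite triC.
have t2' : tri v d c by rewrite triC.
have nav : ~~ e a v by apply: (nv a b).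
have nbv : ~~ e b v by apply: (nv b a).
have nuc : ~~ e u c by apply: (nu c d).
have nud : ~~ e u d by apply: (nu d c).
have ne x y : e u x -> ~~ e u y -> x != y by move=> ux; apply: contraNneq => <-.
have far x y : e u x -> e v y -> ~~ e x v -> ~~ e u y -> v != x -> u != y -> ~~ e x y.
  move=> ux vy xv uy nx ny; rewrite eC; apply/negP => yx; rewrite eC in ux.
  by case: (no_C4 G ux uv vy yx); rewrite // 1?eq_sym //; apply/negP.
pose s i := if i == 0 then u else v.
pose lf i := if i == 0 then a else c.
apply: (@D_copy 1 s lf b d) => //.
- by case=> [|[|]].
- have F x y : e x y -> (y == x) = false.
    by move=> xy; rewrite eq_sym; apply/negbTE/(adj_neq G).
  have nac : ~~ e a c by apply: far.
  have nad : ~~ e a d by apply: far.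
  have nbc : ~~ e b c by apply: far.
  have nbd : ~~ e b d by apply: far.
  case=> [|i] [|[|j]] // x y; rewrite ?ltnS ?ltn0 ?andbF // => _.
  rewrite /in_bag /s /lf /= ?orbF.
  move=> /or3P[] /eqP-> /or3P[] /eqP->;
    rewrite ?eqxx ?uv ?(adj_neq G uv) ?(F _ _ ua) ?(F _ _ ub) ?(F _ _ vc)
      ?(F _ _ vd) /= ?eqbF_neg ?uc ?ud ?nuc ?nud ?nav ?nbv ?nac ?nad ?nbc ?nbd
      ?andbT //=; first [exact: ne | by rewrite eq_sym ?va ?vb].
- by move=> x; rewrite /= !inE; case: (x == a) (x == b) (x == c) (x == d)
    (x == u) (x == v) => [] [] [] [] [] [].
Qed.

End Spines.

(** * Spines traced down a forest *)

Section Walks.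

Variables (V : eqType) (nb : V -> seq V) (pos : V -> nat) (par : V -> V).
Hypothesis G : chordal_lists nb.
Hypothesis F : bfs_forest nb pos par.
Local Notation e := (adj nb).
Local Notation big := (big nb).
Local Notation tri := (tri nb).
Local Notation sib := (sib nb par).
Local Notation lone := (lone nb par).
Let eC : symmetric e := adj_sym G.
Let eI : irreflexive e := adj_irr G.
Hypothesis S : forall x y, e x y -> [|| par y == x, par x == y | par x == par y].
Hypothesis star : forall x y d, sib x y -> sib y d -> d != x -> ~~ big x.

Lemma iter_root n y : 0 < pos y -> pos y <= n -> par (iter n par y) = iter n par y.
Proof.
elim: n y => [|n IH] y vy yn; first by plia.
case: (eqVneq (par y) y) => [E|ny]; first by rewrite !iter_fix.
have lt := par_lt F vy ny; rewrite iterSr IH //; last by plia.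
exact: (par_vis G F).
Qed.

(** The iteration count is bounded by [pos y], since each step towards the root
    decreases [pos]; this makes the relation decidable. *)
Definition below x y := [exists k : 'I_(pos y).+1, iter k par y == x].

Lemma belowP x y : 0 < pos y -> reflect (exists k, iter k par y = x) (below x y).
Proof.
move=> vy; apply: (iffP existsP) => [[k /eqP <-]|[k <-]]; first by exists k.
case: (leqP k (pos y)) => ky; first by exists (Ordinal (ky : k < (pos y).+1)).
exists ord_max => /=; apply/eqP.
by rewrite -(subnK (ltnW ky)) iterD [RHS]iter_fix // iter_root.
Qed.

Lemma below_refl x : 0 < pos x -> below x x.
Proof. by move=> vx; apply/(belowP _ vx); exists 0. Qed.

Lemma below_par x : 0 < pos x -> par x != x -> ~~ below x (par x).
Proof.
move=> vx nx; have lx := par_lt F vx nx.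
apply/negP => /(belowP _ (par_vis G F vx))[k E].
have le n : 0 < pos (iter n par (par x)) /\ pos (iter n par (par x)) <= pos (par x).
  elim: n => [|n [IH0 IH]]; first by rewrite /= (par_vis G F).
  rewrite iterS; split; first exact: (par_vis G F).
  case: (eqVneq (par (iter n par (par x))) (iter n par (par x))) => [->//|nn].
  by apply: leq_trans IH; apply/ltnW/(par_lt F).
by have [_] := le k; rewrite E; plia.
Qed.

(** A vertex without siblings is joined to the rest of the graph by the edge to
    its parent alone: the other edges join parents to children, or siblings
    that have the same parent. *)
Lemma below_cut x y z : 0 < pos x -> lone x -> e y z ->
  below x y -> ~~ below x z -> y = x /\ z = par x.
Proof.
move=> vx lx yz; have vy := pos_edge F yz.
have vz : 0 < pos z by apply: (pos_edge F (y := y)); rewrite eC.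
move=> /(belowP _ vy)[k xy] /(belowP _ vz) nz.
case: (edgeP G F S yz) => [[p _]|[p _]|[s [p _ _]]].
- by case: nz; exists k.+1; rewrite iterSr p.
- case: k xy => [|k] /= xy; first by rewrite -xy -p.
  by case: nz; exists k; rewrite -p -iterSr.
- case: k xy => [|k] /= xy; first by have := lx z; rewrite -xy s.
  by case: nz; exists k.+1; rewrite iterSr -p -iterSr.
Qed.

Variables (N : nat) (T h : pred V) (ta tb nx : V -> V) (pick : V -> V -> V -> V).
Hypothesis posN : forall x, pos x <= N.
Hypothesis TE : forall u, T u -> tri u (ta u) (tb u).
Hypothesis pickP : forall u a b, big u ->
  [/\ e u (pick u a b), pick u a b != a & pick u a b != b].
Hypothesis nxP : forall u, 0 < pos u -> h u -> ~~ T u ->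
  [/\ big u, 0 < pos (nx u), par (nx u) = u, nx u != u & lone (nx u) /\ (T (nx u) || h (nx u))].

(** The vertices of one half of D_k, starting at the end [u] of the edge [uv] and
    following the claims [nx] down to a triangle.  Each inner vertex brings a
    neighbor that is not on the chain, chosen by [pick]. *)
Fixpoint walk n u v : seq V :=
  if n is k.+1 then
    if T u then [:: u; ta u; tb u]
    else [:: u, pick u v (nx u) & walk k (nx u) u]
  else [::].

Definition it u i := iter i nx u.
Definition prv u v i := if i is j.+1 then it u j else v.
Definition leaf u v i :=
  if T (it u i) then tb (it u i) else pick (it u i) (prv u v i) (it u i.+1).

Definition chain u n := T (it u n) /\ forall i, i < n ->
  [/\ ~~ T (it u i), big (it u i), 0 < pos (it u i.+1), par (it u i.+1) = it u i
    & it u i.+1 != it u i /\ lone (it u i.+1)].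

Lemma itS u i : it (nx u) i = it u i.+1.
Proof. by rewrite /it iterSr. Qed.

(** Claims lead from a parent to a child, so [pos] increases along them and a
    vertex in a triangle must be reached. *)
Lemma chain_ex u : 0 < pos u -> T u || h u -> exists2 n, n <= N & chain u n.
Proof.
move=> vu hu; suff [n nN cn] : exists2 n, n <= N - pos u & chain u n.
  by exists n => //; plia.
have [k] := ubnP (N - pos u); elim: k u vu hu => // k IH u vu + uk.
case: (boolP (T u)) => [Tu _|nT /= hu]; first by exists 0; [|split].
have [bu vn pn nn [ln hn]] := nxP vu hu nT.
have lt : pos u < pos (nx u).
  by rewrite -{1}pn; apply: (par_lt F) => //; rewrite pn eq_sym.
have pN := posN (nx u).
have [|n nN [Tn cn]] := IH (nx u) vn hn; first by plia.
exists n.+1; first by plia.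
split=> [|[|i] ni]; first by rewrite -itS.
  by split.
by have := cn i ni; rewrite !itS.
Qed.

Lemma chain_lt u n i : chain u n -> i < n -> pos (it u i) < pos (it u i.+1).
Proof.
move=> [_ c] /c[_ _ v p [nn _]]; rewrite -{1}p; apply: (par_lt F) => //.
by rewrite p eq_sym.
Qed.

Lemma map_iotaS (A : Type) (f : nat -> A) n :
  [seq f i | i <- iota 0 n.+1] = f 0 :: [seq f i.+1 | i <- iota 0 n].
Proof. by rewrite -[iota 0 n.+1]/(0 :: iota (1 + 0) n) iotaDl map_cons -map_comp. Qed.

Lemma walk_chain u v n k : chain u n -> n < k ->
  walk k u v =i ta (it u n) :: [seq it u i | i <- iota 0 n.+1] ++
                               [seq leaf u v i | i <- iota 0 n.+1]
  /\ size (walk k u v) = n.*2 + 3.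
Proof.
elim: n k u v => [|n IH] [//|k] u v [Tn cn] nk.
  rewrite /leaf /it /= in Tn *; rewrite Tn; split=> // x; rewrite !inE.
  by case: (x == u) (x == ta u) (x == tb u) => [] [] [].
have [nT _ _ _ _] := cn 0 isT; rewrite /it /= in nT.
have -> : walk k.+1 u v = [:: u, pick u v (nx u) & walk k (nx u) u].
  by rewrite /= (negbTE nT).
have c' : chain (nx u) n.
  by split=> [|i ni]; rewrite !itS //; apply: cn.
have [wE ws] := IH k (nx u) u c' nk.
split; last by rewrite /= ws; plia.
have lE i : leaf (nx u) u i = leaf u v i.+1.
  by rewrite /leaf !itS; case: i => [|i] //=; rewrite itS.
have m1 : [seq it u i | i <- iota 0 n.+2] = u :: [seq it (nx u) i | i <- iota 0 n.+1].
  by rewrite map_iotaS; congr (_ :: _); apply: eq_map => i; rewrite itS.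
have m2 : [seq leaf u v i | i <- iota 0 n.+2] =
    pick u v (nx u) :: [seq leaf (nx u) u i | i <- iota 0 n.+1].
  rewrite map_iotaS; congr (_ :: _); last by apply: eq_map => i; rewrite lE.
  by rewrite /leaf /= (negbTE nT).
move=> x; rewrite m1 m2 -itS.
rewrite !inE wE !inE !mem_cat !inE.
by case: (x == u) (x == pick u v (nx u)) (x == ta _) => [] [] []; rewrite /= ?orbT.
Qed.

(** A forest edge to a vertex without siblings is in no triangle. *)
Definition bridge u v := [&& 0 < pos u, par u != u & par u == v] /\ lone u.

Lemma bridge_tri u v a b : bridge u v \/ bridge v u -> tri u a b ->
  (a != v) && (b != v).
Proof.
have one x y c d : bridge x y -> tri x c d -> c != y.
  by move=> [/and3P[vx n' /eqP<-] lx]; apply: (lone_tri G F S star).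
have two x y c d : bridge y x -> tri x c d -> c != y.
  move=> yx t; apply/eqP => E; rewrite E (tri_rot G) in t.
  by have := one _ _ _ _ yx t; rewrite eqxx.
by move=> [] uv t; have t' := t; rewrite (triC G) in t';
  rewrite ?(one _ _ _ _ uv t) ?(one _ _ _ _ uv t') ?(two _ _ _ _ uv t)
    ?(two _ _ _ _ uv t').
Qed.

Lemma chain_bridge u n i : chain u n -> i < n -> bridge (it u i.+1) (it u i).
Proof.
move=> [_ c] /c[_ _ v p [nn l]]; split=> //.
by rewrite v p eqxx andbT eq_sym.
Qed.

Lemma leaf_chain u v n j : bridge u v \/ bridge v u -> chain u n -> j <= n ->
  [/\ e (it u j) (leaf u v j), leaf u v j != prv u v j &
      j < n -> leaf u v j != it u j.+1].
Proof.
move=> uv c jn.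
have pj : bridge (it u j) (prv u v j) \/ bridge (prv u v j) (it u j).
  by case: j jn => [//|j jn]; left; apply: chain_bridge c jn.
rewrite /leaf; case: ifP => Tj.
  have t := TE Tj; have /andP[_ ->] := bridge_tri pj t.
  split=> //; first by case/and3P: t.
  by move=> jn'; have [_ /(_ _ jn')[]] := c; rewrite Tj.
have jn' : j < n.
  by rewrite ltn_neqAle jn andbT; apply: contraFneq Tj => ->; case: c.
have [_ /(_ _ jn')[_ bj _ _ _]] := c.
by have [p1 p2 p3] := pickP (prv u v j) (it u j.+1) bj.
Qed.

(** The chain that starts at [x], read backwards, followed by the chain that
    starts at its parent, is the spine.  All of its edges are bridges of the
    forest, and the side of each of them is given by [below]. *)
Lemma D_collision x k : 0 < pos x -> par x != x -> lone x -> T x || h x ->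
  T (par x) || h (par x) -> (~~ T (par x) -> nx (par x) != x) -> N < k ->
  exists2 d, 4 <= d & copy nb (@D_graph d) (walk k x (par x) ++ walk k (par x) x).
Proof.
move=> vx nx' lx hx hp npx Nk; set p := par x in hp npx *.
have vp : 0 < pos p := par_vis G F vx.
have lt : pos p < pos x := par_lt F vx nx'.
have [al alN cx] := chain_ex vx hx; have [be beN cp] := chain_ex vp hp.
have bx : bridge x p by split=> //; rewrite vx nx' eqxx.
have bx1 : bridge x p \/ bridge p x by left.
have bx2 : bridge p x \/ bridge x p by right.
pose m := (al + be).+1.
pose s i := if i <= al then it x (al - i) else it p (i - al.+1).
pose lf i := if i <= al then leaf x p (al - i) else leaf p x (i - al.+1).
have sl i : i <= al -> s i = it x (al - i) by rewrite /s => ->.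
have sr j : s (al.+1 + j) = it p j by rewrite /s addKn ifF //; plia.
have ll i : i <= al -> lf i = leaf x p (al - i) by rewrite /lf => ->.
have lr j : lf (al.+1 + j) = leaf p x j by rewrite /lf addKn ifF //; plia.
have split_at i : i < m -> [\/ exists2 j, i = al - j.+1 & j < al, i = al |
    exists2 j, i = al.+1 + j & j < be].
  rewrite /m => im; case: (ltngtP i al) => ial; last by constructor 2.
  - by constructor 1; exists (al - i.+1); plia.
  - by constructor 3; exists (i - al.+1); plia.
have sx j : j <= al -> s (al - j) = it x j.
  by move=> ja; rewrite sl ?leq_subr // subKn.
have lx' j : j <= al -> lf (al - j) = leaf x p j.
  by move=> ja; rewrite ll ?leq_subr // subKn.
have sub1 j : j < al -> (al - j.+1).+1 = al - j by move=> ja; plia.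
have step i : i < m ->
    if i < al.+1 then bridge (s i) (s i.+1) else bridge (s i.+1) (s i).
  move=> im; case: (split_at i im) => [[j -> ja]|->|[j -> jb]].
  - rewrite ifT; last by plia.
    rewrite sx // sub1 // sx; last exact: ltnW.
    exact: (chain_bridge cx ja).
  - rewrite leqnn -{1}(subn0 al) sx // -[al.+1]addn0 sr; exact: bx.
  - rewrite ifF; last by plia.
    rewrite -addnS !sr; exact: (chain_bridge cp jb).
pose A i : pred V := if i < al.+1 then below (s i) else predC (below (s i.+1)).
exists m.+3 => //; apply: (@D_spine _ _ G m s lf (ta (it x al)) (ta (it p be)) _ A) => //.
- move=> i im; have := step i im; case: ifP => _ [/and3P[v n /eqP<-] _].
    by rewrite eC (par_adj G F).
  exact: (par_adj G F).
- move=> i im; have := step i im; rewrite /A; case: ifP => _ [/and3P[v n /eqP<-] _].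
    by rewrite below_refl // below_par.
  by rewrite /= negbK below_refl // below_par.
- move=> i y z im yz; have := step i im.
  rewrite /A; case: ifP => _ [/and3P[v n /eqP<-] l] /=.
    exact: below_cut.
  rewrite negbK => ny bz; rewrite eC in yz.
  by have [-> ->] := below_cut v l yz bz ny.
- move=> i im; have im' : i < m by plia.
  have ne a b : pos a < pos b -> b != a.
    by move=> ab; apply/eqP => E; rewrite E ltnn in ab.
  case: (split_at i im') => [[[|j] E ja]|E|[j E jb]]; rewrite E in im *.
  - rewrite sx // sub1 // subn0 -[al.+1]addn0 sr.
    by apply: ne; apply: (ltn_trans lt); exact: (chain_lt cx ja).
  - rewrite sx // sub1 // sub1; last exact: ltnW.
    rewrite sx; last by plia.
    by apply: ne; apply: ltn_trans (chain_lt cx ja); apply: (chain_lt cx); plia.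
  - rewrite -{1}(subn0 al) sx // -[al.+2]addn1 sr.
    have b0 : 0 < be by move: im; rewrite /m; plia.
    have [_ /(_ 0 b0)[nT _ _ _ _]] := cp.
    by rewrite eq_sym; exact: npx.
  - rewrite -!addnS !sr eq_sym; have jb' : j.+1 < be by move: im; rewrite /m; plia.
    apply: ne; apply: ltn_trans (chain_lt cp jb'); exact: (chain_lt cp jb).
- move=> i im; case: (leqP i al) => ia.
    by rewrite sl // ll //; have [] := leaf_chain bx1 cx (leq_subr i al).
  have -> : i = al.+1 + (i - al.+1) by plia.
  have ib : i - al.+1 <= be by plia.
  by rewrite sr lr; have [] := leaf_chain bx2 cp ib.
- move=> i im; case: (split_at i im) => [[j -> ja]|->|[j -> jb]].
  - rewrite sub1 // lx' // lx' ?sx //; try exact: ltnW.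
    have [_ n1 _] := leaf_chain bx1 cx ja.
    by have [_ _ n2] := leaf_chain bx1 cx (ltnW ja); split=> //; apply: n2.
  - rewrite -{1 4}(subn0 al) sx // lx' // -[al.+1]addn0 sr lr.
    have [_ n1 _] := leaf_chain bx1 cx (leq0n al).
    by have [_ n2 _] := leaf_chain bx2 cp (leq0n be).
  - rewrite -!addnS !sr !lr; have [_ n1 _] := leaf_chain bx2 cp jb.
    by have [_ _ n2] := leaf_chain bx2 cp (ltnW jb); split=> //; apply: n2.
- rewrite sl // ll // subn0 /leaf; have [Tn _] := cx; rewrite Tn.
  by rewrite -(triC G); apply: TE.
- have -> : m = al.+1 + be by rewrite /m addSn.
  by rewrite sr lr /leaf; have [Tn _] := cp; rewrite Tn -(triC G); apply: TE.
- have [Tn _] := cx; have t := TE Tn.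
  have -> : s 1 = prv x p al.
    case: (posnP al) => [a0|a0]; first by rewrite a0 /= -[1]addn0 -[p]/(it p 0) -sr a0.
    by rewrite sl // -{2}(prednK a0) /= subn1.
  have pj : bridge (it x al) (prv x p al) \/ bridge (prv x p al) (it x al).
    by case: (al) cx => [//|j] c; left; apply: chain_bridge c _.
  by have /andP[] := bridge_tri pj t.
- have [Tn _] := cp; have t := TE Tn.
  have -> : s m.-1 = prv p x be.
    case: (posnP be) => [b0|b0].
      by rewrite /m b0 addn0 /= sl // subnn.
    by rewrite -(prednK b0) /= -sr; congr s; rewrite /m; plia.
  have pj : bridge (it p be) (prv p x be) \/ bridge (prv p x be) (it p be).
    by case: (be) cp => [//|j] c; left; apply: chain_bridge c _.
  by have /andP[] := bridge_tri pj t.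
- have [_ s1] := walk_chain p cx (leq_ltn_trans alN Nk).
  have [_ s2] := walk_chain x cp (leq_ltn_trans beN Nk).
  by rewrite size_cat s1 s2 /m; plia.
have [w1 _] := walk_chain p cx (leq_ltn_trans alN Nk).
have [w2 _] := walk_chain x cp (leq_ltn_trans beN Nk).
move=> y; rewrite mem_cat w1 w2.
have mapE (f fx fp : nat -> V) : (forall i, i <= al -> f i = fx (al - i)) ->
    (forall j, f (al.+1 + j) = fp j) ->
    (y \in [seq f i | i <- iota 0 m.+1]) =
    (y \in [seq fx i | i <- iota 0 al.+1]) || (y \in [seq fp i | i <- iota 0 be.+1]).
  move=> fl fr; have -> : m.+1 = al.+1 + be.+1 by rewrite /m; plia.
  rewrite iotaD map_cat mem_cat; congr (_ || _); last first.
    rewrite add0n -[X in iota X]addn0 iotaDl -map_comp.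
    by congr (_ \in _); apply: eq_map => j; rewrite -fr.
  apply/mapP/mapP => [] [i]; rewrite mem_iota add0n => ia ->; exists (al - i).
  - by rewrite mem_iota; plia.
  - by apply: fl; plia.
  - by rewrite mem_iota; plia.
  - by rewrite fl ?leq_subr // subKn //; plia.
move: (mapE s (it x) (it p) sl sr) (mapE lf (leaf x p) (leaf p x) ll lr).
move: [seq s i | i <- _] [seq lf i | i <- _] [seq it x i | i <- _]
  [seq it p i | i <- _] [seq leaf x p i | i <- _] [seq leaf p x i | i <- _].
move=> l1 l2 l3 l4 l5 l6 E1 E2; rewrite !inE !mem_cat E1 E2.
case: (y == ta (it x al)) (y == ta (it p be)) => [] []; rewrite /= ?orbT //.
by case: (y \in l3) (y \in l4) (y \in l5) (y \in l6) => [] [] [] [].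
Qed.

End Walks.

(** * The obstructions have no star 3-coloring *)

Section StarColorings.

Variables (T : finType) (e : rel T).

Lemma bicolored_path (C : finType) (f : T -> C) a b c d : star_coloring e f ->
  uniq [:: a; b; c; d] -> e a b -> e b c -> e c d -> f a = f c -> f b <> f d.
Proof.
move=> [_ st] u ab bc cd ac bd; have := st a b c d u ab bc cd.
suff: f @: [set a; b; c; d] \subset [set f a; f b].
  by move/subset_leq_card => h1 h2; have := leq_trans h2 h1; rewrite cards2; case: eqP.
apply/subsetP => y /imsetP[x]; rewrite !inE => /orP[/orP[/orP[]|]|] /eqP-> ->;
  by rewrite -?ac -?bd eqxx ?orbT.
Qed.

(** On a two-colored path [a b c d], the vertex [b] has the two neighbors [a] and
    [c] of equal color, and [c] has [b] and [d], so that neither end serves the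
    edge [bc]. *)
Lemma star_coloring_only (C : finType) (f : T -> C) : symmetric e ->
  proper_coloring e f ->
  (forall x y, e x y -> (forall z, e x z -> f z = f y -> z = y) \/
                        (forall z, e y z -> f z = f x -> z = x)) ->
  star_coloring e f.
Proof.
move=> eC pf only; split=> // a b c d; rewrite /= !inE !negb_or.
move=> /and4P[/and3P[ab' ac ad] /andP[bc' bd] cd' _] ab bc cd.
have three x y z : [set f x; f y; f z] \subset f @: [set a; b; c; d] ->
    f x != f y -> f x != f z -> f y != f z -> 2 < #|f @: [set a; b; c; d]|.
  move=> /subset_leq_card sub xy xz yz; apply: leq_trans sub.
  by rewrite -setUA cardsU1 cards2 !inE negb_or xy xz yz.
have img x : x \in [set a; b; c; d] -> f x \in f @: [set a; b; c; d].
  by move=> xin; apply: imset_f.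
have [ia ib ic id] : [/\ f a \in f @: [set a; b; c; d], f b \in f @: [set a; b; c; d],
    f c \in f @: [set a; b; c; d] & f d \in f @: [set a; b; c; d]].
  by split; apply: img; rewrite !inE eqxx ?orbT.
have sub x y z : f x \in f @: [set a; b; c; d] -> f y \in f @: [set a; b; c; d] ->
    f z \in f @: [set a; b; c; d] -> [set f x; f y; f z] \subset f @: [set a; b; c; d].
  by move=> hx hy hz; apply/subsetP => t; rewrite !inE => /orP[/orP[]|] /eqP->.
case: (eqVneq (f a) (f c)) => [fac|fac]; last first.
  by apply: three (sub _ _ _ ia ib ic) _ fac _; apply: pf.
case: (eqVneq (f b) (f d)) => [fbd|fbd]; last first.
  by apply: three (sub _ _ _ ib ic id) _ fbd _; apply: pf.
case: (only b c bc) => [/(_ a)|/(_ d)].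
  by rewrite eC => /(_ ab fac) E; rewrite E eqxx in ac.
by move=> /(_ cd (esym fbd)) E; rewrite E eqxx in bd.
Qed.

Lemma star_colorable_induced (U : finType) (h : rel U) (W : {set T}) k :
  induced_iso h e W -> star_colorable k e -> star_colorable k h.
Proof.
move=> [g [gi _ ge]] [f [pf st]]; exists (f \o g); split.
  by move=> x y xy; apply: pf; rewrite ge.
move=> a b c d u ab bc cd.
have := st (g a) (g b) (g c) (g d); rewrite !ge -[uniq _]/(uniq (map g [:: a; b; c; d])).
rewrite map_inj_uniq // => /(_ u ab bc cd).
by rewrite imset_comp !imsetU !imset_set1 /=.
Qed.

End StarColorings.

Lemma third3 (p q r x : 'I_3) : p != q -> p != r -> q != r -> x != p ->
  x = q \/ x = r.
Proof.
move=> pq pr qr xp; case: (eqVneq x q) => [|xq]; [by left | right].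
by apply: ord_inj; move: p q r x pq pr qr xp xq => [p ?] [q ?] [r ?] [x ?];
  rewrite -!val_eqE /=; lia.
Qed.

Lemma third_eq (p q x y : 'I_3) : p != q -> x != p -> x != q -> y != p ->
  y != q -> x = y.
Proof.
move=> pq xp xq yp yq; apply: ord_inj.
by move: p q x y pq xp xq yp yq => [p ?] [q ?] [x ?] [y ?]; rewrite -!val_eqE /=; lia.
Qed.

Lemma K4_not_star : ~ star_colorable 3 K4.
Proof.
case=> f [pf _]; have N (i j : 'I_4) : i != j -> f i != f j by apply: pf.
pose o (i : nat) : 'I_4 := inord i.
have O i j : i < 4 -> j < 4 -> i != j -> f (o i) != f (o j).
  by move=> i4 j4 ij; apply: N; rewrite -val_eqE /= !inordK.
have := third_eq (O 0 1 isT isT isT) (O 2 0 isT isT isT) (O 2 1 isT isT isT)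
  (O 3 0 isT isT isT) (O 3 1 isT isT isT).
by move/eqP; apply/negP; apply: O.
Qed.

Section GraphOfEdges.

Variables (n : nat) (s : seq (nat * nat)) (f : 'I_n.+1 -> 'I_3).
Hypothesis st : star_coloring (@graph_of_edges n.+1 s) f.
Let o (i : nat) : 'I_n.+1 := inord i.
Definition joined i j := ((i, j) \in s) || ((j, i) \in s).

Lemma joined_adj i j : i <= n -> j <= n -> joined i j ->
  graph_of_edges s (o i) (o j).
Proof. by move=> ni nj; rewrite /graph_of_edges !inordK. Qed.

Lemma joined_neq i j : i <= n -> j <= n -> joined i j -> f (o i) != f (o j).
Proof. by move=> ni nj ij; have [pf _] := st; apply/pf/joined_adj. Qed.

Lemma joined_path a b c d : [&& a <= n, b <= n, c <= n & d <= n] ->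
  uniq [:: a; b; c; d] -> [&& joined a b, joined b c & joined c d] ->
  f (o a) = f (o c) -> f (o b) <> f (o d).
Proof.
move=> /and4P[na nb nc nd] u /and3P[ab bc cd].
apply: (bicolored_path st); try exact: joined_adj.
by rewrite -(map_inj_uniq val_inj) [map _ _]/= !inordK.
Qed.

End GraphOfEdges.

Lemma kite_not_star : ~ star_colorable 3 kite.
Proof.
case=> f st; pose o (i : nat) : 'I_5 := inord i.
have N := joined_neq st.
have P := joined_path st.
have E23 : f (o 2) = f (o 3) by apply: (third_eq (p := f (o 0)) (q := f (o 1))); apply: N.
have [E|E] : f (o 4) = f (o 0) \/ f (o 4) = f (o 1).
  by apply: (third3 (p := f (o 2))); apply: N.
- exact: (P 4 2 0 3 isT isT isT E E23).
- exact: (P 4 2 1 3 isT isT isT E E23).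
Qed.

Lemma gem_not_star : ~ star_colorable 3 gem.
Proof.
case=> f st; pose o (i : nat) : 'I_5 := inord i.
have N := joined_neq st.
apply: (joined_path (a := 0) (b := 1) (c := 2) (d := 3) st isT isT isT).
- by apply: (third_eq (p := f (o 4)) (q := f (o 1))); apply: N.
- by apply: (third_eq (p := f (o 4)) (q := f (o 2))); apply: N.
Qed.

(** Each of the vertices 1 and 2 has the color of 3 or of 4, so neither pendant
    vertex may take the color of the center 0: they take the colors of 2 and 1,
    and the path 5, 1, 2, 6 has two colors. *)
Lemma X127_not_star : ~ star_colorable 3 X127.
Proof.
case=> f st; pose o (i : nat) : 'I_7 := inord i.
have N := joined_neq st.
have P := joined_path st.
have [c Ec c1] : exists2 c, f (o 1) = f (o c) & (c == 3) || (c == 4).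
  have [E|E] : f (o 1) = f (o 3) \/ f (o 1) = f (o 4).
    by apply: (third3 (p := f (o 0))); apply: N.
  - by exists 3.
  - by exists 4.
have [d Ed d1] : exists2 d, f (o 2) = f (o d) & (d == 3) || (d == 4).
  have [E|E] : f (o 2) = f (o 3) \/ f (o 2) = f (o 4).
    by apply: (third3 (p := f (o 0))); apply: N.
  - by exists 3.
  - by exists 4.
have n5 : f (o 5) <> f (o 0).
  move=> E; case/orP: c1 => /eqP c1; rewrite c1 in Ec.
  - exact: (P 5 1 0 3 isT isT isT E Ec).
  - exact: (P 5 1 0 4 isT isT isT E Ec).
have n6 : f (o 6) <> f (o 0).
  move=> E; case/orP: d1 => /eqP d1; rewrite d1 in Ed.
  - exact: (P 6 2 0 3 isT isT isT E Ed).
  - exact: (P 6 2 0 4 isT isT isT E Ed).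
have E5 : f (o 5) = f (o 2).
  by apply: (third_eq (p := f (o 0)) (q := f (o 1))); try exact: N; apply/eqP.
have E6 : f (o 6) = f (o 1).
  by apply: (third_eq (p := f (o 0)) (q := f (o 2))); try exact: N; apply/eqP.
exact: (P 5 1 2 6 isT isT isT E5 (esym E6)).
Qed.

(** Along the spine, each [u_(i+2)] repeats the color of a neighbor of [u_(i+1)],
    by induction from the first triangle: the other neighbors of [u_(i+2)] may
    not have the color of [u_(i+1)], so they agree.  At the last triangle two of
    those neighbors are adjacent. *)
Lemma D_not_star k : 4 <= k -> ~ star_colorable 3 (@D_graph k).
Proof.
move=> k4 [f st]; have [pf _] := st.
case: k k4 f st pf => [|[|[|[|m]]]] // _.
pose U := ('I_m.+4 + 'I_(m.+4 - 2))%type.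
have sE : m.+4 - 2 = m.+2 by plia.
move=> f st pf.
pose u i : U := inl (inord i); pose v i : U := inr (cast_ord (esym sE) (inord i)).
have uu i : i.+1 < m.+4 -> D_graph (u i) (u i.+1).
  by move=> im; rewrite /D_graph /= !inordK ?eqxx //; plia.
have uv i : i < m.+4 -> D_graph (u i) (v (minn i.-1 m.+1)).
  by move=> im; rewrite /D_graph /= !inordK ?eqxx //; plia.
have DC : symmetric (@D_graph m.+4).
  by move=> [i|i] [j|j] //=; rewrite orbC.
have une i j : i < m.+4 -> j < m.+4 -> i != j -> u i != u j.
  move=> im jm; apply: contraNneq => -[] /(congr1 val) /=.
  by rewrite !inordK // => ->.
have vne i j : i < m.+2 -> j < m.+2 -> i != j -> v i != v j.
  move=> im jm; apply: contraNneq => -[].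
  by rewrite !inordK // => ->.
have uvne i j : u i != v j by [].
have P := bicolored_path st.
(* a neighbor of [u_(i+2)] that had the color of [u_(i+1)] would prolong a path
   from [t] with two colors *)
have far i t z : i <= m -> t = u i \/ t = v i -> z = u i.+3 \/ z = v i.+1 ->
    D_graph (u i.+1) t -> D_graph (u i.+2) z -> f t = f (u i.+2) ->
    f z != f (u i.+1).
  move=> im tE zE ut uz ft; rewrite eq_sym; apply/eqP.
  apply: (P t (u i.+1) (u i.+2) z) => //; [|by rewrite DC|by apply: uu; plia].
  rewrite /= !inE !negb_or andbT; have vune a b : v a != u b by [].
  case: tE => ->; case: zE => ->; rewrite ?vune ?uvne ?une ?vne //=; plia.
have N x y : D_graph x y -> f y != f x by rewrite DC; apply: pf.
have vE i j : i < m.+4 -> j = minn i.-1 m.+1 -> D_graph (u i) (v j).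
  by move=> im ->; apply: uv.
have u01 : D_graph (u 1) (u 0) by rewrite DC; apply: uu.
have inv i : i <= m -> exists2 t, (t = u i \/ t = v i) /\ D_graph (u i.+1) t &
    f t = f (u i.+2).
  elim: i => [|i IH] im.
    have [E|E] : f (u 2) = f (u 0) \/ f (u 2) = f (v 0).
      apply: (third3 (p := f (u 1))).
      - by apply/N/uu.
      - by apply/pf/vE.
      - by apply/pf/vE.
      - by apply/N/uu.
    + by exists (u 0) => //; split=> //; left.
    + by exists (v 0) => //; split; [right | apply: vE].
  have [t [tE ut] ft] := IH (ltnW im).
  have im' : i <= m := ltnW im.
  have uz : D_graph (u i.+2) (u i.+3) by apply: uu; plia.
  have vz : D_graph (u i.+2) (v i.+1) by apply: vE; plia.
  exists (v i.+1); first by split; [right|].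
  apply: (third_eq (p := f (u i.+1)) (q := f (u i.+2))).
  - by apply: N; rewrite DC; apply: uu; plia.
  - by apply: (far i t) => //; right.
  - exact: N.
  - by apply: (far i t) => //; left.
  - exact: N.
have [t [tE ut] ft] := inv m (leqnn m).
have uz : D_graph (u m.+2) (u m.+3) by apply: uu; plia.
have vz : D_graph (u m.+2) (v m.+1) by apply: vE; plia.
have : D_graph (u m.+3) (v m.+1) by apply: vE; plia.
move/pf/eqP; apply; apply: (third_eq (p := f (u m.+1)) (q := f (u m.+2))).
- by apply: N; rewrite DC; apply: uu; plia.
- by apply: (far m t) => //; left.
- exact: N.
- by apply: (far m t) => //; right.
- exact: N.
Qed.

Theorem obstruction_not_star (T : finType) (e : rel T) (W : {set T}) :
  obstruction e W -> ~ star_colorable 3 e.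
Proof.
have up (U : finType) (h : rel U) : induced_iso h e W ->
    ~ star_colorable 3 h -> ~ star_colorable 3 e.
  by move=> he nh /(star_colorable_induced he).
case=> [[|]|||[k k4]] he; apply: (up _ _ he).
- exact: K4_not_star.
- exact: kite_not_star.
- exact: gem_not_star.
- exact: X127_not_star.
- exact: D_not_star.
Qed.

(** * Programs made of bounded loops *)

Section Straight.

Variable w : nat.

Fixpoint loopfree (c : cmd) : bool :=
  match c with
  | Seq c1 c2 | If _ c1 c2 => loopfree c1 && loopfree c2
  | While _ _ => false
  | _ => true
  end.

(** Commands without loops always terminate, and are evaluated as functions on
    states. *)
Fixpoint run (c : cmd) (s : state) : state :=
  match c with
  | Skip | While _ _ => s
  | Assign x e => set_reg s x (eval w s e)
  | Store a i e => set_arr s a (eval w s i) (eval w s e)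
  | Seq c1 c2 => run c2 (run c1 s)
  | If b c1 c2 => if holds w s b then run c1 s else run c2 s
  end.

Lemma run_if b c1 c2 s :
  run (If b c1 c2) s = if holds w s b then run c1 s else run c2 s.
Proof. by []. Qed.

Lemma run_seq c1 c2 s : run (Seq c1 c2) s = run c2 (run c1 s).
Proof. by []. Qed.

Fixpoint max_cost (c : cmd) : nat :=
  match c with
  | Skip | While _ _ => 1
  | Assign _ e => (expr_cost e).+1
  | Store _ i e => (expr_cost i + expr_cost e).+1
  | Seq c1 c2 => max_cost c1 + max_cost c2
  | If b c1 c2 => (test_cost b + maxn (max_cost c1) (max_cost c2)).+1
  end.

Lemma exec_run c s : loopfree c ->
  exists2 t, t <= max_cost c & exec w c s t (run c s).
Proof.
elim: c s => [|x e|a i e|c1 IH1 c2 IH2|b c1 IH1 c2 IH2|//] s /=.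
- by exists 1 => //; constructor.
- by exists (expr_cost e).+1 => //; constructor.
- by exists (expr_cost i + expr_cost e).+1 => //; constructor.
- move=> /andP[/(IH1 s)[t1 l1 e1] /(IH2 (run c1 s))[t2 l2 e2]].
  by exists (t1 + t2); [rewrite leq_add | econstructor; eauto].
- move=> /andP[/(IH1 s)[t1 l1 e1] /(IH2 s)[t2 l2 e2]].
  pose t := if holds w s b then t1 else t2.
  exists (test_cost b + t).+1; last by constructor; rewrite /t; case: ifP.
  by rewrite ltnS leq_add2l /t leq_max; case: ifP; rewrite ?l1 ?l2 ?orbT.
Qed.

Fixpoint keeps_reg (x : nat) (c : cmd) : bool :=
  match c with
  | Assign y _ => x != y
  | Seq c1 c2 | If _ c1 c2 => keeps_reg x c1 && keeps_reg x c2
  | While _ c => keeps_reg x c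
  | _ => true
  end.

Fixpoint keeps_arr (a : nat) (c : cmd) : bool :=
  match c with
  | Store b _ _ => a != b
  | Seq c1 c2 | If _ c1 c2 => keeps_arr a c1 && keeps_arr a c2
  | While _ c => keeps_arr a c
  | _ => true
  end.

Lemma run_reg x c s : keeps_reg x c -> regs (run c s) x = regs s x.
Proof.
elim: c s => [|y e|a i e|c1 IH1 c2 IH2|b c1 IH1 c2 IH2|] //= s.
- by move/negbTE->.
- by move=> /andP[h1 h2]; rewrite IH2 ?IH1.
- by move=> /andP[h1 h2]; case: ifP => _; rewrite ?IH2 ?IH1.
Qed.

Lemma run_arr a c s : keeps_arr a c -> arrs (run c s) a = arrs s a.
Proof.
elim: c s => [|y e|b i e|c1 IH1 c2 IH2|b c1 IH1 c2 IH2|] //= s.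
- by move=> /negbTE ab; apply: functional_extensionality => j; rewrite ab.
- by move=> /andP[h1 h2]; rewrite IH2 ?IH1.
- by move=> /andP[h1 h2]; case: ifP => _; rewrite ?IH2 ?IH1.
Qed.

End Straight.

(** [Loop k N c] runs [c] with the counter [k] going from 0 to the value of
    register [N].  Bodies are commands without loops, so that a single register
    bounds the number of iterations of all loops of a program. *)
Inductive prog :=
  | Base of cmd
  | Chain of prog & prog
  | Loop of nat & nat & cmd
  | Branch of test & prog & prog.

Fixpoint code (p : prog) : cmd :=
  match p with
  | Base c => c
  | Chain p1 p2 => Seq (code p1) (code p2)
  | Loop k N c =>
      Seq (Assign k (Const 0))
        (While (TLt (Reg k) (Reg N)) (Seq c (Assign k (Add (Reg k) (Const 1)))))
  | Branch b p1 p2 => If b (code p1) (code p2)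
  end.

Fixpoint wf (N : nat) (p : prog) : bool :=
  match p with
  | Base c => loopfree c && keeps_reg N c
  | Chain p1 p2 | Branch _ p1 p2 => wf N p1 && wf N p2
  | Loop k M c =>
      [&& M == N, N != k, loopfree c, keeps_reg N c & keeps_reg k c]
  end.

Fixpoint prog_cost (p : prog) : nat :=
  match p with
  | Base c => max_cost c
  | Chain p1 p2 => prog_cost p1 + prog_cost p2
  | Loop _ _ c => max_cost c + 8
  | Branch b p1 p2 => (test_cost b + (prog_cost p1 + prog_cost p2)).+1
  end.

Section Programs.

Variable w : nat.

Definition turn k c s :=
  let s' := run w c s in set_reg s' k (regs s' k).+1.

Fixpoint prun (p : prog) (s : state) : state :=
  match p with
  | Base c => run w c s
  | Chain p1 p2 => prun p2 (prun p1 s)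
  | Loop k N c => iter (regs s N) (turn k c) (set_reg s k 0)
  | Branch b p1 p2 => if holds w s b then prun p1 s else prun p2 s
  end.

Fixpoint prog_keeps_reg x p : bool :=
  match p with
  | Base c => keeps_reg x c
  | Chain p1 p2 | Branch _ p1 p2 => prog_keeps_reg x p1 && prog_keeps_reg x p2
  | Loop k _ c => (x != k) && keeps_reg x c
  end.

Fixpoint prog_keeps_arr a p : bool :=
  match p with
  | Base c => keeps_arr a c
  | Chain p1 p2 | Branch _ p1 p2 => prog_keeps_arr a p1 && prog_keeps_arr a p2
  | Loop _ _ c => keeps_arr a c
  end.

Lemma turn_reg x k c s : x != k -> keeps_reg x c -> regs (turn k c s) x = regs s x.
Proof. by move=> /negbTE xk kc; rewrite /turn /= xk run_reg. Qed.

Lemma turn_arr a k c s : keeps_arr a c -> arrs (turn k c s) a = arrs s a.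
Proof. by move=> kc; rewrite /turn /= run_arr. Qed.

Lemma iter_turn_reg x k c n s : x != k -> keeps_reg x c ->
  regs (iter n (turn k c) s) x = regs s x.
Proof. by move=> xk kc; elim: n => // n IH; rewrite iterS turn_reg. Qed.

Lemma iter_turn_arr a k c n s : keeps_arr a c ->
  arrs (iter n (turn k c) s) a = arrs s a.
Proof. by move=> kc; elim: n => // n IH; rewrite iterS turn_arr. Qed.

Lemma iter_turn_counter k c n s : keeps_reg k c ->
  regs (iter n (turn k c) s) k = regs s k + n.
Proof.
move=> kc; elim: n => [|n IH]; first by rewrite addn0.
by rewrite iterS {1}/turn /= eqxx run_reg // IH addnS.
Qed.

Lemma prun_reg x p s : prog_keeps_reg x p -> regs (prun p s) x = regs s x.
Proof.
elim: p s => [c|p1 IH1 p2 IH2|k N c|b p1 IH1 p2 IH2] s /=.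
- exact: run_reg.
- by move=> /andP[h1 h2]; rewrite IH2 ?IH1.
- by move=> /andP[xk kc]; rewrite iter_turn_reg //= (negbTE xk).
- by move=> /andP[h1 h2]; case: ifP => _; rewrite ?IH2 ?IH1.
Qed.

Lemma prun_arr a p s : prog_keeps_arr a p -> arrs (prun p s) a = arrs s a.
Proof.
elim: p s => [c|p1 IH1 p2 IH2|k N c|b p1 IH1 p2 IH2] s /=.
- exact: run_arr.
- by move=> /andP[h1 h2]; rewrite IH2 ?IH1.
- by move=> kc; rewrite iter_turn_arr.
- by move=> /andP[h1 h2]; case: ifP => _; rewrite ?IH2 ?IH1.
Qed.

Lemma wf_keeps N p : wf N p -> prog_keeps_reg N p.
Proof.
elim: p => [c|p1 IH1 p2 IH2|k M c|b p1 IH1 p2 IH2] /=.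
- by move=> /andP[].
- by move=> /andP[/IH1-> /IH2->].
- by move=> /and5P[_ -> _ ->].
- by move=> /andP[/IH1-> /IH2->].
Qed.

Lemma exec_while k N c s n : N != k -> loopfree c -> keeps_reg N c ->
  keeps_reg k c -> regs s N < 2 ^ w -> regs s k + n = regs s N ->
  exists2 t, t <= n * (max_cost c + 8) + 4 &
    exec w (While (TLt (Reg k) (Reg N)) (Seq c (Assign k (Add (Reg k) (Const 1)))))
      s t (iter n (turn k c) s).
Proof.
move=> Nk lc kN kk; elim: n s => [|n IH] s Nw En.
  exists 4 => //=; apply: (@ExecWhileFalse w (TLt (Reg k) (Reg N))) => /=.
  by rewrite -leqNgt; lia.
have [t1 l1 e1] := exec_run w s lc.
have E : set_reg (run w c s) k (eval w (run w c s) (Add (Reg k) (Const 1))) = turn k c s.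
  rewrite /turn /=; congr set_reg; rewrite run_reg //.
  by rewrite (@modn_small 1) ?modn_small ?addn1 //; lia.
have [||t2 l2 e2] := IH (turn k c s).
- by rewrite turn_reg.
- by rewrite (turn_reg _ Nk kN) /turn /= eqxx run_reg //; lia.
rewrite -iterSr in e2.
exists (3 + (t1 + 4) + t2).+1; first by rewrite mulSn; lia.
apply: (@ExecWhileTrue w (TLt (Reg k) (Reg N)) _ s (turn k c s)) => //=; first by lia.
by apply: ExecSeq e1 _; rewrite -E; exact: ExecAssign.
Qed.

(** The counter stays below [regs s N], which is a word, so its increments do not
    wrap around. *)
Lemma prun_exec N p s : wf N p -> regs s N < 2 ^ w ->
  exists2 t, t <= prog_cost p * (regs s N).+1 & exec w (code p) s t (prun p s).
Proof.
elim: p s => [c|p1 IH1 p2 IH2|k M c|b p1 IH1 p2 IH2] s /=.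
- move=> /andP[/(exec_run w s)[t lt et] _] _; exists t => //.
  by rewrite mulnS (leq_trans lt) ?leq_addr.
- move=> /andP[w1 w2] Nw; have [t1 l1 e1] := IH1 s w1 Nw.
  have E := prun_reg s (wf_keeps w1).
  have [|t2 l2 e2] := IH2 (prun p1 s) w2; first by rewrite E.
  exists (t1 + t2); last by apply: ExecSeq e1 e2.
  by rewrite mulnDl leq_add // -E.
- move=> /and5P[/eqP-> Nk lc kN kk] Nw.
  have [||t lt et] := @exec_while k N c (set_reg s k 0) (regs s N) Nk lc kN kk.
  + by rewrite /= (negbTE Nk).
  + by rewrite /= eqxx (negbTE Nk) add0n.
  exists (2 + t); first by rewrite mulnS; lia.
  by apply: ExecSeq et; rewrite -[X in set_reg s k X](mod0n (2 ^ w)); exact: ExecAssign.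
- move=> /andP[w1 w2] Nw; have [t1 l1 e1] := IH1 s w1 Nw.
  have [t2 l2 e2] := IH2 s w2 Nw.
  pose t := if holds w s b then t1 else t2.
  exists (test_cost b + t).+1; last by constructor; rewrite /t; case: ifP.
  have lt : t <= prog_cost p1 * (regs s N).+1 + prog_cost p2 * (regs s N).+1.
    by rewrite /t; case: ifP => _; lia.
  by rewrite !mulSn !mulnDl; lia.
Qed.

(** Apart from its invariant, a body may use that it has not touched the registers
    and arrays that its text does not assign. *)
Lemma loop_rule (I : nat -> state -> Prop) k N c s :
  N != k -> keeps_reg N c -> keeps_reg k c -> I 0 (set_reg s k 0) ->
  (forall i t, i < regs s N -> regs t k = i ->
     (forall a, keeps_arr a c -> arrs t a = arrs s a) ->
     (forall x, (x != k) && keeps_reg x c -> regs t x = regs s x) ->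
     I i t -> I i.+1 (set_reg (run w c t) k i.+1)) ->
  I (regs s N) (prun (Loop k N c) s).
Proof.
move=> Nk kN kk I0 IS /=; have : regs s N <= regs s N by [].
elim: {1 3 4}(regs s N) => [//|n IH] nN; rewrite iterS {1}/turn.
have kn : regs (iter n (turn k c) (set_reg s k 0)) k = n.
  by rewrite iter_turn_counter //= eqxx.
rewrite run_reg // kn; apply: IS => //; last exact/IH/ltnW.
- by move=> a ka; rewrite iter_turn_arr.
- by move=> x /andP[xk kx]; rewrite iter_turn_reg //= (negbTE xk).
Qed.

End Programs.

(** * Reading the input *)

Coercion Reg : nat >-> expr.
Declare Scope cmd_scope.
Delimit Scope cmd_scope with cmd.
Notation "x ::= e" := (Assign x e) (at level 80, no associativity) : cmd_scope.
Notation "c1 ;; c2" := (Seq c1 c2) (at level 85, right associativity) : cmd_scope.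
Open Scope cmd_scope.

Notation rANS := 0 (only parsing).
Notation rOUT := 1 (only parsing).
Notation rN := 2 (only parsing).
Notation rLEN := 3 (only parsing).
Notation rK := 4 (only parsing).
Notation rX := 5 (only parsing).
Notation rY := 6 (only parsing).
Notation rPTR := 7 (only parsing).
Notation rCUR := 8 (only parsing).
Notation rHEAD := 9 (only parsing).
Notation rTAIL := 10 (only parsing).
Notation rJ := 11 (only parsing).
Notation rEND := 12 (only parsing).
Notation rRR := 13 (only parsing).
Notation rV := 14 (only parsing).

Notation aIN := 0 (only parsing).
Notation aOUT := 1 (only parsing).
Notation aOFF := 2 (only parsing).
Notation aMARK := 3 (only parsing).
Notation aSRC := 4 (only parsing).
Notation aPOS := 5 (only parsing).
Notation aORD := 6 (only parsing).
Notation aPAR := 7 (only parsing).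
Notation aDEG := 8 (only parsing).

Definition read_degrees : cmd :=
  Store aOFF rK (Add rPTR (Const 1)) ;;
  Store aDEG rK (Get aIN rPTR) ;;
  Store aMARK rPTR (Add rK (Const 1)) ;;
  rPTR ::= Add (Add rPTR (Get aIN rPTR)) (Const 1).

(** The words of the input are turned into arcs: [aMARK] tells which words are
    degrees and whose, and every other word up to the end of the input is a
    neighbor of the vertex whose degree was read last.  A value [x.+1] stands
    for the vertex [x], and 0 for none. *)
Definition read_sources : cmd :=
  If (TEq (Get aMARK rK) (Const 0))
    (If (TLt rK rPTR) (Store aSRC rK rCUR) Skip)
    (rCUR ::= Get aMARK rK).

Definition arc_body (c : cmd) : cmd :=
  If (TEq (Get aSRC rK) (Const 0)) Skip
    (rX ::= Defs.Sub (Get aSRC rK) (Const 1) ;; rY ::= Get aIN rK ;; c).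
(** Each pass over the edges inspects all words of the input and acts on those
    that are neighbors; [rX] and [rY] are then the ends of the arc. *)
Definition arc_loop (c : cmd) : prog := Loop rK rLEN (arc_body c).

Definition push (v p : nat) : cmd :=
  Store aORD rTAIL v ;;
  rTAIL ::= Add rTAIL (Const 1) ;;
  Store aPOS v rTAIL ;;
  Store aPAR v p.

Definition bfs_scan : cmd :=
  rV ::= Get aIN rJ ;; rJ ::= Add rJ (Const 1) ;;
  If (TEq (Get aPOS rV) (Const 0)) (push rV rCUR) Skip.
Definition bfs_pop : cmd :=
  rCUR ::= Get aORD rHEAD ;;
  rJ ::= Get aOFF rCUR ;;
  rEND ::= Add rJ (Get aDEG rCUR) ;;
  rHEAD ::= Add rHEAD (Const 1).
(** The candidates for roots are all vertices, tried twice: first only those of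
    degree at least three are admitted, then all of them. *)
Definition bfs_choose : cmd :=
  If (TLt rRR rN) (rV ::= rRR) (rV ::= Defs.Sub rRR rN).
Definition bfs_admit : cmd :=
  If (TAnd (TEq (Get aPOS rV) (Const 0))
       (TNot (TAnd (TLt rRR rN) (TLt (Get aDEG rV) (Const 3)))))
    (push rV rV) Skip ;;
  rRR ::= Add rRR (Const 1).
Definition bfs_root : cmd := bfs_choose ;; bfs_admit.
(** One elementary step of the search: scan an arc, or take the next vertex from
    the queue, or try the next root. *)
Definition bfs_step : cmd :=
  If (TLt rJ rEND) bfs_scan
    (If (TLt rHEAD rTAIL) bfs_pop
      (If (TLt rRR (Add rN rN)) bfs_root Skip)).

Section Phases.

Variables (w n : nat) (nb : nat -> seq nat) (IN : nat -> nat).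
Hypothesis G : chordal_lists nb.
Hypothesis nbn : forall x y, adj nb x y -> x < n.
Local Notation e := (adj nb).
Local Notation big := (big nb).
Local Notation deg x := (size (nb x)).
Let eC : symmetric e := adj_sym G.
Let eI : irreflexive e := adj_irr G.

(** The address of the degree of [x] in the input; [start n] is its length. *)
Fixpoint start x := if x is k.+1 then start k + deg k + 1 else 1.
(** The number of iterations of all loops but the first.  The search needs the most of them:
    one for each arc, one for each vertex in the queue, and two for each vertex
    to be tried as a root. *)
Definition len := start n * 3.

Lemma start_mono x y : x <= y -> start x <= start y.
Proof.
elim: y => [|y IH]; first by rewrite leqn0 => /eqP->.
by rewrite leq_eqVlt ltnS => /orP[/eqP->//|/IH] /=; lia.
Qed.

Lemma start_lt x y : x < y -> start x + deg x < start y.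
Proof. by move=> /start_mono /=; lia. Qed.

Lemma start_ge x : x < start x.
Proof. by elim: x => //= x; lia. Qed.

Hypothesis room : start n * 20 < 2 ^ w.

(** Addresses and counters stay below a fixed multiple of the length of the input,
    so that no addition wraps around. *)
Lemma small k : k <= start n * 19 -> k %% 2 ^ w = k.
Proof. by move=> kn; rewrite modn_small //; have := start_ge n; lia. Qed.

Hypothesis IN0 : IN 0 = n.
Hypothesis INdeg : forall x, x < n -> IN (start x) = deg x.
Hypothesis INnb : forall x i, x < n -> i < deg x ->
  IN (start x + 1 + i) = nth 0 (nb x) i.

(** The part of the state that describes the input and that every later phase
    preserves. *)
Record parsed (s : state) : Prop := Parsed {
  p_n : regs s rN = n;
  p_len : regs s rLEN = len;
  p_in : arrs s aIN = IN;
  p_off : forall x, x < n -> arrs s aOFF x = start x + 1;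
  p_deg : forall x, x < n -> arrs s aDEG x = deg x;
  p_arc : forall j, arrs s aSRC j != 0 -> e (arrs s aSRC j).-1 (IN j);
  p_arcs : forall x y, e x y -> exists j,
    [/\ j < len, arrs s aSRC j = x.+1 & IN j = y] }.

Lemma parsed_ext s t : (forall a, a \in [:: aIN; aOFF; aDEG; aSRC] -> arrs t a = arrs s a) ->
  regs t rN = regs s rN -> regs t rLEN = regs s rLEN -> parsed s -> parsed t.
Proof.
move=> Ea En El [h1 h2 h3 h4 h5 h6 h7].
by split; rewrite ?En ?El ?Ea.
Qed.

Definition init : cmd := rN ::= Get aIN (Const 0) ;; rPTR ::= Const 1.
Definition sizes : prog := Loop rK rN read_degrees.
Definition set_len : cmd := rLEN ::= Add rPTR (Add rPTR rPTR).
Definition sources : prog := Loop rK rLEN read_sources.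

Lemma parse_correct s : regs s = (fun _ => 0) ->
  arrs s = (fun a i => if a == aIN then IN i else 0) ->
  parsed (prun w sources (run w set_len (prun w sizes (run w init s)))).
Proof.
move=> rs0 as0; pose s1 := run w init s.
have ge := start_ge n.
have s1n : regs s1 rN = n by rewrite /= as0 mod0n /= IN0.
pose I1 x t := [/\ regs t rPTR = start x /\ arrs t aIN = IN,
  forall y, y < x -> arrs t aOFF y = start y + 1 /\ arrs t aDEG y = deg y,
  forall y, y < x -> arrs t aMARK (start y) = y.+1,
  forall j, arrs t aMARK j != 0 -> exists2 y, y < x & j = start y &
  forall j, arrs t aSRC j = 0 /\ regs t rCUR = 0].
have : I1 n (prun w sizes s1).
  rewrite -[X in I1 X]s1n; apply: loop_rule => //.
    split=> //=; rewrite ?rs0 ?as0 //.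
    by split; [rewrite small //; lia | apply: functional_extensionality].
  rewrite s1n => i t ilt tk ka kr [[tp tin] tod tm1 tm2 tsc].
  have st : start i.+1 <= start n by apply: start_mono.
  rewrite /= in st.
  rewrite /I1 /= tk tp tin INdeg // !small; [|lia..].
  split=> //.
  - move=> y; rewrite ltnS leq_eqVlt => /orP[/eqP->|yi].
      by rewrite eqxx.
    by rewrite (ltn_eqF yi); apply: tod.
  - move=> y; rewrite ltnS leq_eqVlt => /orP[/eqP->|yi].
      by rewrite eqxx addn1.
    by rewrite (ltn_eqF (leq_ltn_trans (leq_addr _ _) (start_lt yi))) tm1.
  - move=> j; case: (eqVneq j (start i)) => [->|_ /tm2[y yi ->]]; first by exists i.
    by exists y => //; exact: ltnW.
set s2 := prun w sizes s1 => -[[tp tin] tod tm1 tm2 tsc].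
have s2n : regs s2 rN = n by rewrite -s1n prun_reg.
pose s3 := run w set_len s2.
have s3l : regs s3 rLEN = len by rewrite /= tp !small /len; lia.
pose I2 k t := [/\ (1 < k -> 0 < n -> exists x, [/\ x < n, regs t rCUR = x.+1,
      start x < k & x.+1 < n -> k <= start x.+1]),
  (k <= 1 -> regs t rCUR = 0),
  (forall j, arrs t aSRC j != 0 -> exists2 x, arrs t aSRC j = x.+1 /\ x < n &
     start x < j <= start x + deg x) &
  forall x j, x < n -> j < k -> start x < j <= start x + deg x -> arrs t aSRC j = x.+1].
have uniq_owner x y j : start x < j <= start x + deg x ->
    start y < j <= start y + deg y -> x = y.
  by move=> hx hy; case: (ltngtP x y) => // /start_lt; lia.
have : I2 len (prun w sources s3).
  rewrite -[X in I2 X]s3l; apply: loop_rule => //.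
    split=> //=; first by have [] := tsc 0.
    by move=> j; have [->] := tsc j.
  rewrite s3l => k t klt tk ka kr [i1 i2 i3 i4].
  have mk : arrs t aMARK = arrs s2 aMARK by rewrite ka.
  have pk : regs t rPTR = start n by rewrite kr //= tp.
  rewrite /= tk mk mod0n pk.
  have src x : x < n -> k = start x -> I2 k.+1 (set_reg (set_reg t rCUR x.+1) rK k.+1).
    move=> xn kx; split=> //=.
    - by move=> _ _; exists x; split=> //; rewrite kx // => /= _; lia.
    - by have := start_ge x; lia.
    - move=> y j yn; rewrite ltnS leq_eqVlt => /orP[/eqP->|jk]; last exact: i4.
      by rewrite kx; case: (ltngtP x y) => [/start_lt|/start_lt|->]; lia.
  case: (boolP (arrs s2 aMARK k == 0)) => mk0; last first.
    have [x xn kx] := tm2 k mk0.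
    have E : arrs s2 aMARK k = x.+1 by rewrite kx tm1.
    by rewrite E; apply: src.
  have nostart x : x < n -> k <> start x.
    by move=> xn E; rewrite E tm1 in mk0.
  have owner : 1 < k < start n -> exists x,
      [/\ x < n, regs t rCUR = x.+1 & start x < k <= start x + deg x].
    move=> /andP[k1 kn]; have n0 : 0 < n by case: (n) kn => //=; lia.
    have [x [xn -> xk xk']] := i1 k1 n0; exists x; split=> //; rewrite xk /=.
    case: (ltnP x.+1 n) => xn'.
      by have := xk' xn'; have := nostart _ xn'; rewrite /=; lia.
    by have E : n = x.+1; [lia | move: kn; rewrite E /=; lia].
  have i1' : 1 < k.+1 -> 0 < n -> exists x, [/\ x < n, regs t rCUR = x.+1,
      start x < k.+1 & x.+1 < n -> k.+1 <= start x.+1].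
    move=> k1 n0; have k1' : k <> 1 by move=> E; apply: (nostart 0 n0); rewrite E.
    have [|x [xn xc xk xk']] := i1 _ n0; first by lia.
    exists x; split=> //; first by lia.
    by move=> xn'; have := xk' xn'; have := nostart _ xn'; lia.
  case: ifP => kn /=; last first.
    split=> //=; first by move=> k1; apply: i2; lia.
    move=> x j xn; rewrite ltnS leq_eqVlt => /orP[/eqP->|jk]; last exact: i4.
    by have := start_mono xn; rewrite /=; lia.
  split=> //=.
  - by move=> k1; apply: i2; lia.
  - move=> j; case: (eqVneq j k) => [->|_]; last exact: i3.
    case: (leqP k 1) => k1; first by rewrite i2.
    by have [|x [xn -> xk]] := owner; [rewrite k1 | exists x].
  - move=> x j xn; rewrite ltnS leq_eqVlt => /orP[/eqP->|jk].
      rewrite eqxx => xk; have [|y [yn -> yk]] := owner.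
        by have := start_ge x; have := start_mono xn; rewrite /=; lia.
      by rewrite (uniq_owner _ _ _ xk yk).
    by rewrite (ltn_eqF jk); apply: i4.
set s4 := prun w sources s3 => -[_ _ i3 i4].
split.
- by rewrite prun_reg.
- by rewrite prun_reg.
- by rewrite prun_arr.
- by move=> x xn; rewrite prun_arr //; have [] := tod x xn.
- by move=> x xn; rewrite prun_arr //; have [] := tod x xn.
- move=> j /i3[x [-> xn] /andP[j1 j2]] /=.
  have jE : start x + 1 + (j - start x - 1) = j by lia.
  have jd : j - start x - 1 < deg x by lia.
  by rewrite -jE INnb // /adj mem_nth.
- move=> x y xy; have xn := nbn xy; have ix : index y (nb x) < deg x by rewrite index_mem.
  exists (start x + 1 + index y (nb x)); rewrite INnb // nth_index //.
  have := start_mono xn; rewrite /= => le.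
  by split=> //; [rewrite /len; lia | apply: i4 => //; rewrite /len; lia].
Qed.

End Phases.

Section Arcs.

Variables (w n : nat) (nb : nat -> seq nat) (IN : nat -> nat).
Local Notation e := (adj nb).
Local Notation start := (start nb).
Local Notation len := (len n nb).
Local Notation parsed := (parsed n nb IN).
Hypothesis room : start n * 20 < 2 ^ w.

(** [S] is an invariant of the state, and [R t x y] what the body establishes when
    it meets the arc [(x, y)]; the loop meets every arc.  Both have to be
    insensitive to the registers that the loop itself uses. *)
Lemma arc_rule c s (S : state -> Prop) (R : state -> nat -> nat -> Prop) :
  parsed s -> keeps_reg rLEN c -> keeps_reg rK c -> keeps_reg rX c ->
  keeps_reg rY c -> keeps_arr aIN c -> keeps_arr aSRC c ->
  (forall t r v, r \in [:: rK; rX; rY] -> S t -> S (set_reg t r v)) ->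
  (forall t r v x y, r \in [:: rK; rX; rY] -> R t x y -> R (set_reg t r v) x y) ->
  S s ->
  (forall t x y, e x y -> regs t rX = x -> regs t rY = y ->
     (forall a, keeps_arr a c -> arrs t a = arrs s a) ->
     (forall r, (r \notin [:: rK; rX; rY]) && keeps_reg r c -> regs t r = regs s r) ->
     S t ->
     [/\ S (run w c t), R (run w c t) x y &
         forall x' y', R t x' y' -> R (run w c t) x' y']) ->
  S (prun w (arc_loop c) s) /\ forall x y, e x y -> R (prun w (arc_loop c) s) x y.
Proof.
move=> P kl kk kx ky kin ksrc Sr Rr S0 step.
pose I i t := S t /\ forall j x y, j < i -> arrs s aSRC j = x.+1 -> IN j = y -> R t x y.
have [||||i t il tk ka kr [It Jt]|St Rt] := @loop_rule w I rK rLEN (arc_body c) s.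
- by [].
- by rewrite /= kl.
- by rewrite /= kk.
- by split=> //; apply: Sr.
- have src : arrs t aSRC = arrs s aSRC by apply: ka; rewrite /= ksrc.
  have tin : arrs t aIN = IN by rewrite ka ?(p_in P) //= kin.
  rewrite /= tk mod0n src; case: eqP => [j0|/eqP j0].
    split; first exact: Sr.
    move=> j x y; rewrite ltnS leq_eqVlt => /orP[/eqP->|jk jx jy].
      by rewrite j0.
    by apply: Rr => //; exact: (Jt _ _ _ jk jx jy).
  have xE : arrs s aSRC i = (arrs s aSRC i).-1.+1 by rewrite prednK // lt0n.
  have eij := p_arc P j0.
  rewrite (small room); last by have := start_ge nb n; lia.
  rewrite tin subn1; set t' := set_reg (set_reg t _ _) _ _.
  have [a kac|r /andP[rn rc]||S' R' RR] := step t' _ _ eij erefl erefl.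
  + exact: ka.
  + move: rn; rewrite !inE !negb_or => /and3P[r4 r5 r6].
    by rewrite /t' /= (negbTE r5) (negbTE r6) kr //= r4 r5 r6.
  + by apply: (Sr) => //; apply: (Sr).
  split; first exact: Sr.
  move=> j x y; rewrite ltnS leq_eqVlt => /orP[/eqP-> ix iy|jk jx jy]; apply: (Rr) => //.
    by rewrite -iy -[x]/(x.+1.-1) -ix.
  by apply: RR; apply: (Rr) => //; apply: (Rr) => //; exact: (Jt _ _ _ jk jx jy).
rewrite (p_len P) in St Rt; split=> // x y /(p_arcs P)[j [jl jx jy]].
exact: Rt jl jx jy.
Qed.

End Arcs.

(** * Invariants of breadth-first search *)

Section Search.

Variables (n : nat) (nb : nat -> seq nat).
Hypothesis G : chordal_lists nb.
Hypothesis nbn : forall x y, adj nb x y -> x < n.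
Local Notation e := (adj nb).
Local Notation big := (big nb).
Local Notation deg x := (size (nb x)).
Let eC : symmetric e := adj_sym G.
Let eI : irreflexive e := adj_irr G.

(** The invariant of the search: [h] vertices have left the queue, [t] have
    entered it, [q] neighbors of the last vertex to leave have been scanned, and
    [rr] candidates for roots have been tried.  [s_mono] and [s_first] hold
    because children enter the queue in the order of their parents. *)
Record searching (pos par ord : nat -> nat) (h t q rr : nat) : Prop := Searching {
  s_vis : forall x, 0 < pos x -> [/\ x < n, pos x <= t & ord (pos x).-1 = x];
  s_ord : forall i, i < t -> pos (ord i) = i.+1;
  s_head : h <= t;
  s_par : forall y, 0 < pos y -> par y <> y ->
    [/\ e (par y) y, 0 < pos (par y) < pos y & pos (par y) <= h];
  s_closed : forall x y, 0 < pos x < h -> e x y -> 0 < pos y;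
  s_part : forall i, 0 < h -> i < q -> 0 < pos (nth 0 (nb (ord h.-1)) i);
  s_q : if 0 < h then q <= deg (ord h.-1) else q == 0;
  s_first : forall u y, e u y -> 0 < pos u < pos y ->
    par y <> y /\ pos (par y) <= pos u;
  s_mono : forall y z, 0 < pos y -> par y <> y -> par z <> z ->
    pos y < pos z -> pos (par y) <= pos (par z);
  s_cut : forall r u v, par r = r -> e u v -> 0 < pos u < pos r ->
    0 < pos v < pos r;
  s_small : forall r z, 0 < pos r -> par r = r -> ~~ big r -> pos r <= pos z ->
    ~~ big z;
  s_cand : forall v, v < n -> v < rr -> big v -> 0 < pos v;
  s_cand2 : forall v, v < n -> n + v < rr -> 0 < pos v;
  s_late : forall r, 0 < pos r -> par r = r -> ~~ big r -> n < rr }.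

Definition scanned ord h q := if 0 < h then q == deg (ord h.-1) else true.

Definition upd (f : nat -> nat) i v := fun j => if j == i then v else f j.

Lemma head_pos pos par ord h t q rr : searching pos par ord h t q rr ->
  0 < h -> pos (ord h.-1) = h.
Proof. by move=> S h0; rewrite (s_ord S) ?prednK // (s_head S). Qed.

Lemma visit_child pos par ord h t q rr v : searching pos par ord h t q rr ->
  0 < h -> q < deg (ord h.-1) -> v = nth 0 (nb (ord h.-1)) q -> pos v = 0 ->
  searching (upd pos v t.+1) (upd par v (ord h.-1)) (upd ord t v) h t.+1 q.+1 rr.
Proof.
move=> S h0 qd vE pv; set p := ord h.-1 in qd vE *.
have pp : pos p = h := head_pos S h0.
have pv' : e p v by rewrite /adj vE mem_nth.
have vp : p != v := adj_neq G pv'.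
have ht := s_head S.
have vn : v < n by apply: (nbn (y := p)); rewrite eC.
have old x : 0 < pos x -> x <> v by move=> x0 E; rewrite E pv in x0.
have ule x : 0 < pos x -> pos x <= t by case/(s_vis S).
have oldu x : x <> v -> upd pos v t.+1 x = pos x by move=> /eqP/negbTE xv; rewrite /upd xv.
have oldp x : x <> v -> upd par v p x = par x by move=> /eqP/negbTE xv; rewrite /upd xv.
have newu : upd pos v t.+1 v = t.+1 by rewrite /upd eqxx.
have newp : upd par v p v = p by rewrite /upd eqxx.
have pos_le x : pos x <= upd pos v t.+1 x.
  by case: (eqVneq x v) => [->|/eqP/oldu->//]; rewrite pv.
have fromv u : e u v -> 0 < pos u -> h <= pos u.
  move=> uv u0; rewrite leqNgt; apply/negP => uh.
  by have := @s_closed _ _ _ _ _ _ _ S u v; rewrite u0 uh pv => /(_ isT uv).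
have ordh i : i < t -> upd ord t v i = ord i by move=> it; rewrite /upd (ltn_eqF it).
have ordh' : upd ord t v h.-1 = p by rewrite ordh //; lia.
split.
- move=> x; case: (eqVneq x v) => [->|/eqP xv].
    by rewrite newu /= /upd eqxx; split.
  rewrite oldu // => x0; have [xn xt xo] := s_vis S x0.
  by split=> //; [exact: leqW | rewrite ordh //; lia].
- move=> i; rewrite ltnS leq_eqVlt => /orP[/eqP->|it].
    by rewrite [upd ord _ _ _]/upd eqxx newu.
  by rewrite ordh // oldu ?(s_ord S) //; apply: old; rewrite (s_ord S).
- exact: leqW.
- move=> y; case: (eqVneq y v) => [->|/eqP yv].
    rewrite newu newp oldu ?pp //; last exact/eqP.
    by move=> _ _; split=> //; rewrite h0 ltnS.
  rewrite oldu // oldp // => y0 ny; have [e1 e2 e3] := s_par S y0 ny.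
  by have /andP[e4 _] := e2; split=> //; rewrite oldu //; apply: old.
- move=> x y; case: (eqVneq x v) => [->|/eqP xv]; first by rewrite newu; lia.
  by rewrite oldu // => xh xy; apply: leq_trans (pos_le y); apply: (s_closed S xh).
- move=> i _; rewrite ordh' ltnS leq_eqVlt => /orP[/eqP->|iq].
    by rewrite -vE newu.
  by apply: leq_trans (pos_le _); apply: (s_part S).
- by rewrite h0 ordh'.
- move=> u y; case: (eqVneq y v) => [->|/eqP yv].
    rewrite newu newp => uv; case: (eqVneq u v) => [->|/eqP uv']; first by rewrite newu; lia.
    rewrite !oldu // => [/andP[u0 _]|]; last exact/eqP.
    by rewrite pp; split; [exact/eqP | exact: fromv].
  rewrite [upd pos _ _ y]oldu // oldp // => uy /andP[u0 uy'].
  have uv : u <> v by move=> E; move: uy'; rewrite E newu; have := ule y; lia.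
  rewrite (oldu u) // in u0 uy' *; have uy2 : 0 < pos u < pos y by rewrite u0.
  have y0 : 0 < pos y by lia.
  have [ny le] := s_first S uy uy2; split=> //; rewrite oldu //.
  by have [_ /andP[/old]] := s_par S y0 ny.
- move=> y z; case: (eqVneq y v) => [->|/eqP yv].
    rewrite newu => _ _ _; case: (eqVneq z v) => [->|/eqP zv]; first by rewrite newu; lia.
    by rewrite oldu // => zt; have := ule z; lia.
  rewrite (oldu y) // (oldp y) // => y0 ny.
  have [_ /andP[/old pyv _] pyh] := s_par S y0 ny; rewrite (oldu (par y)) //.
  case: (eqVneq z v) => [->|/eqP zv]; first by rewrite newp => _ _; rewrite oldu ?pp //; apply/eqP.
  rewrite oldp // oldu // => nz yz; have z0 : 0 < pos z by lia.
  have [_ /andP[/old pzv _] _] := s_par S z0 nz; rewrite oldu //.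
  exact: (s_mono S).
- move=> r u x; case: (eqVneq r v) => [->|/eqP rv].
    by rewrite newp => E; rewrite E eqxx in vp.
  rewrite oldp // (oldu r) // => rr' ux /andP[u0 ur].
  have uv : u <> v by move=> E; move: ur; rewrite E newu; have := ule r; lia.
  rewrite oldu // in u0 ur; have ur2 : 0 < pos u < pos r by rewrite u0.
  have x2 := s_cut S rr' ux ur2; have /andP[/old xv _] := x2.
  by rewrite oldu.
- move=> r z; case: (eqVneq r v) => [->|/eqP rv].
    by rewrite newp => _ E; rewrite E eqxx in vp.
  rewrite oldu // oldp // => r0 rr' sr; case: (eqVneq z v) => [->|/eqP zv].
    move=> _; apply/negP => bz; have := s_late S r0 rr' sr => rr0.
    by have := s_cand S vn (ltn_trans vn rr0) bz; rewrite pv.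
  by rewrite oldu //; apply: (s_small S).
- by move=> x xn xr bx; apply: leq_trans (pos_le _); apply: (s_cand S).
- by move=> x xn xr; apply: leq_trans (pos_le _); apply: (s_cand2 S).
move=> r; case: (eqVneq r v) => [->|/eqP rv].
  by rewrite newp => _ E; rewrite E eqxx in vp.
by rewrite oldu // oldp //; apply: (s_late S).
Qed.

Lemma skip_child pos par ord h t q rr v : searching pos par ord h t q rr ->
  0 < h -> q < deg (ord h.-1) -> v = nth 0 (nb (ord h.-1)) q -> 0 < pos v ->
  searching pos par ord h t q.+1 rr.
Proof.
move=> [? ? ? ? ? part qd ? ? ? ? ? ? ?] h0 qd' vE pv; split=> //.
- move=> i _; rewrite ltnS leq_eqVlt => /orP[/eqP->|iq]; last exact: part.
  by rewrite -vE.
- by rewrite h0.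
Qed.

Lemma closed_all pos par ord h t q rr : searching pos par ord h t q rr ->
  scanned ord h q -> forall x y, 0 < pos x <= h -> e x y -> 0 < pos y.
Proof.
move=> S sc x y /andP[x0]; rewrite leq_eqVlt => /orP[/eqP E|xh]; last first.
  by apply: (s_closed S); rewrite x0.
have h0 : 0 < h by rewrite -E.
have xo : ord h.-1 = x by have [_ _] := s_vis S x0; rewrite E.
rewrite /scanned h0 xo in sc; move=> xy.
have iy : index y (nb x) < q by rewrite (eqP sc) index_mem.
by have := s_part S h0 iy; rewrite xo nth_index.
Qed.

Lemma pop pos par ord h t q rr : searching pos par ord h t q rr ->
  scanned ord h q -> h < t -> searching pos par ord h.+1 t 0 rr.
Proof.
move=> S sc ht; have cl := closed_all S sc.
case: S => ? ? ? sp ? part qd ? ? ? ? ? ? ?; split=> //.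
by move=> y y0 ny; have [? ? ?] := sp y y0 ny; split=> //; exact: leqW.
Qed.

Definition candidate rr v := (rr < n) && (v == rr) || (n <= rr) && (n + v == rr).

Lemma skip_root pos par ord h t q rr v : searching pos par ord h t q rr ->
  candidate rr v -> 0 < pos v \/ rr < n /\ ~~ big v ->
  searching pos par ord h t q rr.+1.
Proof.
case=> ? ? ? ? ? ? ? ? ? ? ? c1 c2 late cv pv; split=> //.
- move=> x xn; rewrite ltnS leq_eqVlt => /orP[/eqP xr bx|]; last exact: c1.
  have xv : x = v by move: cv; rewrite /candidate; lia.
  by rewrite xv in bx *; case: pv => // -[_]; rewrite bx.
- move=> x xn; rewrite ltnS leq_eqVlt => /orP[/eqP xr|]; last exact: c2.
  have xv : x = v by move: cv; rewrite /candidate; lia.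
  by rewrite xv; case: pv => // -[rn _]; exfalso; lia.
- by move=> r r0 rr0 sr; exact: leqW (late r r0 rr0 sr).
Qed.

Lemma visit_root pos par ord h q rr v : searching pos par ord h h q rr ->
  scanned ord h q -> candidate rr v -> v < n -> pos v = 0 -> (rr < n -> big v) ->
  searching (upd pos v h.+1) (upd par v v) (upd ord h v) h h.+1 q rr.+1.
Proof.
move=> S sc cv vn pv bv.
have cl : forall x y, 0 < pos x -> e x y -> 0 < pos y.
  move=> x y x0; apply: (closed_all S sc); rewrite x0.
  by have [] := s_vis S x0.
have old x : 0 < pos x -> x <> v by move=> x0 E; rewrite E pv in x0.
have ule x : 0 < pos x -> pos x <= h by case/(s_vis S).
have oldu x : x <> v -> upd pos v h.+1 x = pos x by move=> /eqP/negbTE xv; rewrite /upd xv.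
have oldp x : x <> v -> upd par v v x = par x by move=> /eqP/negbTE xv; rewrite /upd xv.
have newu : upd pos v h.+1 v = h.+1 by rewrite /upd eqxx.
have newp : upd par v v v = v by rewrite /upd eqxx.
have pos_le x : pos x <= upd pos v h.+1 x.
  by case: (eqVneq x v) => [->|/eqP/oldu->//]; rewrite pv.
have nofrom u : e u v -> 0 < pos u -> False.
  by move=> uv u0; have := cl u v u0 uv; rewrite pv.
have ordh i : i < h -> upd ord h v i = ord i by move=> it; rewrite /upd (ltn_eqF it).
have ordh' : 0 < h -> upd ord h v h.-1 = ord h.-1 by move=> h0; rewrite ordh //; lia.
have upd_lt x y : 0 < upd pos v h.+1 x < upd pos v h.+1 y -> x <> v /\ 0 < pos x.
  case: (eqVneq x v) => [->|/eqP xv]; last by rewrite oldu // => /andP[].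
  rewrite newu; case: (eqVneq y v) => [->|/eqP yv]; first by rewrite newu; lia.
  by rewrite oldu // => ?; have := ule y; lia.
split.
- move=> x; case: (eqVneq x v) => [->|/eqP xv].
    by rewrite newu /= /upd eqxx; split.
  rewrite oldu // => x0; have [xn xt xo] := s_vis S x0.
  by split=> //; [exact: leqW | rewrite ordh //; lia].
- move=> i; rewrite ltnS leq_eqVlt => /orP[/eqP->|it].
    by rewrite [upd ord _ _ _]/upd eqxx newu.
  by rewrite ordh // oldu ?(s_ord S) //; apply: old; rewrite (s_ord S).
- exact: leqnSn.
- move=> y; case: (eqVneq y v) => [->|/eqP yv]; first by rewrite newp.
  rewrite oldu // oldp // => y0 ny; have [e1 e2 e3] := s_par S y0 ny.
  by have /andP[e4 _] := e2; split=> //; rewrite oldu //; apply: old.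
- move=> x y; case: (eqVneq x v) => [->|/eqP xv]; first by rewrite newu; lia.
  by rewrite oldu // => xh xy; apply: leq_trans (pos_le y); apply: (s_closed S xh).
- move=> i h0; rewrite ordh' // => iq.
  by apply: leq_trans (pos_le _); apply: (s_part S).
- by have := s_q S; case: ifP => // h0; rewrite ordh'.
- move=> u y uy lt; have [uv u0] := upd_lt _ _ lt.
  case: (eqVneq y v) => [E|/eqP yv]; first by rewrite E in uy; case: (nofrom u).
  move: lt; rewrite !(oldu u) // (oldu y) // oldp // => lt; have y0 : 0 < pos y by case/andP: lt => _; apply: leq_ltn_trans.
  have [ny le] := s_first S uy lt; split=> //; rewrite oldu //.
  by have [_ /andP[/old]] := s_par S y0 ny.
- move=> y z; case: (eqVneq y v) => [->|/eqP yv]; first by rewrite newp.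
  case: (eqVneq z v) => [->|/eqP zv]; first by rewrite newp.
  rewrite !(oldu y) ?(oldu z) ?(oldp y) ?(oldp z) // => y0 ny nz yz.
  have z0 : 0 < pos z by lia.
  have [_ /andP[/old pyv _] pyh] := s_par S y0 ny; rewrite (oldu (par y)) //.
  have [_ /andP[/old pzv _] _] := s_par S z0 nz; rewrite oldu //.
  exact: (s_mono S).
- move=> r u x rE ux lt; have [uv u0] := upd_lt _ _ lt.
  have x0 := cl u x u0 ux; rewrite (oldu x); last exact: old.
  move: lt rE; case: (eqVneq r v) => [->|/eqP rv].
    by rewrite newu x0 ltnS => _ _; exact: ule.
  by rewrite !oldu // oldp // => lt rE; apply: (s_cut S rE ux).
- move=> r z; case: (eqVneq r v) => [->|/eqP rv].
    rewrite newu => _ _ sv; case: (eqVneq z v) => [->//|/eqP zv].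
    by rewrite oldu // => hz; have := ule z; lia.
  rewrite oldu // oldp // => r0 rr' sr; case: (eqVneq z v) => [->|/eqP zv].
    move=> _; apply/negP => bz; have := s_late S r0 rr' sr => rr0.
    by have := s_cand S vn (ltn_trans vn rr0) bz; rewrite pv.
  by rewrite oldu //; apply: (s_small S).
- move=> x xn; rewrite ltnS leq_eqVlt => /orP[/eqP xr _|xr bx].
    have -> : x = v by move: cv; rewrite /candidate; lia.
    by rewrite newu.
  by apply: leq_trans (pos_le _); apply: (s_cand S).
- move=> x xn; rewrite ltnS leq_eqVlt => /orP[/eqP xr|xr].
    have -> : x = v by move: cv; rewrite /candidate; lia.
    by rewrite newu.
  by apply: leq_trans (pos_le _); apply: (s_cand2 S).
move=> r; case: (eqVneq r v) => [->|/eqP rv].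
  rewrite newu newp ltnS => _ _ sv; rewrite leqNgt; apply/negP => /bv bv'.
  by rewrite bv' in sv.
by rewrite oldu // oldp // => r0 rE sr; exact: leqW (s_late S r0 rE sr).
Qed.

(** When no candidate is left, every vertex has been tried a second time, and has
    been admitted unless it was already found. *)
Lemma search_done pos par ord h q : searching pos par ord h h q (n + n) ->
  scanned ord h q ->
  [/\ bfs_forest nb pos par, forall x, x < n -> 0 < pos x,
      forall x, 0 < pos x -> pos x <= h /\ ord (pos x).-1 = x &
      forall i, i < h -> pos (ord i) = i.+1].
Proof.
move=> S sc; have vis x : x < n -> 0 < pos x.
  by move=> xn; apply: (s_cand2 S xn); rewrite ltn_add2l.
have ve x y : e x y -> 0 < pos x by move=> /nbn/vis.
split=> //; last 2 first.
- by move=> x /(s_vis S)[].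
- exact: (s_ord S).
split=> //.
- move=> x y x0 E; have [_ _ ex] := s_vis S x0.
  have y0 : 0 < pos y by rewrite -E.
  by have [_ _ ey] := s_vis S y0; rewrite -ex -ey E.
- move=> y y0 /eqP ny; have [e1 /andP[e2 e3] _] := s_par S y0 ny.
  by rewrite eC e1.
- move=> u y uy lt; have lt' : 0 < pos u < pos y by rewrite (ve _ _ uy).
  have [ny ->] := s_first S uy lt'.
  by rewrite andbT; apply/eqP.
- by move=> y z y0 /eqP ny /eqP nz; apply: (s_mono S).
- move=> r u v r0 rr uv ur; have lt' : 0 < pos u < pos r by rewrite (ve _ _ uv).
  by have /andP[] := s_cut S rr uv lt'.
- exact: (s_small S).
Qed.

Lemma tail_le pos par ord h t q rr : searching pos par ord h t q rr -> t <= n.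
Proof.
move=> S; rewrite -(size_iota 0 n) -(size_iota 0 t) -(size_map ord).
apply: uniq_leq_size.
  rewrite map_inj_in_uniq ?iota_uniq // => i j.
  rewrite !mem_iota => /= it jt E.
  by have := s_ord S it; rewrite E (s_ord S) // => -[].
move=> x /mapP[i]; rewrite mem_iota => it ->; rewrite mem_iota.
have oi : 0 < pos (ord i) by rewrite (s_ord S).
by have [] := s_vis S oi.
Qed.

End Search.

(** * Breadth-first search as a single loop *)

Section SearchLoop.

Variables (w n : nat) (nb : nat -> seq nat) (IN : nat -> nat).
Hypothesis G : chordal_lists nb.
Hypothesis nbn : forall x y, adj nb x y -> x < n.
Local Notation e := (adj nb).
Local Notation big := (big nb).
Local Notation deg x := (size (nb x)).
Local Notation start := (start nb).
Let eC : symmetric e := adj_sym G.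
Hypothesis IN0 : IN 0 = n.
Hypothesis INdeg : forall x, x < n -> IN (start x) = deg x.
Hypothesis INnb : forall x i, x < n -> i < deg x ->
  IN (start x + 1 + i) = nth 0 (nb x) i.
Hypothesis room : start n * 20 < 2 ^ w.
Local Notation len := (len n nb).
Local Notation parsed := (parsed n nb IN).

(** The number of arcs scanned so far, which measures the progress of the search
    together with the numbers of vertices taken and of candidates tried. *)
Definition arcs_done (pos : nat -> nat) h q :=
  \sum_(v < n) if 0 < pos v < h then deg v else
               if (0 < h) && (pos v == h) then q else 0.

Lemma start_sum x : start x = 1 + x + \sum_(v < x) deg v.
Proof. by elim: x => [|x IH] /=; rewrite ?big_ord0 // IH big_ord_recr /=; lia. Qed.

Section Abstract.
Variables (pos par ord : nat -> nat) (h t q rr : nat).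
Hypothesis S : searching n nb pos par ord h t q rr.

Lemma arcs_scan : 0 < h -> arcs_done pos h q.+1 = (arcs_done pos h q).+1.
Proof.
move=> h0; have ph := head_pos S h0.
have pn : ord h.-1 < n by have [] := s_vis S (_ : 0 < pos (ord h.-1)); rewrite ?ph.
rewrite /arcs_done (bigD1 (Ordinal pn)) // [in RHS](bigD1 (Ordinal pn)) //=.
rewrite ph h0 ltnn eqxx /= -addSn; congr (_ + _); apply: eq_bigr => v vp.
case: ifP => // _; case: eqP => // pv; case/eqP: vp; apply: ord_inj => /=.
have v0 : 0 < pos v by rewrite pv.
by have [_ _ <-] := s_vis S v0; rewrite pv.
Qed.

Lemma arcs_upd v q' : pos v = 0 ->
  arcs_done (upd pos v t.+1) h q' = arcs_done pos h q'.
Proof.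
move=> pv; apply: eq_bigr => u _; rewrite /upd; case: eqP => // ->.
have ht := s_head S; rewrite pv /=.
have -> : (t.+1 < h) = false by lia.
have -> : (t.+1 == h) = false by lia.
by rewrite andbF; case: (h).
Qed.

Lemma arcs_pop : scanned nb ord h q -> arcs_done pos h.+1 0 = arcs_done pos h q.
Proof.
move=> sc; apply: eq_bigr => v _; case: (posnP (pos v)) => [->|v0] /=.
  by case: (h).
case: (ltngtP (pos v) h) => vh.
- by rewrite ifT // ltnW.
- by rewrite ifF ?andbF; [case: ifP | lia].
- have h0 : 0 < h by rewrite -vh.
  rewrite vh leqnn h0; move: sc; rewrite /scanned h0 => /eqP ->.
  by have [_ _] := s_vis S v0; rewrite vh => ->.
Qed.

Lemma arcs_le : arcs_done pos h q + n < start n.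
Proof.
suff: arcs_done pos h q <= \sum_(v < n) deg v by rewrite start_sum; lia.
apply: leq_sum => v _; case: ifP => // _; case: ifP => // /andP[h0 /eqP vh].
have v0 : 0 < pos v by rewrite vh.
have [_ _ ov] := s_vis S v0; rewrite vh in ov.
by have := s_q S; rewrite h0 ov.
Qed.

End Abstract.

Definition bfs_link ord h q (s : state) :=
  if 0 < h then
    [/\ regs s rCUR = ord h.-1, regs s rJ = start (ord h.-1) + 1 + q &
        regs s rEND = start (ord h.-1) + 1 + deg (ord h.-1)]
  else regs s rJ = regs s rEND.

Definition bfs_state (i : nat) (s : state) := exists q,
  [/\ searching n nb (arrs s aPOS) (arrs s aPAR) (arrs s aORD)
        (regs s rHEAD) (regs s rTAIL) q (regs s rRR),
      bfs_link (arrs s aORD) (regs s rHEAD) q s, regs s rRR <= n + n &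
      i <= regs s rRR + regs s rHEAD + arcs_done (arrs s aPOS) (regs s rHEAD) q \/
      [/\ regs s rHEAD = regs s rTAIL, scanned nb (arrs s aORD) (regs s rHEAD) q
        & regs s rRR = n + n]].

Lemma nth_ord_lt pos par ord h t q rr : searching n nb pos par ord h t q rr ->
  0 < h -> ord h.-1 < n.
Proof.
move=> S h0; have ph := head_pos S h0.
by have [|] := s_vis S (_ : 0 < pos (ord h.-1)); rewrite ?ph.
Qed.

Lemma scan_correct i s : parsed s -> bfs_state i s -> regs s rJ < regs s rEND ->
  bfs_state i.+1 (run w bfs_scan s).
Proof.
move=> P [q [S L rn prog]] JE.
have h0 : 0 < regs s rHEAD.
  by move: L; rewrite /bfs_link; case: ifP => // _ E; rewrite E ltnn in JE.
move: L; rewrite /bfs_link h0; set x := arrs s aORD _ => -[Lc Lj Le].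
have xn : x < n := nth_ord_lt S h0.
have qd : q < deg x by move: JE; rewrite Lj Le; lia.
have le := start_mono nb xn; rewrite /= in le.
have vE : IN (start x + 1 + q) = nth 0 (nb x) q by apply: INnb.
have sm := small (k := _) room.
have tn := tail_le S.
have ge := start_ge nb n.
have ht := s_head S.
have prog' : i.+1 <= regs s rRR + regs s rHEAD +
    arcs_done (arrs s aPOS) (regs s rHEAD) q.+1.
  rewrite (arcs_scan S) //; case: prog => [|[_]]; first by lia.
  by rewrite /scanned h0 => /eqP E; move: qd; rewrite E ltnn.
rewrite /= Lj (p_in P) vE Lc mod0n !sm; [|lia..].
set v := nth _ _ q; case: (posnP (arrs s 5 v)) => [v0|v0]; last first.
  exists q.+1; split=> //=; first exact: (skip_child S h0 qd).
  - by rewrite /bfs_link /= h0 -/x; split=> //; lia.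
  - by left.
rewrite /= [regs s 10 + 1]addn1; exists q.+1; split=> //=.
- exact: (visit_child G nbn S h0 qd (erefl _) v0).
- rewrite /bfs_link /= h0.
  have -> : ((regs s 9).-1 == regs s 10) = false by lia.
  by rewrite -/x; split=> //; lia.
- by left; have := arcs_upd S q.+1 v0; rewrite /upd /= => ->.
Qed.

Lemma pop_correct i s : parsed s -> bfs_state i s ->
  regs s rEND <= regs s rJ -> regs s rHEAD < regs s rTAIL ->
  bfs_state i.+1 (run w bfs_pop s).
Proof.
move=> P [q [S L rn prog]] JE hlt.
have sc : scanned nb (arrs s aORD) (regs s rHEAD) q.
  move: L (s_q S); rewrite /bfs_link /scanned; case: ifP => // _ [_ E1 E2] qd.
  by move: JE; rewrite E1 E2; lia.
set x := arrs s aORD (regs s rHEAD).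
have px : arrs s aPOS x = (regs s rHEAD).+1 := s_ord S hlt.
have xn : x < n by have [|] := s_vis S (_ : 0 < arrs s aPOS x); rewrite ?px.
have le := start_mono nb xn; rewrite /= in le.
have sm := small (k := _) room.
have tn := tail_le S.
have ge := start_ge nb n.
rewrite /= -/x (p_off P) // (p_deg P) // !sm; [|lia..].
rewrite [regs s 9 + 1]addn1; exists 0; split=> //=.
- exact: pop S sc hlt.
- by rewrite /bfs_link /= -/x; split=> //; lia.
- left; rewrite (arcs_pop S) //; case: prog => [|[E _ _]]; first by lia.
  by rewrite E ltnn in hlt.
Qed.

Lemma root_correct i s : parsed s -> bfs_state i s ->
  regs s rEND <= regs s rJ -> regs s rTAIL <= regs s rHEAD ->
  regs s rRR < n + n -> bfs_state i.+1 (run w bfs_root s).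
Proof.
move=> P [q [S L rn prog]] JE hge rlt.
have hE : regs s rTAIL = regs s rHEAD by have := s_head S; lia.
rewrite hE in S.
have sc : scanned nb (arrs s aORD) (regs s rHEAD) q.
  move: L (s_q S); rewrite /bfs_link /scanned; case: ifP => // _ [_ E1 E2] qd.
  by move: JE; rewrite E1 E2; lia.
have sm := small (k := _) room.
have tn := tail_le S.
have ge := start_ge nb n.
pose v := if regs s rRR < n then regs s rRR else regs s rRR - n.
have vn : v < n by rewrite /v; case: ifP; lia.
have cv : candidate n (regs s rRR) v.
  by rewrite /candidate /v; case: ltnP => //= le; rewrite ?eqxx //; lia.
have nd : ~ regs s rRR = n + n by lia.
have prog' : i.+1 <= (regs s rRR).+1 + regs s rHEAD +
    arcs_done (arrs s aPOS) (regs s rHEAD) q.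
  by case: prog => [|[_ _ E]]; [lia | case: nd].
have -> : run w bfs_root s = run w bfs_admit (set_reg s rV v).
  rewrite -[LHS]/(run w bfs_admit (run w bfs_choose s)); congr (run w bfs_admit _).
  by rewrite /= (p_n P) /v; case: ifP.
rewrite /= (p_n P) (p_deg P) // mod0n (sm 3); last by lia.
case: ifP => [/andP[/eqP v0 nsm]|ad] /=; (rewrite !sm; [|lia..]);
  rewrite [regs s 13 + 1]addn1 ?[regs s 10 + 1]addn1; exists q; split=> //=.
- rewrite hE; apply: (visit_root S sc cv vn v0) => rrn.
  by move: nsm; rewrite rrn /= -leqNgt.
- move: L; rewrite /bfs_link /=; case: ifP => // h0 [L1 L2 L3].
  have -> : ((regs s 9).-1 == regs s 10) = false by lia.
  by split.
- by left; have := arcs_upd S q v0; rewrite /upd /= hE => ->.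
- rewrite hE; apply: (skip_root S cv); move/negbT: ad.
  rewrite negb_and -lt0n negbK => /orP[|/andP[r1 r2]]; [by left | right].
  by rewrite r1 -leqNgt; split.
- by left.
Qed.

Lemma bfs_step_correct i s : parsed s -> bfs_state i s -> bfs_state i.+1 (run w bfs_step s).
Proof.
move=> P I; rewrite /bfs_step run_if [holds _ _ _]/=.
case: ltnP => JE; first exact: scan_correct.
rewrite run_if [holds _ _ _]/=; case: ltnP => ht; first exact: pop_correct.
rewrite run_if [holds _ _ _]/= (p_n P) (small room); last first.
  by have := start_ge nb n; lia.
case: ltnP => rr; first exact: root_correct.
have [q [S L rn prog]] := I; exists q; split=> //; right.
have sc : scanned nb (arrs s aORD) (regs s rHEAD) q.
  move: L (s_q S); rewrite /bfs_link /scanned; case: ifP => // _ [_ E1 E2] qd.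
  by move: JE; rewrite E1 E2; lia.
by split=> //; apply/eqP; rewrite eqn_leq ?rn ?rr // (s_head S).
Qed.

Definition bfs_loop : prog := Loop rK rLEN bfs_step.

(** The measure of progress increases in every iteration and cannot reach [len],
    so the search ends within the loop. *)
Lemma bfs_correct s : parsed s ->
  (forall a, a \in [:: aPOS; aORD; aPAR] -> arrs s a = (fun _ => 0)) ->
  (forall r, r \in [:: rHEAD; rTAIL; rJ; rEND; rRR] -> regs s r = 0) ->
  let s' := prun w bfs_loop s in
  [/\ parsed s', bfs_forest nb (arrs s' aPOS) (arrs s' aPAR),
      forall x, x < n -> 0 < arrs s' aPOS x,
      forall x, 0 < arrs s' aPOS x ->
        arrs s' aPOS x <= regs s' rTAIL /\ arrs s' aORD (arrs s' aPOS x).-1 = x &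
      (forall i, i < regs s' rTAIL -> arrs s' aPOS (arrs s' aORD i) = i.+1) /\
      regs s' rTAIL <= n].
Proof.
move=> P a0 r0 s'.
have P' : parsed s'.
  by apply: parsed_ext P => [a||]; rewrite ?prun_reg // !inE => /or4P[] /eqP->;
    rewrite prun_arr.
have I : bfs_state len s'.
  rewrite -[len](p_len P); apply: (@loop_rule w (fun i t => bfs_state i t)) => //.
  - exists 0; rewrite /bfs_link /= (r0 rHEAD isT) (r0 rTAIL isT) (r0 rJ isT).
    rewrite (r0 rEND isT) (r0 rRR isT) !a0 //.
    by split=> //; left.
  - move=> i t il tk ka kr [q It].
    have Pt : parsed t.
      by apply: parsed_ext P => [a||]; rewrite ?kr // !inE => /or4P[] /eqP->;
        rewrite ka.
    have [q' ?] : bfs_state i.+1 (run w bfs_step t).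
      by apply: bfs_step_correct => //; exists q.
    by exists q'.
have [q [S L rn prog]] := I.
case: prog => [|[hE sc rE]]; first by have := arcs_le S; have := s_head S;
  have := tail_le S; rewrite /len; lia.
rewrite hE rE in S sc; have [b1 b2 b3 b4] := search_done G nbn S sc.
by split=> //; split=> //; exact: tail_le S.
Qed.

End SearchLoop.

(** * Listing diamonds *)

Notation rFV := 15 (only parsing).
Notation rA := 16 (only parsing).
Notation rB := 17 (only parsing).
Notation rC := 18 (only parsing).
Notation rD := 19 (only parsing).
Notation rZ := 20 (only parsing).
Notation rCD := 21 (only parsing).
Notation rZA := 22 (only parsing).
Notation rZB := 23 (only parsing).
Notation aH1 := 9 (only parsing).
Notation aH2 := 10 (only parsing).

Definition differ e1 e2 := TNot (TEq e1 e2).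

Definition avoids (v a b : expr) : test := TAnd (differ v a) (differ v b).

(** Among three neighbors of [c], one is different from [a] and from [b]. *)
Definition choose_nbr (r : nat) (c a b : expr) : cmd :=
  let v i := Get aIN (Add (Get aOFF c) (Const i)) in
  If (avoids (v 0) a b) (r ::= v 0)
    (If (avoids (v 1) a b) (r ::= v 1) (r ::= v 2)).

Definition emit (r : nat) : cmd :=
  Store aOUT rOUT r ;; rOUT ::= Add rOUT (Const 1).

Definition emits : seq nat -> cmd := foldr (fun r c => emit r ;; c) Skip.

Definition nontree : test :=
  TAnd (differ (Get aPAR rY) rX) (differ (Get aPAR rX) rY).

Definition blame (a b c d : expr) : cmd :=
  rA ::= a ;; rB ::= b ;; rC ::= c ;; rD ::= d ;; rFV ::= Const 1.

(** Two different siblings per vertex are recorded, which is enough to see whether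
    a given one is the only one. *)
Definition sib_body : cmd :=
  If nontree
    (If (TEq (Get aPAR rX) (Get aPAR rY))
      (If (TEq (Get aH1 rX) (Const 0)) (Store aH1 rX (Add rY (Const 1)))
        (If (TEq (Get aH1 rX) (Add rY (Const 1))) Skip
          (Store aH2 rX (Add rY (Const 1)))))
      (If (TLt (Get aPOS rX) (Get aPOS rY))
        (blame (Get aPAR rY) rX (Get aPAR rX) rY) Skip))
    Skip.

Definition tip_body : cmd :=
  If (TAnd nontree (TLt (Const 2) (Get aDEG rX)))
    (If (differ (Get aH1 rY) (Add rX (Const 1)))
      (blame (Get aPAR rX) rY rX (Defs.Sub (Get aH1 rY) (Const 1)))
      (If (differ (Get aH2 rY) (Const 0))
        (blame (Get aPAR rX) rY rX (Defs.Sub (Get aH2 rY) (Const 1))) Skip))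
    Skip.

Definition adjacent (r a b : nat) : prog :=
  arc_loop (If (TAnd (TEq rX a) (TEq rY b)) (r ::= Const 1) Skip).

Definition diamond_list : cmd :=
  If (TEq rCD (Const 1)) (emits [:: rA; rB; rC; rD])
    (If (TAnd (TEq rZA (Const 1)) (TEq rZB (Const 1)))
      (emits [:: rZ; rA; rB; rC]) (emits [:: rA; rB; rC; rD; rZ])).

(** With the third neighbor [z] of the tip [c], the cases of [diamond_tip] are
    told apart by three searches for an edge.  If [z] sees both [a] and [b],
    these three and [c] form K4. *)
Definition report_diamond : prog :=
  Chain (Base (choose_nbr rZ rC rA rB))
    (Chain (adjacent rCD rC rD) (Chain (adjacent rZA rZ rA)
      (Chain (adjacent rZB rZ rB) (Base diamond_list)))).

Section Blame.

Variables (w n : nat) (nb : nat -> seq nat) (IN : nat -> nat).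
Hypothesis G : chordal_lists nb.
Hypothesis nbn : forall x y, adj nb x y -> x < n.
Local Notation e := (adj nb).
Local Notation big := (big nb).
Local Notation deg x := (size (nb x)).
Local Notation start := (start nb).
Local Notation tri := (tri nb).
Let eC : symmetric e := adj_sym G.
Let eI : irreflexive e := adj_irr G.
Hypothesis INnb : forall x i, x < n -> i < deg x ->
  IN (start x + 1 + i) = nth 0 (nb x) i.
Hypothesis room : start n * 20 < 2 ^ w.
Local Notation len := (len n nb).
Local Notation parsed := (parsed n nb IN).

Definition pick3 c a b :=
  let v := nth 0 (nb c) in
  if (v 0 != a) && (v 0 != b) then v 0
  else if (v 1 != a) && (v 1 != b) then v 1 else v 2.

Lemma pick3P c a b : big c ->
  [/\ e c (pick3 c a b), pick3 c a b != a & pick3 c a b != b].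
Proof.
move=> bc; have U := nb_uniq G c; rewrite bigE in bc.
have M i : i < 3 -> e c (nth 0 (nb c) i).
  by move=> i3; rewrite /adj mem_nth // (leq_trans i3).
have D i j : i < 3 -> j < 3 -> i != j -> nth 0 (nb c) i != nth 0 (nb c) j.
  by move=> i3 j3; rewrite nth_uniq // ?(leq_trans i3) ?(leq_trans j3).
rewrite /pick3; case: ifP => [/andP[]|n0]; first by split; rewrite ?M.
case: ifP => [/andP[]|n1]; first by split; rewrite ?M.
have d01 := D 0 1 isT isT isT; have d02 := D 2 0 isT isT isT.
have d12 := D 2 1 isT isT isT; split; first exact: M.
- move/negbT: n0; move/negbT: n1; rewrite !negb_and !negbK.
  case/orP => /eqP E1; case/orP => /eqP E0; rewrite -?E0 // -?E1 //.
  by rewrite E0 E1 eqxx in d01.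
- move/negbT: n0; move/negbT: n1; rewrite !negb_and !negbK.
  case/orP => /eqP E1; case/orP => /eqP E0; rewrite -?E0 // -?E1 //.
  by rewrite E0 E1 eqxx in d01.
Qed.

Lemma run_pick s r c a b : parsed s -> eval w s c < n -> big (eval w s c) ->
  run w (choose_nbr r c a b) s =
  set_reg s r (pick3 (eval w s c) (eval w s a) (eval w s b)).
Proof.
move=> P cn bc; set x := eval w s c in cn bc *.
have le := start_mono nb cn; rewrite /= in le; have ge := start_ge nb n.
rewrite bigE in bc.
have vE i : i < 3 -> eval w s (Get aIN (Add (Get aOFF c) (Const i))) = nth 0 (nb x) i.
  move=> i3; rewrite /= -/x (p_in P) (p_off P) // !(small room); [|lia..].
  by apply: INnb => //; apply: leq_trans bc.
rewrite /choose_nbr !run_if -!/(eval _ _ _) /pick3.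
have hE v : holds w s (avoids v a b) = (eval w s v != eval w s a) && (eval w s v != eval w s b).
  by [].
by rewrite !hE !vE //; case: ifP => _; [|case: ifP => _]; rewrite -(vE _ _).
Qed.

Definition out (s : state) := [seq arrs s aOUT i | i <- iota 0 (regs s rOUT)].

Lemma run_emit r s : regs s rOUT < start n * 19 ->
  out (run w (emit r) s) = rcons (out s) (regs s r) /\
  regs (run w (emit r) s) rOUT = (regs s rOUT).+1.
Proof.
move=> lt; rewrite /out /= !(small room); [|lia..].
split; last by rewrite addn1.
rewrite iotaD map_cat /= add0n eqxx -cats1; congr (_ ++ _).
by apply/eq_in_map => i; rewrite mem_iota => /andP[_ il]; rewrite ltn_eqF.
Qed.

Lemma run_emits rs s : rOUT \notin rs -> regs s rOUT + size rs <= start n * 19 ->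
  out (run w (emits rs) s) = out s ++ [seq regs s r | r <- rs] /\
  regs (run w (emits rs) s) rOUT = regs s rOUT + size rs.
Proof.
elim: rs s => [|r rs IH] s; first by rewrite cats0 addn0.
rewrite inE negb_or eq_sym => /andP[r1 nrs] le.
have [|o1 o2] := @run_emit r s; first by rewrite (leq_trans _ le) //= addnS ltnS leq_addr.
have [//||o3 o4] := IH (run w (emit r) s).
  by rewrite o2 (leq_trans _ le) //= addSnnS.
rewrite [run w _ _]/(run w (emits rs) (run w (emit r) s)) o3 o4 o1 o2 -cats1 -catA.
split; last by rewrite /= addSnnS.
congr (_ ++ _); congr (_ :: _); apply/eq_in_map => x xrs.
by rewrite run_reg //=; apply: contraNneq nrs => <-.
Qed.

Lemma emits_keeps_reg x rs : x != rOUT -> keeps_reg x (emits rs).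
Proof. by move=> xo; elim: rs => //= r rs ->; rewrite xo. Qed.

Lemma parsed_keep s p : all (prog_keeps_arr^~ p) [:: aIN; aOFF; aDEG; aSRC] ->
  prog_keeps_reg rN p && prog_keeps_reg rLEN p -> parsed s -> parsed (prun w p s).
Proof.
move=> /allP ka /andP[kn kl]; apply: parsed_ext; rewrite ?prun_reg // => a ain.
by rewrite prun_arr //; apply: ka.
Qed.

Lemma adjacent_correct r a b s : parsed s -> regs s r = 0 ->
  [/\ r != rLEN, r != rK, r != rX & r != rY] ->
  [/\ a \notin [:: rK; rX; rY; r] & b \notin [:: rK; rX; rY; r]] ->
  regs (prun w (adjacent r a b) s) r = e (regs s a) (regs s b).
Proof.
move=> P r0 [rl rk rx ry] [an bn]; have ge := start_ge nb n.
have m1 : 1 %% 2 ^ w = 1 by rewrite (small room) //; lia.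
have [||||||||||S1 R1] := @arc_rule w n nb IN room
  (If (TAnd (TEq rX a) (TEq rY b)) (r ::= Const 1) Skip) s
  (fun t => (regs t r == 0) || (regs t r == 1) && e (regs s a) (regs s b))
  (fun t x y => (x == regs s a) && (y == regs s b) -> regs t r = 1) P.
all: try by rewrite //= 1?eq_sym ?rl ?rk ?rx ?ry.
- move=> t q v q3; rewrite /= (_ : (r == q) = false) //.
  by apply: contraTF q3 => /eqP<-; rewrite !inE !negb_or rk rx ry.
- move=> t q v x y q3; rewrite /= (_ : (r == q) = false) //.
  by apply: contraTF q3 => /eqP<-; rewrite !inE !negb_or rk rx ry.
- by rewrite r0.
- move=> t x y xy tx ty ka kr ht.
  have keep q : q \notin [:: rK; rX; rY; r] -> regs t q = regs s q.
    rewrite -[[:: _; _; _; _]]/([:: rK; rX; rY] ++ [:: r]) mem_cat negb_or mem_seq1.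
    by move=> /andP[q3 qr]; apply: kr; rewrite q3 /= ?andbT.
  rewrite run_if /= m1 tx ty (keep a an) (keep b bn).
  case: ifP => [/andP[/eqP xa /eqP yb]|nE]; rewrite /= ?eqxx.
    by rewrite -xa -yb xy orbT; split.
  by split=> //; rewrite nE.
case: (boolP (e _ _)) S1 (R1 (regs s a) (regs s b)) => [ab _ ->//|_]; rewrite ?eqxx //.
by rewrite andbF orbF => /eqP.
Qed.

Lemma adjacent_keeps r a b s q : q \notin [:: rK; rX; rY; r] ->
  regs (prun w (adjacent r a b) s) q = regs s q.
Proof.
rewrite !inE !negb_or => /and4P[q4 q5 q6 qr]; rewrite prun_reg //=.
by rewrite q4 q5 q6 qr.
Qed.

Lemma diamond_correct s : parsed s -> regs s rOUT = 0 ->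
  regs s rCD = 0 -> regs s rZA = 0 -> regs s rZB = 0 ->
  diamond nb (regs s rA) (regs s rB) (regs s rC) (regs s rD) ->
  obs nb (out (prun w report_diamond s)).
Proof.
move=> P o0 cd0 za0 zb0.
set a := regs s rA; set b := regs s rB; set c := regs s rC; set d := regs s rD.
move=> /and4P[tc td ncd bc].
have cn : c < n by case/and3P: tc => _ ac _; apply: (nbn (y := a)); rewrite eC.
pose z := pick3 c a b; have [cz za zb] := pick3P a b bc.
have E1 : prun w (Base (choose_nbr rZ rC rA rB)) s = set_reg s rZ z.
  exact: (@run_pick s rZ rC rA rB P cn bc).
pose s1 := set_reg s rZ z; pose s2 := prun w (adjacent rCD rC rD) s1.
pose s3 := prun w (adjacent rZA rZ rA) s2; pose s4 := prun w (adjacent rZB rZ rB) s3.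
rewrite -[prun w _ _]/(run w diamond_list (prun w (adjacent rZB rZ rB)
  (prun w (adjacent rZA rZ rA) (prun w (adjacent rCD rC rD)
    (prun w (Base (choose_nbr rZ rC rA rB)) s))))) E1 -/s1 -/s2 -/s3 -/s4.
have P1 : parsed s1 by apply: parsed_ext P.
have P2 : parsed s2 by apply: parsed_keep.
have P3 : parsed s3 by apply: parsed_keep.
have k4 q : q \notin [:: rK; rX; rY; rZB] -> regs s4 q = regs s3 q.
  exact: adjacent_keeps.
have k3 q : q \notin [:: rK; rX; rY; rZA] -> regs s3 q = regs s2 q.
  exact: adjacent_keeps.
have k2 q : q \notin [:: rK; rX; rY; rCD] -> regs s2 q = regs s1 q.
  exact: adjacent_keeps.
have Ecd : regs s4 rCD = e c d.
  by rewrite k4 // k3 // adjacent_correct.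
have Eza : regs s4 rZA = e z a.
  by rewrite k4 // adjacent_correct // ?k2.
have Ezb : regs s4 rZB = e z b.
  by rewrite adjacent_correct // ?k3 ?k2.
have ge := start_ge nb n.
have V q : q \in [:: rOUT; rA; rB; rC; rD; rZ] -> regs s4 q = regs s1 q.
  by rewrite !inE => /orP[|/orP[|/orP[|/orP[|/orP[]]]]] /eqP->; rewrite k4 ?k3 ?k2.
have O : out s4 = [::] by rewrite /out V //= o0.
have R rs : rOUT \notin rs -> size rs <= 5 ->
    out (run w (emits rs) s4) = [seq regs s4 r | r <- rs].
  move=> nrs srs; have [|-> _] := @run_emits rs s4 nrs; last by rewrite O.
  by rewrite V //= o0 add0n (leq_trans srs) //; move: ge; clear; lia.
have m1 : 1 %% 2 ^ w = 1 by rewrite (small room) //; lia.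
rewrite /diamond_list run_if [holds _ _ _]/= m1 Ecd eqb1.
have [ab ac bc'] := and3P tc; have [_ ad bd] := and3P td.
case: (boolP (e c d)) => cd.
  rewrite R //= !V //=; constructor 1; left; exact: (K4_copy G).
rewrite run_if [holds _ _ _]/= m1 Eza Ezb !eqb1; case: ifP => zab.
  rewrite R //= !V //=; constructor 1; left; case/andP: zab => za' zb'.
  by apply: (K4_copy G); rewrite // eC.
rewrite R //= !V //=; have [g1 g2 k] := diamond_tip G tc td ncd cd cz za zb.
case: (boolP (e z a)) zab => /= za' zb'.
  constructor 2; apply: (copy_eq _ _ (g1 za' (negbT zb'))) => //.
  move=> x; rewrite !inE.
  by case: (x == a) (x == b) (x == c) (x == d) (x == z) => [] [] [] [] [].
case: (boolP (e z b)) => [zb''|zb''].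
  constructor 2; apply: (copy_eq _ _ (g2 za' zb'')) => //.
  move=> x; rewrite !inE.
  by case: (x == a) (x == b) (x == c) (x == d) (x == z) => [] [] [] [] [].
by constructor 1; right; apply: k.
Qed.

End Blame.

(** * Edges outside the forest *)

Section SiblingLoops.

Variables (w n : nat) (nb : nat -> seq nat) (IN pos par : nat -> nat).
Hypothesis G : chordal_lists nb.
Hypothesis nbn : forall x y, adj nb x y -> x < n.
Local Notation e := (adj nb).
Local Notation big := (big nb).
Local Notation deg x := (size (nb x)).
Local Notation start := (start nb).
Local Notation sib := (sib nb par).
Local Notation parsed := (parsed n nb IN).
Let eC : symmetric e := adj_sym G.
Hypothesis room : start n * 20 < 2 ^ w.
Hypothesis F : bfs_forest nb pos par.

Definition blamed (t : state) :=
  regs t rFV != 0 -> diamond nb (regs t rA) (regs t rB) (regs t rC) (regs t rD).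

Record sib_lists (h1 h2 : nat -> nat) : Prop := SibLists {
  sl_ex : forall x y, sib x y -> h1 x != 0 /\ (h1 x = y.+1 \/ h2 x != 0);
  sl_1 : forall x, h1 x != 0 -> sib x (h1 x).-1;
  sl_2 : forall x, h2 x != 0 -> sib x (h2 x).-1 /\ h2 x <> h1 x }.

Lemma adj_n x y : e x y -> x < n /\ y < n.
Proof. by move=> xy; rewrite (nbn xy) (nbn (y := x)) // eC. Qed.

Lemma sib_loop_correct s : parsed s -> arrs s aPOS = pos -> arrs s aPAR = par ->
  arrs s aH1 = (fun _ => 0) -> arrs s aH2 = (fun _ => 0) -> regs s rFV = 0 ->
  let s' := prun w (arc_loop sib_body) s in
  blamed s' /\ (regs s' rFV = 0 -> sib_lists (arrs s' aH1) (arrs s' aH2) /\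
    forall x y, e x y -> [|| par y == x, par x == y | par x == par y]).
Proof.
move=> P posE parE h10 h20 fv0 s'.
have ge := start_ge nb n.
have m1 : 1 %% 2 ^ w = 1 by rewrite (small room) //; lia.
pose Inv t := [/\ blamed t,
  forall x, arrs t aH1 x != 0 -> sib x (arrs t aH1 x).-1 &
  forall x, arrs t aH2 x != 0 -> [/\ sib x (arrs t aH2 x).-1, arrs t aH1 x != 0 &
    arrs t aH2 x <> arrs t aH1 x]].
pose Seen t x y := sib x y -> if par x == par y then
    arrs t aH1 x != 0 /\ (arrs t aH1 x = y.+1 \/ arrs t aH2 x != 0)
  else pos x < pos y -> regs t rFV != 0.
have [||||||||||S1 R1] := @arc_rule w n nb IN room sib_body s Inv Seen P; rewrite //.
- by move=> t q v; rewrite !inE => /or3P[] /eqP->.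
- by move=> t q v x y; rewrite !inE => /or3P[] /eqP->.
- by rewrite /Inv /blamed fv0 h10 h20.
- move=> t x y xy tx ty ka kr [I1 I2 I3].
  have [xn yn] := adj_n xy.
  have tpos : arrs t aPOS = pos by rewrite ka.
  have tpar : arrs t aPAR = par by rewrite ka.
  rewrite /sib_body run_if [holds _ _ _]/= tpar tx ty.
  case: ifP => [/andP[nyx nxy]|ns]; last first.
    by split=> // /and3P[_ a b]; rewrite a b in ns.
  have sxy : sib x y by rewrite /(sib _ _) xy nyx nxy.
  rewrite run_if [holds _ _ _]/= tpar tx ty; case: ifP => E.
    rewrite run_if [holds _ _ _]/= mod0n tx; case: ifP => h1x.
      rewrite /= tx ty m1 (small room) ?addn1; last by lia.
      split.
      + split=> // z /=; case: (eqVneq z x) => [->|_] //; [exact: I2| |exact: I3].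
        by move=> /I3[_ + _]; rewrite (eqP h1x).
      + by rewrite /Seen /= E eqxx; split=> //; left.
      + move=> x' y'; rewrite /Seen /= => H /H; case: ifP => // _.
        by case: (eqVneq x' x) => [->|//]; rewrite (eqP h1x) eqxx => -[].
    rewrite run_if [holds _ _ _]/= m1 tx ty (small room) ?addn1; last by lia.
    case: ifP => h1y.
      split=> //; rewrite /Seen E => _; split; first by rewrite h1x.
      by left; apply/eqP.
    rewrite /= tx ty m1 (small room) ?addn1; last by lia.
    split.
    + split=> // z /=; case: (eqVneq z x) => [-> _|_]; last exact: I3.
      by split=> //; [rewrite h1x | apply/eqP; rewrite eq_sym h1y].
    + by rewrite /Seen /= E eqxx h1x; split=> //; right.
    + move=> x' y'; rewrite /Seen /= => H /H; case: ifP => // _ [hx hy]; split=> //.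
      by case: (eqVneq x' x) => // _; right.
  rewrite run_if [holds _ _ _]/= tpos tx ty; case: ifP => lt; last first.
    by split=> //; rewrite /Seen E lt.
  rewrite /= tpar tx ty m1; split.
  + split=> // _ /=; apply: (nontree_diamond G F xy lt nyx).
    by rewrite eq_sym E.
  + by rewrite /Seen /= E.
  + by move=> x' y'; rewrite /Seen /= => H /H; case: ifP => // _ H' /H'.
have {}S1 : Inv s' := S1; case: S1 => I1 I2 I3; split=> // fv.
have R2 x y : sib x y -> par x == par y /\
    arrs s' aH1 x != 0 /\ (arrs s' aH1 x = y.+1 \/ arrs s' aH2 x != 0).
  move=> xy; have exy : e x y by case/and3P: xy.
  have yx : sib y x by rewrite sibC.
  have eyx : e y x by rewrite eC.
  have := R1 _ _ exy xy; case: ifP => // npp H.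
  have := R1 _ _ eyx yx; rewrite eq_sym npp => H'.
  by case: (adj_pos G F exy) => [/H|/H']; rewrite -/s' fv.
split.
  by split=> // [x y /R2[]|x /I3[]].
move=> x y xy; case: (eqVneq (par y) x) => //= nyx; case: (eqVneq (par x) y) => //= nxy.
by have [|->] := R2 x y _; rewrite // /(sib _ _) xy nyx nxy.
Qed.

Hypothesis S : forall x y, e x y -> [|| par y == x, par x == y | par x == par y].

Lemma tip_loop_correct s h1 h2 : parsed s -> arrs s aPAR = par ->
  arrs s aH1 = h1 -> arrs s aH2 = h2 -> sib_lists h1 h2 -> regs s rFV = 0 ->
  let s' := prun w (arc_loop tip_body) s in
  blamed s' /\ (regs s' rFV = 0 ->
    forall x y d, sib x y -> sib y d -> d != x -> ~~ big x).
Proof.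
move=> P parE h1E h2E SL fv0 s'.
have ge := start_ge nb n.
have sm := small (k := _) room.
have m1 : 1 %% 2 ^ w = 1 by rewrite sm //; lia.
pose Seen t x y := sib x y -> big x -> regs t rFV = 0 ->
  forall d, sib y d -> d = x.
have [||||||||||S1 R1] := @arc_rule w n nb IN room tip_body s blamed Seen P; rewrite //.
- by move=> t q v; rewrite !inE => /or3P[] /eqP->.
- by move=> t q v x y; rewrite !inE => /or3P[] /eqP->.
- by rewrite /blamed fv0.
- move=> t x y xy tx ty ka kr I1.
  have [xn yn] := adj_n xy.
  have tpar : arrs t aPAR = par by rewrite ka.
  have t1 : arrs t aH1 = h1 by rewrite ka.
  have t2 : arrs t aH2 = h2 by rewrite ka.
  have td : arrs t aDEG x = deg x by rewrite ka // (p_deg P).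
  rewrite /tip_body run_if [holds _ _ _]/= tpar tx ty td sm; last by lia.
  case: ifP => [/andP[/andP[nyx nxy] bx]|ns]; last first.
    split=> // xyS bx; move: ns; have /and3P[_ -> ->] := xyS.
    by rewrite -/(big x) bx.
  have xyS : sib x y by rewrite /(sib _ _) xy nyx nxy.
  have yxS : sib y x by rewrite sibC.
  have [_ pE _ _ _] := sib_par F S xyS.
  have t3 := sib_up G F S xyS.
  have blame_ok d : sib y d -> d <> x -> diamond nb (par x) y x d.
    move=> yd dx; have t4 := sib_up G F S yd; rewrite -pE in t4.
    by apply/and4P; split=> //; [rewrite (triC G) | rewrite eq_sym; apply/eqP].
  have [h1y hx] := sl_ex SL yxS.
  rewrite run_if [holds _ _ _]/= t1 tx ty m1 sm ?addn1; last by lia.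
  case: ifP => h1x.
    rewrite /= tpar t1 tx ty m1 subn1; split=> //.
    move=> _ /=; apply: blame_ok; first exact: (sl_1 SL).
    by move=> E; move: h1x; rewrite -E prednK ?lt0n // eqxx.
  rewrite run_if [holds _ _ _]/= t2 ty mod0n; case: ifP => h2y.
    rewrite /= tpar t2 tx ty m1 subn1; split=> //.
    have [yd ne] := sl_2 SL h2y.
    move=> _ /=; apply: blame_ok => // E; apply: ne.
    by rewrite -[h2 y]prednK ?lt0n // E; apply/esym/eqP/negbFE.
  split=> // _ _ _ d yd; have [_ [E|]] := sl_ex SL yd; last by rewrite h2y.
  by move/negbFE: h1x; rewrite E eqSS => /eqP.
have {}S1 : blamed s' := S1; split=> // fv x y d xy yd dx; apply/negP => bx.
have exy : e x y by case/and3P: xy.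
by move: dx; rewrite (R1 _ _ exy xy bx fv d yd) eqxx.
Qed.

End SiblingLoops.

(** * Triangles *)

Notation rT := 24 (only parsing).
Notation rFX := 25 (only parsing).
Notation rFY := 26 (only parsing).
Notation rF4 := 27 (only parsing).
Notation rFK := 28 (only parsing).
Notation rU := 29 (only parsing).
Notation rP := 30 (only parsing).
Notation rQ := 31 (only parsing).
Notation rE1 := 32 (only parsing).
Notation rE2 := 33 (only parsing).
Notation aT1A := 11 (only parsing).
Notation aT1B := 12 (only parsing).
Notation aT2A := 13 (only parsing).
Notation aT2B := 14 (only parsing).

Definition suc (e : expr) := Add e (Const 1).
Definition dec (e : expr) := Defs.Sub e (Const 1).

(** At most two triangles are kept at [u], the second one disjoint from the first
    apart from [u]. *)
Definition add_tri (u a b : nat) : cmd :=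
  If (TEq (Get aT1A u) (Const 0))
    (Store aT1A u (suc a) ;; Store aT1B u (suc b))
    (If (TAnd (TEq (Get aT2A u) (Const 0))
          (TAnd (avoids (suc a) (Get aT1A u) (Get aT1B u))
                (avoids (suc b) (Get aT1A u) (Get aT1B u))))
      (Store aT2A u (suc a) ;; Store aT2B u (suc b)) Skip).

Definition tri_body : cmd :=
  If nontree (rT ::= Get aPAR rX ;; add_tri rT rX rY ;; add_tri rX rT rY) Skip.

Definition find (f r1 r2 : nat) (b : test) : prog :=
  arc_loop (If b (r1 ::= rX ;; r2 ::= rY ;; f ::= Const 1) Skip).

Definition big_test (e : expr) := TLt (Const 2) (Get aDEG e).
Definition shared_test (e : expr) := differ (Get aT2A e) (Const 0).

Definition find_D4 : prog := find rF4 rP rQ (TAnd (shared_test rX) (shared_test rY)).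
(** A copy of X127 consists of a shared vertex and a triangle at it with two large
    vertices.  The shared vertex is the parent of the two siblings in the
    triangle, or, in [find_side], one of them. *)
Definition find_top : prog := find rFX rP rQ
  (TAnd nontree (TAnd (shared_test (Get aPAR rX)) (TAnd (big_test rX) (big_test rY)))).
Definition find_side : prog := find rFY rP rQ
  (TAnd nontree (TAnd (shared_test rX) (TAnd (big_test (Get aPAR rX)) (big_test rY)))).

(** A triangle at [u] that avoids [v1] and [v2], chosen among the two recorded. *)
Definition away (r1 r2 u v1 v2 : nat) : cmd :=
  If (TAnd (avoids (Get aT1A u) (suc v1) (suc v2)) (avoids (Get aT1B u) (suc v1) (suc v2)))
    (r1 ::= dec (Get aT1A u) ;; r2 ::= dec (Get aT1B u))
    (r1 ::= dec (Get aT2A u) ;; r2 ::= dec (Get aT2B u)).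

Definition X127_list : cmd :=
  away rC rD rU rP rQ ;; choose_nbr rE1 rP rU rQ ;; choose_nbr rE2 rQ rU rP ;;
  emits [:: rU; rP; rQ; rC; rD; rE1; rE2].
Definition D4_list : cmd :=
  away rA rB rP rQ rQ ;; away rC rD rQ rP rP ;;
  emits [:: rP; rA; rB; rQ; rC; rD].

Section Find.

Variables (w n : nat) (nb : nat -> seq nat) (IN : nat -> nat).
Local Notation e := (adj nb).
Local Notation start := (start nb).
Local Notation parsed := (parsed n nb IN).
Hypothesis room : start n * 20 < 2 ^ w.

Lemma find_correct f r1 r2 b (B : rel nat) s : parsed s -> regs s f = 0 ->
  uniq [:: f; r1; r2; rK; rX; rY; rLEN] ->
  (forall t x y, e x y -> regs t rX = x -> regs t rY = y -> arrs t = arrs s ->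
     holds w t b = B x y) ->
  let s' := prun w (find f r1 r2 b) s in
  if regs s' f == 0 then forall x y, e x y -> ~~ B x y
  else e (regs s' r1) (regs s' r2) && B (regs s' r1) (regs s' r2).
Proof.
move=> P f0; rewrite 3!cons_uniq !inE !negb_or => /and4P[].
move=> /and5P[f1 f2 f4 f5 /andP[f6 f3]] /and5P[g2 g4 g5 g6 g3].
move=> /and4P[h4 h5 h6 h3] _ bE /=; have ge := start_ge nb n.
have m1 : 1 %% 2 ^ w = 1 by rewrite (small room) //; lia.
set c := If b _ _.
have [||||||||||S1 R1] := @arc_rule w n nb IN room c s
  (fun t => (regs t f != 0) ==> e (regs t r1) (regs t r2) && B (regs t r1) (regs t r2))
  (fun t x y => B x y -> regs t f != 0) P.
all: try by rewrite //= !(eq_sym _ f) !(eq_sym _ r1) !(eq_sym _ r2) ?f3 ?f4 ?f5 ?f6 ?g3 ?g4 ?g5 ?g6 ?h3 ?h4 ?h5 ?h6.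
- move=> t q v q3; have [-> -> ->] : [/\ regs (set_reg t q v) f = regs t f,
    regs (set_reg t q v) r1 = regs t r1 & regs (set_reg t q v) r2 = regs t r2] => //.
  have K z : z \notin [:: rK; rX; rY] -> regs (set_reg t q v) z = regs t z.
    by move=> z3; rewrite /= ifF //; apply: contraNF z3 => /eqP->.
  by rewrite !K // !inE !negb_or ?f4 ?f5 ?f6 ?g4 ?g5 ?g6 ?h4 ?h5 ?h6.
- move=> t q v x y q3; rewrite /= ifF //.
  by apply: contraTF q3 => /eqP<-; rewrite !inE !negb_or f4 f5 f6.
- by rewrite f0.
- move=> t x y xy tx ty ka kr I1.
  have tE : arrs t = arrs s by apply: functional_extensionality => a; apply: ka.
  rewrite /c run_if (bE t x y) //; case: ifP => Bxy.
    have N (z z' : nat) : z != z' -> (z == z') = false /\ (z' == z) = false.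
      by move=> zz; rewrite (eq_sym z' z) (negbTE zz).
    have [F1 F1'] := N _ _ f1; have [F2 F2'] := N _ _ f2; have [G2 G2'] := N _ _ g2.
    have [_ G6] := N _ _ g6.
    by rewrite /= m1 !eqxx ?F1 ?F1' ?F2 ?F2' ?G2 ?G2' ?G6 tx ty xy Bxy.
  by split=> //; rewrite Bxy.
case: eqP S1 R1 => [f00 _ R1 x y xy|_ S1 _] //.
by apply/negP => /(R1 _ _ xy).
Qed.

End Find.

Section Triangles.

Variables (w n : nat) (nb : nat -> seq nat) (IN pos par : nat -> nat).
Hypothesis G : chordal_lists nb.
Hypothesis nbn : forall x y, adj nb x y -> x < n.
Local Notation e := (adj nb).
Local Notation big := (big nb).
Local Notation deg x := (size (nb x)).
Local Notation start := (start nb).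
Local Notation sib := (sib nb par).
Local Notation tri := (tri nb).
Local Notation parsed := (parsed n nb IN).
Let eC : symmetric e := adj_sym G.
Hypothesis room : start n * 20 < 2 ^ w.
Hypothesis F : bfs_forest nb pos par.
Hypothesis S : forall x y, e x y -> [|| par y == x, par x == y | par x == par y].
Hypothesis star : forall x y d, sib x y -> sib y d -> d != x -> ~~ big x.

Record tri_lists (p q p' q' : nat -> nat) : Prop := TriLists {
  tl_1 : forall u, p u != 0 -> tri u (p u).-1 (q u).-1 /\ q u != 0;
  tl_2 : forall u, p' u != 0 -> [/\ p u != 0, q' u != 0, tri u (p' u).-1 (q' u).-1 &
    [&& p' u != p u, p' u != q u, q' u != p u & q' u != q u]] }.

Definition lists_of (t : state) :=
  tri_lists (arrs t aT1A) (arrs t aT1B) (arrs t aT2A) (arrs t aT2B).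

Definition listed (t : state) u a b :=
  (arrs t aT1A u != 0) && [|| arrs t aT2A u != 0, a.+1 == arrs t aT1A u,
    a.+1 == arrs t aT1B u, b.+1 == arrs t aT1A u | b.+1 == arrs t aT1B u].

Lemma add_tri_correct (ru ra rb : nat) t u a b : regs t ru = u -> regs t ra = a ->
  regs t rb = b -> a < n -> b < n -> tri u a b -> lists_of t ->
  let t' := run w (add_tri ru ra rb) t in
  [/\ lists_of t', listed t' u a b & forall u' a' b', listed t u' a' b' -> listed t' u' a' b'].
Proof.
move=> tu ta tb an bn uab [L1 L2] t'; have ge := start_ge nb n.
have m1 : 1 %% 2 ^ w = 1 by rewrite (small room) //; lia.
have ma : (a + 1) %% 2 ^ w = a.+1 by rewrite (small room) addn1 //; lia.
have mb : (b + 1) %% 2 ^ w = b.+1 by rewrite (small room) addn1 //; lia.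
rewrite /t' /add_tri run_if [holds _ _ _]/= tu mod0n; case: ifP => p0.
  rewrite /= tu ta tb m1 ma mb; split.
  - split=> v /=; case: (eqVneq v u) => [->|_]; [by [] | exact: L1 | | exact: L2].
    by move/L2 => []; rewrite p0.
  - by rewrite /listed /= !eqxx /= ?orbT.
  - move=> v x y; rewrite /listed /=; case: (eqVneq v u) => [->|//].
    by rewrite p0.
rewrite run_if [holds _ _ _]/= tu ta tb m1 ma mb mod0n; case: ifP => [/and3P[p2 /andP[n1 n2] /andP[n3 n4]]|nn].
  rewrite /= tu ta tb m1 ma mb; split.
  - split=> v /=; first exact: L1.
    case: (eqVneq v u) => [-> _|_]; last exact: L2.
    by rewrite p0 n1 n2 n3 n4.
  - by rewrite /listed /= eqxx p0.
  - move=> v x y; rewrite /listed /=; case: (eqVneq v u) => [->|//].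
    by rewrite p0.
split=> //; rewrite /listed p0 /=; move: nn.
by case: eqP => //= _; do !case: eqP => //=.
Qed.

Lemma tri_loop_correct s : parsed s -> arrs s aPAR = par ->
  arrs s aT1A = (fun _ => 0) -> arrs s aT2A = (fun _ => 0) ->
  let s' := prun w (arc_loop tri_body) s in
  lists_of s' /\ forall u a b, tri u a b -> listed s' u a b.
Proof.
move=> P parE t10 t20 s'.
have [||||||||||S1 R1] := @arc_rule w n nb IN room tri_body s lists_of
  (fun t x y => sib x y -> listed t (par x) x y && listed t x (par x) y) P; rewrite //.
- by rewrite /lists_of t10 t20; split.
- move=> t x y xy tx ty ka kr I1.
  have [xn yn] := adj_n G nbn xy.
  have tpar : arrs t aPAR = par by rewrite ka.
  rewrite /tri_body run_if [holds _ _ _]/= tpar tx ty.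
  case: ifP => [/andP[nyx nxy]|ns]; last first.
    by split=> // /and3P[_ a b]; rewrite a b in ns.
  have sxy : sib x y by rewrite /(sib _ _) xy nyx nxy.
  have t1 := sib_up G F S sxy; have [/adj_n] := and3P t1.
  move=> /(_ _ G nbn)[pn _] _ _.
  pose ta := run w (rT ::= Get aPAR rX) t.
  pose tb := run w (add_tri rT rX rY) ta.
  rewrite -[run w _ _]/(run w (add_tri rX rT rY) tb).
  have [|l1 l2 l3] := @add_tri_correct rT rX rY ta (par x) x y _ tx ty xn yn t1 I1.
    by rewrite /= tpar tx.
  have [||||m1 m2 m3] := @add_tri_correct rX rT rY tb x (par x) y _ _ _ pn yn _ l1.
  + by rewrite run_reg.
  + by rewrite run_reg //= tpar tx.
  + by rewrite run_reg.
  + by rewrite (tri_rot G).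
  split=> //; first by move=> _; rewrite m2 m3.
  by move=> x' y' H /H /andP[h1 h2]; apply/andP; split; apply: (m3); apply: (l3).
split=> // u a b uab.
have key x y : sib x y -> listed s' (par x) x y && listed s' x (par x) y.
  by move=> xy; apply: (R1) => //; case/and3P: xy.
have lC v x y : listed s' v x y = listed s' v y x.
  rewrite /listed; congr (_ && (_ || _)).
  by case: (x.+1 == _) (x.+1 == _) (y.+1 == _) (y.+1 == _) => [] [] [] [].
case: (triP G F S star uab) => [[s1 p1]|[s1 p1]|[s1 p1]].
- by have /andP[] := key _ _ s1; rewrite p1.
- by have /andP[_] := key _ _ s1; rewrite p1 lC.
- by have /andP[_] := key _ _ s1; rewrite p1.
Qed.

End Triangles.

(** * Listing D_4 and X127 *)

Section Shared.

Variables (w n : nat) (nb : nat -> seq nat) (IN : nat -> nat).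
Hypothesis G : chordal_lists nb.
Hypothesis nbn : forall x y, adj nb x y -> x < n.
Local Notation e := (adj nb).
Local Notation big := (big nb).
Local Notation deg x := (size (nb x)).
Local Notation start := (start nb).
Local Notation tri := (tri nb).
Local Notation parsed := (parsed n nb IN).
Let eC : symmetric e := adj_sym G.
Let eI : irreflexive e := adj_irr G.
Hypothesis INnb : forall x i, x < n -> i < deg x ->
  IN (start x + 1 + i) = nth 0 (nb x) i.
Hypothesis room : start n * 20 < 2 ^ w.
Hypothesis tips : forall a b c d, tri a b c -> tri a b d -> c != d -> ~~ big c.

Variables p q p' q' : nat -> nat.
Hypothesis L : tri_lists nb p q p' q'.
Hypothesis C : forall u a b, tri u a b -> (p u != 0) &&
  [|| p' u != 0, a.+1 == p u, a.+1 == q u, b.+1 == p u | b.+1 == q u].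

Lemma shared_elim u : p' u != 0 -> exists a b c d,
  [/\ tri u a b, tri u c d, p u = a.+1 /\ q u = b.+1, p' u = c.+1 /\ q' u = d.+1 &
      [/\ c != a, c != b, d != a & d != b]].
Proof.
move=> h; have [h1 h2 h3 /and4P[n1 n2 n3 n4]] := tl_2 L h.
have [h4 h5] := tl_1 L h1.
have E x : x != 0 -> x = x.-1.+1 by move=> x0; rewrite prednK // lt0n.
exists (p u).-1, (q u).-1, (p' u).-1, (q' u).-1; split=> //; rewrite -?E //.
by rewrite -![_.-1 == _]eqSS -!E.
Qed.

Lemma two_tri u a b c d : tri u a b -> tri u c d -> a != c -> a != d -> b != c ->
  ~~ e a c.
Proof.
move=> t1 t2 ac ad bc; apply/negP => eac.
have [ua ub ab] := and3P t1; have [uc ud cd] := and3P t2.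
have t3 : tri u a c by rewrite /tri ua uc eac.
rewrite eq_sym in bc; have := tips t3 t1 bc.
by rewrite (bigP (x := c) (a := u) (b := a) (c := d)) // 1?eC // (adj_neq G).
Qed.

(** Two triangles that meet in [u] only are not joined by any other edge, so they
    cannot both meet the first recorded triangle in a second vertex. *)
Lemma shared_intro u a b c d : tri u a b -> tri u c d ->
  a != c -> a != d -> b != c -> b != d -> p' u != 0.
Proof.
move=> t1 t2 ac ad bc bd; apply: contraT => h.
have /andP[h1] := C t1; rewrite (negbTE h) /= => m1.
have /andP[_] := C t2; rewrite (negbTE h) /= => m2.
have [t h2] := tl_1 L h1; have /and3P[_ _] := t.
have t1' : tri u b a by rewrite (triC G).
have t2' : tri u d c by rewrite (triC G).
have [ca [da [cb db]]] : c != a /\ d != a /\ c != b /\ d != b.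
  by rewrite !(eq_sym c) !(eq_sym d) ac ad bc bd.
have n1 := two_tri t1 t2 ac ad bc; have n2 := two_tri t1 t2' ad ac bd.
have n3 := two_tri t1' t2 bc bd ac; have n4 := two_tri t1' t2' bd bc ad.
case/or4P: m1 => /eqP E1; case/or4P: m2 => /eqP E2; rewrite -?E1 -?E2 //=;
  try (by rewrite eC (negbTE n1)); try (by rewrite eC (negbTE n2));
  try (by rewrite eC (negbTE n3)); try (by rewrite eC (negbTE n4));
  try (by rewrite (negbTE n1)); try (by rewrite (negbTE n2));
  try (by rewrite (negbTE n3)); try (by rewrite (negbTE n4)).
all: by case: (etrans E1 (esym E2)) => H; move: ac ad bc bd; rewrite H ?eqxx.
Qed.

Definition away_from (u v1 v2 : nat) : nat * nat :=
  if [&& p u != v1.+1, p u != v2.+1, q u != v1.+1 & q u != v2.+1]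
  then ((p u).-1, (q u).-1) else ((p' u).-1, (q' u).-1).

Lemma away_correct u v1 v2 : p' u != 0 -> v1 = v2 \/ e v1 v2 ->
  let cd := away_from u v1 v2 in
  tri u cd.1 cd.2 /\ [&& v1 != cd.1, v1 != cd.2, v2 != cd.1 & v2 != cd.2].
Proof.
move=> h v12 cd; rewrite {}/cd /away_from.
have [a [b [c [d [t1 t2 [-> ->] [-> ->] [ca cb da db]]]]]] := shared_elim h.
rewrite !eqSS; case: ifP => [/and4P[a1 a2 b1 b2]|ab] /=.
  by split; rewrite // !(eq_sym v1) !(eq_sym v2) a1 a2 b1 b2.
split=> //; apply: contraFT ab; rewrite !negb_and !negbK => meet.
have [v vin vcd] : exists2 v, (v == v1) || (v == v2) & (v == c) || (v == d).
  by case/or4P: meet => /eqP->; [exists c|exists d|exists c|exists d];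
    rewrite ?eqxx ?orbT.
apply: contraT => meet'.
have [x xin xab] : exists2 x, (x == v1) || (x == v2) & (x == a) || (x == b).
  move: meet'; rewrite !negb_and !negbK => /or4P[] /eqP E.
  - by exists a; rewrite ?E eqxx.
  - by exists a; rewrite ?E ?eqxx ?orbT.
  - by exists b; rewrite ?E ?eqxx ?orbT.
  - by exists b; rewrite ?E ?eqxx ?orbT.
have other y z t : tri u y z -> (t == y) || (t == z) ->
    exists2 t', tri u t t' & (t' == y) || (t' == z).
  move=> tyz /orP[] /eqP->; [exists z | exists y]; rewrite ?eqxx ?orbT //.
  by rewrite (triC G).
have [x' tx xin'] := other _ _ _ t1 xab; have [v' tv vin'] := other _ _ _ t2 vcd.
have far y z : (y == a) || (y == b) -> (z == c) || (z == d) -> y != z.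
  by move=> /orP[] /eqP-> /orP[] /eqP->; rewrite eq_sym.
have xv := far _ _ xab vcd.
have := two_tri tx tv xv (far _ _ xab vin') (far _ _ xin' vcd).
case: v12 xin vin => [->|v12]; first by rewrite !orbb => /eqP E /eqP E'; rewrite E E' eqxx in xv.
move=> /orP[] /eqP E /orP[] /eqP E'; rewrite E E' ?v12 // in xv *.
- by rewrite eqxx in xv.
- by rewrite eC v12.
- by rewrite eqxx in xv.
Qed.

Definition tri_state (s : state) := [/\ arrs s aT1A = p, arrs s aT1B = q,
  arrs s aT2A = p' & arrs s aT2B = q'].

Lemma run_away (r1 r2 u v1 v2 : nat) s : tri_state s ->
  r1 != u -> regs s v1 < n -> regs s v2 < n ->
  run w (away r1 r2 u v1 v2) s =
  set_reg (set_reg s r1 (away_from (regs s u) (regs s v1) (regs s v2)).1)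
    r2 (away_from (regs s u) (regs s v1) (regs s v2)).2.
Proof.
move=> [e1 e2 e3 e4] r1u l1 l2; have ge := start_ge nb n.
have m1 : 1 %% 2 ^ w = 1 by rewrite (small room) //; lia.
have E : holds w s (TAnd (avoids (Get aT1A u) (suc v1) (suc v2))
    (avoids (Get aT1B u) (suc v1) (suc v2))) =
  [&& p (regs s u) != (regs s v1).+1, p (regs s u) != (regs s v2).+1,
      q (regs s u) != (regs s v1).+1 & q (regs s u) != (regs s v2).+1].
  rewrite /= e1 e2 m1 !(small room) ?addn1; [|lia..].
  by rewrite -andbA.
rewrite /away run_if E /away_from; case: ifP => _;
  by rewrite /= ?e1 ?e2 ?e3 ?e4 m1 (eq_sym u) (negbTE r1u) !subn1.
Qed.

Lemma D4_correct s : parsed s -> tri_state s -> regs s rOUT = 0 ->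
  e (regs s rP) (regs s rQ) -> p' (regs s rP) != 0 -> p' (regs s rQ) != 0 ->
  obs nb (out (run w D4_list s)).
Proof.
move=> P TS o0; set u := regs s rP; set v := regs s rQ => uv su sv.
have [un vn] := adj_n G nbn uv; have ge := start_ge nb n.
have [ta /and4P[n1 n2 _ _]] := away_correct su (or_introl (erefl v)).
have [tc /and4P[n3 n4 _ _]] := away_correct sv (or_introl (erefl u)).
set ab := away_from u v v in ta n1 n2; set cd := away_from v u u in tc n3 n4.
pose s1 := set_reg (set_reg s rA ab.1) rB ab.2.
pose s2 := set_reg (set_reg s1 rC cd.1) rD cd.2.
have -> : run w D4_list s = run w (emits [:: rP; rA; rB; rQ; rC; rD]) s2.
  rewrite /D4_list 2!run_seq.
  have -> : run w (away rA rB rP rQ rQ) s = s1 by rewrite run_away.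
  by rewrite (_ : run w (away rC rD rQ rP rP) s1 = s2) // run_away.
have [||-> _] := @run_emits w n nb room [:: rP; rA; rB; rQ; rC; rD] s2 => //.
  by rewrite /= o0; lia.
have -> : out s2 = [::] by rewrite /out /= o0.
rewrite /= -/u -/v; constructor 4; exists 4 => //.
by apply: (D4_copy G tips uv ta tc); rewrite !inE negb_or ?n1 ?n2 ?n3 ?n4.
Qed.

Lemma X127_correct s : parsed s -> tri_state s -> regs s rOUT = 0 ->
  tri (regs s rU) (regs s rP) (regs s rQ) -> p' (regs s rU) != 0 ->
  big (regs s rP) -> big (regs s rQ) ->
  obs nb (out (run w X127_list s)).
Proof.
move=> P TS o0; set u := regs s rU; set a := regs s rP; set b := regs s rQ.
move=> t su ba bb; have ge := start_ge nb n.
have [ua ub ab] := and3P t; have [un an] := adj_n G nbn ua.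
have [_ bn] := adj_n G nbn ub.
have [tc /and4P[n1 n2 n3 n4]] := away_correct su (or_intror ab).
set cd := away_from u a b in tc n1 n2 n3 n4.
have [e1 e2 e3] := pick3P G u b ba; have [f1 f2 f3] := pick3P G u a bb.
pose s1 := set_reg (set_reg s rC cd.1) rD cd.2.
pose s2 := set_reg s1 rE1 (pick3 nb a u b).
pose s3 := set_reg s2 rE2 (pick3 nb b u a).
have P1 : parsed s1 by apply: parsed_ext P.
have P2 : parsed s2 by apply: parsed_ext P.
have -> : run w X127_list s = run w (emits [:: rU; rP; rQ; rC; rD; rE1; rE2]) s3.
  rewrite /X127_list 3!run_seq.
  have -> : run w (away rC rD rU rP rQ) s = s1 by rewrite run_away.
  have -> : run w (choose_nbr rE1 rP rU rQ) s1 = s2 by rewrite (run_pick INnb room).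
  by rewrite (_ : run w (choose_nbr rE2 rQ rU rP) s2 = s3) // (run_pick INnb room).
have [||-> _] := @run_emits w n nb room [:: rU; rP; rQ; rC; rD; rE1; rE2] s3 => //.
  by rewrite /= o0; lia.
have -> : out s3 = [::] by rewrite /out /= o0.
rewrite /= -/u -/a -/b; constructor 3.
by apply: (X127_copy G tips t tc); rewrite // !inE negb_or ?n1 ?n2 ?n3 ?n4.
Qed.

End Shared.

(** * Following spines *)

Notation aHP := 15 (only parsing).
Notation aBIT := 16 (only parsing).

Definition tri_test (x : expr) := differ (Get aT1A x) (Const 0).
Definition hot_test (x : expr) :=
  TNot (TAnd (TEq (Get aT1A x) (Const 0)) (TEq (Get aHP x) (Const 0))).

(** The vertex [rX] makes a claim if it has no sibling and is hot.  A small parent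
    in no triangle serves the edge without a claim. *)
Definition hp_cond : test :=
  TAnd (differ rY rX) (TAnd (TEq (Get aH1 rX) (Const 0)) (TAnd (hot_test rX)
    (TNot (TAnd (TNot (big_test rY)) (TEq (Get aT1A rY) (Const 0)))))).

Definition hp_body : cmd :=
  If (TLt rK rTAIL)
    (rX ::= Get aORD (Defs.Sub (dec rTAIL) rK) ;; rY ::= Get aPAR rX ;;
     If hp_cond
       (If (hot_test rY) (rP ::= rX ;; rFK ::= Const 1) (Store aHP rY (suc rX)))
       Skip)
    Skip.

Definition hp_loop : prog := Loop rK rLEN hp_body.

Definition walk_body : cmd :=
  If (TEq rT (Const 0))
    (If (tri_test rU)
      (rC ::= dec (Get aT1A rU) ;; rD ::= dec (Get aT1B rU) ;; rT ::= Const 1 ;;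
       emits [:: rU; rC; rD])
      (rC ::= dec (Get aHP rU) ;; choose_nbr rD rU rE1 rC ;; emits [:: rU; rD] ;;
       rE1 ::= rU ;; rU ::= rC))
    Skip.

Definition walk_prog (u v : nat) : prog :=
  Chain (Base (rU ::= u ;; rE1 ::= v ;; rT ::= Const 0)) (Loop rK rLEN walk_body).

Definition report_D : prog :=
  Chain (Base (rQ ::= Get aPAR rP)) (Chain (walk_prog rP rQ) (walk_prog rQ rP)).

Section Spines.

Variables (w n : nat) (nb : nat -> seq nat) (IN pos par ord : nat -> nat) (tl : nat).
Hypothesis G : chordal_lists nb.
Hypothesis nbn : forall x y, adj nb x y -> x < n.
Local Notation e := (adj nb).
Local Notation big := (big nb).
Local Notation deg x := (size (nb x)).
Local Notation start := (start nb).
Local Notation len := (len n nb).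
Local Notation sib := (sib nb par).
Local Notation lone := (lone nb par).
Local Notation tri := (tri nb).
Local Notation parsed := (parsed n nb IN).
Let eC : symmetric e := adj_sym G.
Hypothesis INnb : forall x i, x < n -> i < deg x ->
  IN (start x + 1 + i) = nth 0 (nb x) i.
Hypothesis room : start n * 20 < 2 ^ w.
Hypothesis F : bfs_forest nb pos par.
Hypothesis S : forall x y, e x y -> [|| par y == x, par x == y | par x == par y].
Hypothesis star : forall x y d, sib x y -> sib y d -> d != x -> ~~ big x.
Hypothesis ordP : forall x, 0 < pos x -> pos x <= tl /\ ord (pos x).-1 = x.
Hypothesis posP : forall i, i < tl -> pos (ord i) = i.+1.
Hypothesis tln : tl <= n.
Hypothesis vis_n : forall x, 0 < pos x -> x < n.

Variables (p h1 : nat -> nat).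
Hypothesis loneP : forall x, h1 x = 0 -> lone x.

Definition triangled u := p u != 0.
Definition hot (h : nat -> nat) u := triangled u || (h u != 0).

(** What a claim guarantees while the vertices with [pos] above [k] have been
    treated, in the reverse of the order of the search. *)
Definition hp_ok (k : nat) (h : nat -> nat) := forall v, h v != 0 ->
  [/\ ~~ triangled v, big v & [/\ par (h v).-1 = v, (h v).-1 != v, k < pos (h v).-1,
    h1 (h v).-1 = 0 & hot h (h v).-1]].
Definition hp_done (k : nat) (h : nat -> nat) := forall x, k < pos x -> par x != x ->
  h1 x = 0 -> hot h x -> ~~ triangled (par x) /\ (big (par x) -> h (par x) = x.+1).
Definition collision (h : nat -> nat) x := [/\ 0 < pos x, par x != x, h1 x = 0 &
  [/\ hot h x, hot h (par x) & ~~ triangled (par x) -> h (par x) != x.+1]].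

(** Children are treated before their parents, so that it is known whether a vertex
    is hot when its own claim is examined. *)
Lemma hp_loop_correct s : parsed s -> arrs s aPAR = par -> arrs s aORD = ord ->
  arrs s aT1A = p -> arrs s aH1 = h1 -> regs s rTAIL = tl -> regs s rFK = 0 ->
  arrs s aHP = (fun _ => 0) ->
  let s' := prun w hp_loop s in let h := arrs s' aHP in
  hp_ok 0 h /\ if regs s' rFK == 0 then hp_done 0 h else collision h (regs s' rP).
Proof.
move=> P parE ordE pE h1E tE fk0 h0 s' h; have ge := start_ge nb n.
have m1 : 1 %% 2 ^ w = 1 by rewrite (small room) //; lia.
have m2 : 2 %% 2 ^ w = 2 by rewrite (small room) //; lia.
(* iteration [i] treats the vertex at position [tl - i] of the search *)
pose I i t := hp_ok (tl - i) (arrs t aHP) /\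
  if regs t rFK == 0 then hp_done (tl - i) (arrs t aHP)
  else collision (arrs t aHP) (regs t rP).
have : I len s'.
  rewrite -(p_len P); apply: loop_rule => //.
    rewrite /I /= fk0 h0; split=> // x; rewrite subn0 => lt.
    by have [|] := @ordP x; lia.
  move=> i t il tk ka kr [I1 I2].
  have [tp to tt th] : [/\ arrs t aPAR = par, arrs t aORD = ord, arrs t aT1A = p
      & arrs t aH1 = h1] by rewrite !ka.
  have td x : x < n -> arrs t aDEG x = deg x by move=> xn; rewrite ka // (p_deg P).
  have ttl : regs t rTAIL = tl by rewrite kr.
  rewrite /hp_body run_if [holds _ _ _]/= tk ttl; case: ltnP => itl; last first.
    by rewrite /I /=; have -> : tl - i.+1 = tl - i by lia.
  rewrite 2!run_seq; pose x := ord (tl - 1 - i); pose y := par x.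
  have px : pos x = tl - i by rewrite posP; lia.
  have vx : 0 < pos x by lia.
  have t1E : run w (rY ::= Get aPAR rX) (run w (rX ::= Get aORD (Defs.Sub (dec rTAIL) rK)) t)
      = set_reg (set_reg t rX x) rY y.
    by rewrite /= ttl tk m1 to tp.
  rewrite t1E; set t1 := set_reg _ rY y.
  have vy : 0 < pos y := par_vis G F vx; have yn := vis_n vy; have xn := vis_n vx.
  set hh := arrs t aHP in I1 I2.
  have cE : holds w t1 hp_cond = [&& y != x, h1 x == 0, hot hh x & big y || triangled y].
    by rewrite /= th tt (td _ yn) mod0n m2 /hot /triangled bigE negb_and negb_and negbK.
  have hE (v : nat) : holds w t1 (hot_test v) = hot hh (regs t1 v).
    by rewrite /= tt mod0n /hot /triangled negb_and.
  have nexti : tl - i.+1 = (tl - i).-1 by lia.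
  have weaken : hp_ok (tl - i.+1) hh.
    by move=> v /I1[a b [c d g k l]]; split=> //; split=> //; lia.
  rewrite run_if cE; case: ifP => [/and4P[nyx h1x hx by']|nc]; last first.
    rewrite /I /= -/hh; split=> //; move: I2; case: ifP => // _ I2.
    move=> z; rewrite nexti => lz nz h1z hz.
    case: (ltngtP (pos z) (tl - i)) => lz'; [by lia | exact: I2 |].
    have zx : z = x by apply: (pos_inj F); lia.
    rewrite zx in nz h1z hz *; move: nc; rewrite (nz : y != x) h1z eqxx hz /=.
    by move/negbT; rewrite negb_or => /andP[nb' nT]; split=> //; rewrite (negbTE nb').
  have nxy : par x != x := nyx.
  have lxy := par_lt F vx nxy; rewrite -/y in lxy.
  rewrite run_if hE; case: ifP => hy.
    rewrite /I /= m1 -/hh; split=> //; split=> //; first exact/eqP.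
    split=> // nTy; apply/negP => /eqP hyx.
    have hy0 : hh y != 0 by rewrite hyx.
    by have [_ _ [_ _ + _ _]] := I1 _ hy0; rewrite hyx /=; lia.
  have [nTy hy0] : ~~ triangled y /\ hh y = 0.
    by move/negbT: hy; rewrite negb_or negbK => /andP[-> /eqP].
  have by0 : big y by move: by'; rewrite (negbTE nTy) orbF.
  rewrite /I /= m1 -/hh (small room); last lia.
  rewrite addn1; set h' := fun j => if j == y then _ else _.
  have hh' z : hot hh z -> hot h' z.
    by rewrite /hot /h'; case: (eqVneq z y) => //= _ _; rewrite orbT.
  have h'z z : z != y -> h' z = hh z by rewrite /h' => /negbTE->.
  have h'y : h' y = x.+1 by rewrite /h' eqxx.
  split.
    move=> v; case: (eqVneq v y) => [-> _|vy'].
      rewrite h'y /=; split=> //; split=> //; [by rewrite eq_sym | lia | exact/eqP |].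
      exact: hh'.
    rewrite h'z // => /I1[a b [c d g k l]]; split=> //; split=> //; first lia.
    exact: hh'.
  move: I2; case: ifP => fk I2.
    move=> z; rewrite nexti => lz nz h1z hz.
    case: (eqVneq z x) => [->|zx].
      by split=> // _.
    have lz' : tl - i < pos z.
      have : pos z != pos x.
        apply/eqP => E; move/eqP: zx; apply; apply: (pos_inj F); lia.
      lia.
    have hz' : hot hh z.
      move: hz; rewrite /hot /h'; case: (eqVneq z y) => // zy _.
      by rewrite zy in lz'; lia.
    have [nT hb] := I2 z lz' nz h1z hz'.
    split=> // bz; case: (eqVneq (par z) y) => [py|pz]; last by rewrite h'z // hb.
    by move: (hb bz); rewrite py hy0.
  case: I2 => [c1 c2 c3 [c4 c5 c6]]; split=> //; split; [exact: hh' | exact: hh' |].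
  move=> nT; case: (eqVneq (par (regs t rP)) y) => [py|py]; last by rewrite h'z // c6.
  by move: c5; rewrite py hy.
rewrite /I; have -> : tl - len = 0 by rewrite /len; lia.
by [].
Qed.

Variables (q h : nat -> nat).
Local Notation ta := (fun u => (p u).-1).
Local Notation tb := (fun u => (q u).-1).
Local Notation nx := (fun u => (h u).-1).
Local Notation spine := (walk triangled ta tb nx (pick3 nb)).
Hypothesis hP : hp_ok 0 h.
Hypothesis triP : forall u, triangled u -> tri u (ta u) (tb u).

(** [rU] and [rE1] hold the current vertex of the chain and the preceding one, and
    [rT] is set when the triangle at the end has been listed. *)
Lemma walk_correct (u v : nat) s : u \notin [:: rU; rE1; rT] -> v \notin [:: rU; rE1; rT] ->
  parsed s -> arrs s aT1A = p -> arrs s aT1B = q -> arrs s aHP = h ->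
  0 < pos (regs s u) -> hot h (regs s u) -> regs s rOUT + 3 * len <= start n * 19 ->
  let s' := prun w (walk_prog u v) s in
  out s' = out s ++ spine len (regs s u) (regs s v) /\
  regs s' rOUT <= regs s rOUT + 3 * len.
Proof.
rewrite !inE !negb_or => /and3P[/negbTE u1 /negbTE u2 _] /and3P[/negbTE v1 _ _].
move=> P pE qE hE vu hu le s'; have ge := start_ge nb n.
have m1 : 1 %% 2 ^ w = 1 by rewrite (small room) //; lia.
pose I i t := [/\ regs t rOUT <= regs s rOUT + 3 * i,
   out t ++ (if regs t rT == 0 then spine (len - i) (regs t rU) (regs t rE1) else [::])
     = out s ++ spine len (regs s u) (regs s v) &
   regs t rT = 0 -> 0 < pos (regs t rU) /\ hot h (regs t rU)].
have : I len s'.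
  rewrite /s' /walk_prog; set t0 := run w (rU ::= u ;; rE1 ::= v ;; rT ::= Const 0) s.
  have P0 : parsed t0 by apply: parsed_ext P.
  rewrite -(p_len P0); apply: loop_rule => //.
    by rewrite /I /out /= mod0n v1 muln0 addn0 subn0.
  rewrite (p_len P0) => i t il tk ka kr [I1 I2 I3].
  have Pt : parsed t.
    by apply: parsed_ext P0 => [a||]; rewrite ?kr // !inE => /or4P[] /eqP->; rewrite ka.
  have [tp tq th] : [/\ arrs t aT1A = p, arrs t aT1B = q & arrs t aHP = h] by rewrite !ka.
  rewrite run_if [holds _ _ _]/= mod0n; case: eqP I2 I3 => [T0|T0] I2 I3; last first.
    by split=> //=; [lia | rewrite -I2; case: eqP T0].
  have {I3}[vx hx] := I3 T0.
  have lE : len - i = (len - i.+1).+1 by lia.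
  rewrite lE in I2; set x := regs t rU in vx hx I2.
  rewrite run_if [holds _ _ _]/= tp mod0n -/x.
  case: ifP => Tx.
    rewrite 3!run_seq; set t1 := run w _ (run w _ (run w _ t)).
    have t1E : [/\ regs t1 rU = x, regs t1 rC = ta x, regs t1 rD = tb x,
        regs t1 rOUT = regs t rOUT & regs t1 rT = 1 /\ out t1 = out t].
      by rewrite /t1 /= tp tq m1 -/x !subn1.
    clearbody t1; case: t1E => e1 e2 e3 e4 [e5 e6].
    have [//||E1 E2] := @run_emits w n nb room [:: rU; rC; rD] t1; first by rewrite e4 /=; lia.
    have E3 : regs (run w (emits [:: rU; rC; rD]) t1) rT = 1.
      by rewrite run_reg // emits_keeps_reg.
    move: (run w (emits _) t1) E1 E2 E3 => t2 E1 E2 E3.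
    split; rewrite /= ?E3 //; first by rewrite E2 e4 /=; lia.
    by rewrite cats0 (_ : out _ = out t2) // E1 /= e1 e2 e3 e6 -I2 /= /triangled Tx.
  have hx0 : h x != 0 by move: hx; rewrite /hot /triangled Tx.
  have [_ bx [pnx nxx lpx _ hnx]] := hP hx0.
  rewrite 3!run_seq; set t1 := run w (rC ::= _) t.
  have P1 : parsed t1 by apply: parsed_ext Pt.
  have t1C : regs t1 rC = nx x by rewrite /t1 /= th m1 subn1.
  rewrite (@run_pick w n nb IN INnb room t1) //; last by apply: vis_n.
  set t2 := set_reg t1 rD _.
  have t2D : regs t2 rD = pick3 nb x (regs t rE1) (nx x) by rewrite /t2 /= th m1 subn1.
  have [//||E1 E2] := @run_emits w n nb room [:: rU; rD] t2.
    by rewrite (_ : regs t2 rOUT = regs t rOUT) //=; lia.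
  set t3 := run w (emits _) t2 in E1 E2.
  have K r : r != rOUT -> regs t3 r = regs t2 r by move=> ro; rewrite run_reg // emits_keeps_reg.
  rewrite -/t3; move: t3 E1 E2 K => t3 E1 E2 K.
  split; rewrite /= ?(K rC) ?(K rT) ?(K rU) //.
  - by rewrite E2 /=; lia.
  - rewrite (_ : out _ = out t3) // E1 /= -/x T0 eqxx -catA /= -I2 /= /triangled Tx.
    by rewrite th m1 subn1.
  - by move=> _; rewrite /= th m1 subn1; split=> //; lia.
case=> I1 I2 _; split=> //; move: I2; rewrite subnn; case: ifP => _ /=; by rewrite cats0.
Qed.

Lemma walk_keeps_reg x (u v : nat) :
  x \notin [:: rOUT; rK; rC; rD; rU; rE1; rT] -> prog_keeps_reg x (walk_prog u v).
Proof.
rewrite !inE !negb_or => /and5P[/negbTE h1' /negbTE h2 /negbTE h3 /negbTE h4 /and3P[/negbTE h5 /negbTE h6 /negbTE h7]].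
by rewrite /= h1' h2 h3 h4 h5 h6 h7.
Qed.

Lemma D_correct s : parsed s -> arrs s aPAR = par -> arrs s aT1A = p -> arrs s aT1B = q ->
  arrs s aHP = h -> regs s rOUT = 0 -> collision h (regs s rP) ->
  obs nb (out (prun w report_D s)).
Proof.
move=> P parE pE qE hE o0; have ge := start_ge nb n.
set x := regs s rP; case=> vx px h1x [hx hpx npx].
have vp : 0 < pos (par x) := par_vis G F vx.
pose s1 := run w (rQ ::= Get aPAR rP) s.
have P1 : parsed s1 by apply: parsed_ext P.
pose s2 := prun w (walk_prog rP rQ) s1.
have P2 : parsed s2 by apply: parsed_keep P1.
have s1Q : regs s1 rQ = par x by rewrite /= parE.
have l9 : len = start n * 3 by [].
have le1 : regs s1 rOUT + 3 * len <= start n * 19 by rewrite [regs _ _]o0; lia.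
have [O1 L1] := @walk_correct rP rQ s1 isT isT P1 pE qE hE vx hx le1.
rewrite -/s2 in O1 L1.
have K2 : regs s2 rP = x /\ regs s2 rQ = regs s1 rQ by rewrite !prun_reg // walk_keeps_reg.
have le2 : regs s2 rOUT + 3 * len <= start n * 19.
  by move: L1; rewrite [regs s1 rOUT]o0; lia.
have [pE2 qE2 hE2] : [/\ arrs s2 aT1A = p, arrs s2 aT1B = q & arrs s2 aHP = h].
  by rewrite !prun_arr.
have := @walk_correct rQ rP s2 isT isT P2 pE2 qE2 hE2.
rewrite K2.1 K2.2 s1Q => /(_ vp hpx le2)[O2 _].
rewrite O1 in O2.
have -> : out (prun w (Chain (Base (rQ ::= Get aPAR rP)) (Chain (walk_prog rP rQ) (walk_prog rQ rP))) s)
   = out (prun w (walk_prog rQ rP) s2) by [].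
rewrite O2 (_ : out s1 = [::]); last by rewrite /out [regs s1 rOUT]o0.
have lN : n < len by lia.
apply: Or44; rewrite cat0s.
have posN y : pos y <= n.
  by case: (posnP (pos y)) => [->//|vy]; have [] := ordP vy; lia.
have nxP u : 0 < pos u -> h u != 0 -> ~~ triangled u ->
    [/\ big u, 0 < pos (nx u), par (nx u) = u, nx u != u & lone (nx u) /\ (triangled (nx u) || (h (nx u) != 0))].
  move=> vu hu nT; have [_ bu [a b c d g]] := hP hu.
  by split=> //; split=> //; exact: loneP.
have npx' : ~~ triangled (par x) -> nx (par x) != x.
  move=> nT; move: (npx nT) hpx; rewrite /hot (negbTE nT) /=.
  by case: (h (par x)) => [//|k]; rewrite eqSS.
have := @D_collision _ nb pos par G F S star n triangled (fun u => h u != 0) ta tb nx (pick3 nb)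
  posN triP (fun u a b => @pick3P nb G u a b) nxP x len vx px (loneP h1x) hx hpx npx' lN.
by rewrite s1Q.
Qed.

End Spines.

(** * Coloring *)

Definition lower_test : test :=
  TNot (TAnd (TNot (TLt (Get aDEG rX) (Get aDEG rB)))
    (TNot (TAnd (TEq (Get aDEG rX) (Get aDEG rB)) (TLt (Get aPOS rX) (Get aPOS rB))))).

Definition bit_body : cmd :=
  If (differ (Get aH1 rX) (Const 0))
    (rB ::= dec (Get aH1 rX) ;;
     If lower_test (rC ::= Const 1) (rC ::= Const 0) ;;
     If (shared_test rY) Skip (rC ::= Defs.Sub (Const 1) rC))
    (If (tri_test rY)
      (If (TEq (Get aH1 rY) (Const 0)) (rC ::= Const 0)
        (rC ::= Defs.Sub (Const 1) (Get aBIT rY)))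
      (If (TAnd (differ (Get aHP rY) (Const 0)) (differ (Get aHP rY) (suc rX)))
        (rC ::= Const 0) (rC ::= Const 1))).

Definition color_body : cmd :=
  If (TLt rK rTAIL)
    (rX ::= Get aORD rK ;; rY ::= Get aPAR rX ;;
     If (TEq rY rX) (Store aOUT rX (Const 0))
      (bit_body ;;
       If (TEq (Get aPAR rY) rY) (rD ::= Const 1) (rD ::= Get aOUT (Get aPAR rY)) ;;
       Store aBIT rX rC ;;
       If (TEq rC (Const 0)) (Store aOUT rX rD)
         (Store aOUT rX (Defs.Sub (Const 3) (Add (Get aOUT rY) rD)))))
    Skip.

Definition color_loop : prog := Loop rK rLEN color_body.

Definition entry (h : nat -> nat) x := if h x is k.+1 then Some k else None.

Section Colors.

Variables (w n : nat) (nb : nat -> seq nat) (IN pos par ord : nat -> nat) (tl : nat).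
Hypothesis G : chordal_lists nb.
Hypothesis nbn : forall x y, adj nb x y -> x < n.
Local Notation e := (adj nb).
Local Notation deg x := (size (nb x)).
Local Notation start := (start nb).
Local Notation len := (len n nb).
Local Notation sib := (sib nb par).
Local Notation parsed := (parsed n nb IN).
Hypothesis room : start n * 20 < 2 ^ w.
Hypothesis F : bfs_forest nb pos par.
Hypothesis S : forall x y, e x y -> [|| par y == x, par x == y | par x == par y].
Hypothesis ordP : forall x, 0 < pos x -> pos x <= tl /\ ord (pos x).-1 = x.
Hypothesis posP : forall i, i < tl -> pos (ord i) = i.+1.
Hypothesis tln : tl <= n.
Hypothesis vis_n : forall x, 0 < pos x -> x < n.

Variables (p p' h1 h : nat -> nat).
Hypothesis h1P : forall x, h1 x != 0 -> sib x (h1 x).-1.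

Local Notation T := (fun u => p u != 0).
Local Notation sh := (fun u => p' u != 0).
Local Notation bit := (bit nb pos par T sh (entry h) (entry h1)).

Definition fits (s : state) := [/\ parsed s,
  [/\ arrs s aPAR = par, arrs s aORD = ord & arrs s aPOS = pos],
  [/\ arrs s aT1A = p, arrs s aT2A = p', arrs s aH1 = h1 & arrs s aHP = h] &
  regs s rTAIL = tl].

Lemma bit_body_correct t x : fits t -> regs t rX = x -> regs t rY = par x -> 0 < pos x ->
  (par (par x) != par x -> arrs t aBIT (par x) = bit (par x)) ->
  regs (run w bit_body t) rC = bit x.
Proof.
case=> P [tp to tq] [t1 t2 t3 t4] tt tx ty vx B; have ge := start_ge nb n.
have m1 : 1 %% 2 ^ w = 1 by rewrite (small room) //; lia.
have xn := vis_n vx.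
rewrite /bit_body run_if [holds _ _ _]/= t3 tx mod0n.
case: ifP => hx.
  set y := (h1 x).-1; have xy : sib x y := h1P hx.
  have sx : entry h1 x = Some y by rewrite /entry /y; case: (h1 x) hx.
  have -> : bit x = role nb pos par sh x y by rewrite /(bit _) /= sx.
  have yn : y < n by case/and3P: xy => xy _ _; have [] := adj_n G nbn xy.
  rewrite 2!run_seq; set t' := run w (rB ::= _) t.
  have t'E : t' = set_reg t rB y by rewrite /t' /= t3 tx m1 subn1.
  have lE : holds w t' lower_test = lower nb pos x y.
    by rewrite t'E /= tx tq !(p_deg P) // negb_and !negbK.
  rewrite [run w (If lower_test _ _) t']run_if lE run_if [holds _ _ _]/=.
  rewrite (_ : arrs _ aT2A = p'); last by rewrite t'E; case: ifP => _ /=.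
  rewrite (_ : regs _ rY = par x); last by rewrite t'E; case: ifP => _ /=.
  rewrite mod0n /role; set b := lower _ _ _ _.
  by case: ifP => _; case: b; rewrite /= ?m1 ?mod0n.
have sx : entry h1 x = None by rewrite /entry; move: hx; case: (h1 x).
have -> := @bit_child _ nb pos par T sh (entry h) (entry h1) x sx.
rewrite run_if [holds _ _ _]/= t1 ty mod0n; case: ifP => Ty.
  rewrite run_if [holds _ _ _]/= t3 ty mod0n; case: ifP => hy.
    by rewrite /= mod0n /entry (eqP hy).
  have hy0 : h1 (par x) != 0 by rewrite hy.
  have nr : par (par x) != par x.
    by have [_ _ + _ _] := sib_par F S (h1P hy0).
  have sy : entry h1 (par x) = Some (h1 (par x)).-1.
    by rewrite /entry; case: (h1 (par x)) hy0.
  rewrite /= m1 ty B // sy /=.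
  by case: (bit _).
rewrite run_if [holds _ _ _]/= t4 ty mod0n tx m1 (small room); last lia.
rewrite /entry addn1; case: (h (par x)) => [|k] /=; first by rewrite m1.
rewrite eqSS; case: (eqVneq k x) => [->|kx] /=; first by rewrite m1 eqxx.
by rewrite mod0n; case: eqP => // -[E]; rewrite E eqxx in kx.
Qed.

Lemma pos_par x : 0 < pos x -> 0 < pos (par x) <= pos x.
Proof.
move=> vx; rewrite (par_vis G F vx) /=.
by case: (eqVneq (par x) x) => [->//|nx]; apply/ltnW/(par_lt F).
Qed.

(** Vertices are colored in the order of the search, so that the colors and bits
    of the parent and of the grandparent are known. *)
Lemma color_correct s : fits s ->
  let f := arrs (prun w color_loop s) aOUT in
  forall x, 0 < pos x -> f x =
    if par x == x then 0 else if bit x then beta par f (par x) else alpha par f (par x).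
Proof.
move=> Fs f; have P : parsed s by case: Fs.
have ge := start_ge nb n.
have m1 : 1 %% 2 ^ w = 1 by rewrite (small room) //; lia.
have m3 : 3 %% 2 ^ w = 3 by rewrite (small room) //; lia.
pose col g x := g x =
  if par x == x then 0 else if bit x then beta par g (par x) else alpha par g (par x).
pose I i t := forall x, 0 < pos x <= i -> [/\ col (arrs t aOUT) x, arrs t aOUT x <= 3 &
  par x != x -> arrs t aBIT x = bit x].
suff H : I len (prun w color_loop s).
  move=> x vx; have [le _] := ordP vx.
  by have [] := H x; rewrite // vx /=; rewrite /len; lia.
rewrite -(p_len P); apply: loop_rule => //; first by move=> x; lia.
move=> i t il tk ka kr It.
have Ft : fits t.
  case: Fs => Ps [tp to tq] [t1 t2 t3 t4] tt; split; [|split|split|]; rewrite ?ka ?kr //.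
  by apply: parsed_ext Ps => [a||]; rewrite ?kr // !inE => /or4P[] /eqP->; rewrite ka.
have [Pt [tp to tq] _ tt] := Ft.
rewrite /color_body run_if [holds _ _ _]/= tk tt; case: ltnP => itl; last first.
  move=> x /= /andP[vx xi]; apply: It; have [] := ordP vx; lia.
pose x := ord i; pose y := par x.
have px : pos x = i.+1 by rewrite posP.
have vx : 0 < pos x by rewrite px.
rewrite 2!run_seq.
have -> : run w (rY ::= Get aPAR rX) (run w (rX ::= Get aORD rK) t)
    = set_reg (set_reg t rX x) rY y by rewrite /= tk to tp.
set t1 := set_reg _ rY y.
have F1 : fits t1.
  case: Ft => [? ? ? ?]; split=> //; exact: parsed_ext Pt.
(* writing the entries of x leaves those of the earlier vertices intact *)
have old (g g' : nat -> nat) : (forall z, z != x -> g' z = g z) ->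
    forall z, 0 < pos z <= i -> g' z = g z /\ (col g z -> col g' z).
  move=> gg z /andP[vz zi]; have nx u : pos u <= i -> g' u = g u.
    by move=> ui; apply: gg; apply/eqP => ux; rewrite ux px in ui; lia.
  have /andP[v1 l1] := pos_par vz; have /andP[v2 l2] := pos_par v1.
  by rewrite /col /beta /alpha !nx //; lia.
rewrite run_if [holds _ _ _]/=; case: ifP => yx.
  move=> z /andP[vz zi].
  rewrite /= mod0n; set g' := fun j => if j == x then _ else _.
  case: (eqVneq z x) => [->|zx].
    by rewrite /col /g' eqxx yx; split.
  have zi' : 0 < pos z <= i.
    rewrite vz; have : pos z <> pos x by move=> E; move/eqP: zx; apply; apply: (pos_inj F).
    lia.
  have [E1 E2] : g' z = arrs t aOUT z /\ (col (arrs t aOUT) z -> col g' z).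
    by apply: old zi' => u /negbTE ux; rewrite /g' ux.
  by have [I1 I2 I3] := It z zi'; split=> //; exact: E2.
have nyx : par x != x by rewrite (yx : (par x == x) = false).
have lyx := par_lt F vx nyx; rewrite -/y in lyx.
have vy : 0 < pos y := par_vis G F vx.
have yi : 0 < pos y <= i by rewrite vy; lia.
rewrite run_seq; set t2 := run w bit_body t1.
have b2 : regs t2 rC = bit x.
  apply: bit_body_correct => //; move=> ny; have [_ _ ->] := It y yi; by [].
have a2 : arrs t2 = arrs t.
  by apply: functional_extensionality => a; rewrite run_arr.
have y2 : regs t2 rY = y by rewrite run_reg.
have x2 : regs t2 rX = x by rewrite run_reg.
clearbody t2; rewrite run_seq; set t3 := run w (If _ _ _) t2.
have t3E : t3 = set_reg t2 rD (alpha par (arrs t aOUT) y).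
  by rewrite /t3 run_if [holds _ _ _]/= a2 tp y2 /alpha; case: ifP => _ /=; rewrite ?m1 ?a2 ?tp ?y2.
have al3 : alpha par (arrs t aOUT) y <= 3.
  rewrite /alpha; case: ifP => // ny.
  have /andP[v1 l1] := pos_par vy.
  by have [] := It (par y); rewrite // v1 /=; lia.
have [_ oy3 _] := It y yi.
rewrite run_seq; set t4 := run w (Store aBIT rX rC) t3.
pose val := if bit x then beta par (arrs t aOUT) y else alpha par (arrs t aOUT) y.
set t5 := run w _ t4.
have [o5 b5] : arrs t5 aOUT = (fun j => if j == x then val else arrs t aOUT j) /\
     arrs t5 aBIT = (fun j => if j == x then bit x : nat else arrs t aBIT j).
  rewrite /t5 /t4 t3E run_if [holds _ _ _]/= b2 mod0n; rewrite /val /beta.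
  case: (bit x) b2 => b2 /=; rewrite x2 a2 b2 ?y2 ?m3 //.
  by rewrite (small room) //; lia.
clearbody t5; move=> z /andP[vz zi]; rewrite [arrs _]/= o5 b5.
have gg u : u != x -> (if u == x then val else arrs t aOUT u) = arrs t aOUT u.
  by move/negbTE->.
case: (eqVneq z x) => [->|zx].
  have [oy _] := old _ _ gg y yi.
  have oy' : alpha par (fun j => if j == x then val else arrs t aOUT j) y = alpha par (arrs t aOUT) y.
    rewrite /alpha; case: ifP => // _; have /andP[v1 l1] := pos_par vy.
    have pyi : 0 < pos (par y) <= i by rewrite v1; lia.
    by have [-> _] := old _ _ gg (par y) pyi.
  split=> //; last by rewrite /val /beta; case: (bit x); lia.
  by rewrite /col eqxx (negbTE nyx) -/y /beta oy' oy.

have zi' : 0 < pos z <= i.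
  rewrite vz; have : pos z <> pos x by move=> E; move/eqP: zx; apply; apply: (pos_inj F).
  lia.
have [E1 E2] := old _ _ gg z zi'; have [I1 I2 I3] := It z zi'.
by split=> //; exact: E2.
Qed.

End Colors.

(** * The decision *)

Definition raised (r : nat) : test := differ r (Const 0).

Definition decide_spines : prog :=
  Chain hp_loop (Branch (raised rFK) report_D
    (Chain color_loop (Base (rANS ::= Const 1)))).

Definition decide_shared : prog :=
  Chain find_D4 (Branch (raised rF4) (Base D4_list)
  (Chain find_top (Branch (raised rFX) (Base (rU ::= Get aPAR rP ;; X127_list))
  (Chain find_side (Branch (raised rFY)
    (Base (rU ::= rP ;; rP ::= Get aPAR rP ;; X127_list))
    decide_spines))))).

Definition decide : prog :=
  Chain (arc_loop sib_body) (Branch (raised rFV) report_diamond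
  (Chain (arc_loop tip_body) (Branch (raised rFV) report_diamond
  (Chain (arc_loop tri_body) decide_shared)))).

(** The registers and arrays that are still as they were at the start. *)
Definition fresh (rs As : seq nat) (s : state) :=
  (forall r, r \in rs -> regs s r = 0) /\ (forall a, a \in As -> arrs s a = fun _ => 0).

Lemma fresh_run w p rs As rs' As' s :
  all (fun r => (r \in rs) && prog_keeps_reg r p) rs' ->
  all (fun a => (a \in As) && prog_keeps_arr a p) As' ->
  fresh rs As s -> fresh rs' As' (prun w p s).
Proof.
move=> /allP kr /allP ka [fr fa]; split=> x xin.
- by have /andP[r1 r2] := kr x xin; rewrite prun_reg ?fr.
- by have /andP[a1 a2] := ka x xin; rewrite prun_arr ?fa.
Qed.

Lemma fresh_sub rs As rs' As' s : all (mem rs) rs' -> all (mem As) As' ->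
  fresh rs As s -> fresh rs' As' s.
Proof.
by move=> /allP rr /allP aa [fr fa]; split=> x xin; [apply/fr/rr | apply/fa/aa].
Qed.

Definition three_colors (nb : nat -> seq nat) n (f : nat -> nat) :=
  [/\ forall x, x < n -> f x < 3, forall x y, adj nb x y -> f x != f y &
      forall x y, adj nb x y -> only nb f x y \/ only nb f y x].

Definition verdict nb n (s : state) :=
  (regs s rANS = 0 /\ obs nb (out s)) \/
  (regs s rANS = 1 /\ three_colors nb n (arrs s aOUT)).

Lemma prun_raised w r p1 p2 s : prun w (Branch (raised r) p1 p2) s =
  if regs s r == 0 then prun w p2 s else prun w p1 s.
Proof. by rewrite /= mod0n if_neg. Qed.

Lemma prun_chain w p1 p2 s : prun w (Chain p1 p2) s = prun w p2 (prun w p1 s).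
Proof. by []. Qed.

Section Decide.

Variables (w n : nat) (nb : nat -> seq nat) (IN : nat -> nat).
Hypothesis G : chordal_lists nb.
Hypothesis nbn : forall x y, adj nb x y -> x < n.
Local Notation e := (adj nb).
Local Notation big := (big nb).
Local Notation deg x := (size (nb x)).
Local Notation start := (start nb).
Local Notation tri := (tri nb).
Local Notation parsed := (parsed n nb IN).
Let eC : symmetric e := adj_sym G.
Hypothesis INnb : forall x i, x < n -> i < deg x ->
  IN (start x + 1 + i) = nth 0 (nb x) i.
Hypothesis room : start n * 20 < 2 ^ w.

Variables (pos par ord : nat -> nat) (tl : nat).
Local Notation sib := (sib nb par).
Hypothesis F : bfs_forest nb pos par.
Hypothesis vis : forall x, x < n -> 0 < pos x.
Hypothesis vis_n : forall x, 0 < pos x -> x < n.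
Hypothesis ordP : forall x, 0 < pos x -> pos x <= tl /\ ord (pos x).-1 = x.
Hypothesis posP : forall i, i < tl -> pos (ord i) = i.+1.
Hypothesis tln : tl <= n.

Section Layered.

Hypothesis S : forall x y, e x y -> [|| par y == x, par x == y | par x == par y].
Hypothesis star : forall x y d, sib x y -> sib y d -> d != x -> ~~ big x.
Variables (h1 h2 p q p' q' : nat -> nat).
Hypothesis H : sib_lists nb par h1 h2.
Hypothesis L : tri_lists nb p q p' q'.
Hypothesis C : forall u a b, tri u a b -> (p u != 0) &&
  [|| p' u != 0, a.+1 == p u, a.+1 == q u, b.+1 == p u | b.+1 == q u].

Lemma entryP (h : nat -> nat) x y : entry h x = Some y <-> h x = y.+1.
Proof. by rewrite /entry; case: (h x) => [|k]; split=> // -[->]. Qed.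

Lemma entry0 (h : nat -> nat) x : entry h x = None <-> h x = 0.
Proof. by rewrite /entry; case: (h x). Qed.

Lemma h1_lone x : h1 x = 0 -> lone nb par x.
Proof. by move=> h0 y; apply/negP => /(sl_ex H)[]; rewrite h0. Qed.

Section Spines.
Hypothesis shX : forall u a b, tri u a b -> p' u != 0 -> ~~ big a \/ ~~ big b.
Hypothesis shD : forall u v, e u v -> p' u != 0 -> p' v != 0 -> False.

Lemma spines_correct s : fits n nb IN pos par ord tl p p' h1 (fun _ => 0) s ->
  arrs s aT1B = q -> fresh [:: rANS; rOUT; rFK] [::] s ->
  verdict nb n (prun w decide_spines s).
Proof.
move=> [P [sp so sq] [t1 t2 t3 t4] tt] qE Z.
set s1 := prun w hp_loop s.
have [] := hp_loop_correct G room F ordP posP tln vis_n P sp so t1 t3 tt _ t4.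
  by apply Z.1.
rewrite -/s1; set h := arrs s1 aHP => hok.
have P1 : parsed s1 by apply: parsed_keep P.
have F1 : fits n nb IN pos par ord tl p p' h1 h s1.
  by split; [exact: P1 | split; rewrite /s1 prun_arr |
    split; [rewrite /s1 prun_arr | rewrite /s1 prun_arr | rewrite /s1 prun_arr | ] | rewrite /s1 prun_reg].
have Z1 : fresh [:: rANS; rOUT] [::] s1 by apply: fresh_run Z.
have qE1 : arrs s1 aT1B = q by rewrite prun_arr.
have triT u : triangled p u -> tri u (p u).-1 (q u).-1 by case/(tl_1 L).
have -> : prun w decide_spines s = if holds w s1 (raised rFK) then prun w report_D s1
  else set_reg (prun w color_loop s1) rANS (1 %% 2 ^ w) by [].
rewrite [holds _ _ _]/= mod0n; case: eqP => fk.
  move=> done1 /=; right; set s2 := prun w color_loop s1.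
  have fE := color_correct G nbn room F S ordP posP tln vis_n (sl_1 H) F1.
  rewrite -/s2 in fE; rewrite /verdict /= modn_small; last by have := start_ge nb n; lia.
  split=> //; set f := arrs s2 aOUT in fE *.
  have sbP x y : entry h1 x = Some y -> sib x y.
    by move=> /entryP E; have := @sl_1 _ _ _ _ H x; rewrite E; apply.
  have sbN x y : entry h1 x = None -> ~~ sib x y by move=> /entry0 /h1_lone; apply.
  split.
  - by move=> x xn; have [] := f_range G F fE (vis xn).
  - move=> x y xy; have vx := pos_edge F xy.
    have vy : 0 < pos y by apply: (pos_edge F (y := x)); rewrite eC.
    case: (edgeP G F S xy) => [[E lt]|[E lt]|[xyS _]].
    + by rewrite -E eq_sym (f_par G F fE) // E; apply/eqP => E'; rewrite E' ltnn in lt.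
    + by rewrite -E (f_par G F fE) // E; apply/eqP => E'; rewrite E' ltnn in lt.
    + have [_ E nx ny _] := sib_par F S xyS.
      have [_ bn] := beta_neq G F fE (par_vis G F vx).
      rewrite (fN fE vx nx) (fN fE vy ny) -E (bit_opp G F S star _ _ _ sbP sbN xyS).
      by case: (bit _ _ _ _ _ _ _ y); rewrite // eq_sym.
  - move=> x y; apply: (only_edge G F S star (T := triangled p) (sh := fun u => p' u != 0)
      (hp := entry h) (sb := entry h1) sbP sbN) => //.
    + by move=> u a b /C /andP[].
    + by move=> u /triT tu; exists (p u).-1, (q u).-1.
    + apply: (shared_intro G _ L C); exact: (tip_small G F S star).
    + by move=> v z /entryP hv; have [] := hok v; rewrite hv // => -> ->.
    + move=> z vz nz /entry0 h1z hz; have [] := done1 z vz nz h1z.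
        by move: hz; rewrite /hot /entry; case: (triangled p z); case: (h z).
      by move=> nT hb; split=> // /hb hz'; apply/entryP.
move=> col; left; split; first by rewrite prun_reg // Z1.1.
apply: (D_correct G INnb room F S star ordP tln vis_n h1_lone hok triT P1) => //.
  by case: F1 => _ [].
  by case: F1 => _ _ [].
exact: Z1.1.
Qed.

End Spines.

Lemma fits_keep h prg s :
  all (prog_keeps_arr^~ prg) [:: aIN; aOFF; aDEG; aSRC; aPAR; aORD; aPOS; aT1A; aT2A; aH1; aHP] ->
  all (prog_keeps_reg^~ prg) [:: rN; rLEN; rTAIL] ->
  fits n nb IN pos par ord tl p p' h1 h s ->
  fits n nb IN pos par ord tl p p' h1 h (prun w prg s).
Proof.
move=> /= /and5P[a1 a2 a3 a4 /and5P[a5 a6 a7 a8 /and4P[a9 a10 a11 _]]] /and4P[r1 r2 r3 _].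
case=> P [? ? ?] [? ? ? ?] ?; split; rewrite ?prun_arr ?prun_reg //.
by apply: parsed_keep P; rewrite /= ?a1 ?a2 ?a3 ?a4 ?r1 ?r2.
Qed.

(** If none of the three searches for edges succeeds, their failures are the
    assumptions [shX] and [shD] on shared vertices. *)
Lemma shared_correct s : fits n nb IN pos par ord tl p p' h1 (fun _ => 0) s ->
  tri_state p q p' q' s -> fresh [:: rANS; rOUT; rFK; rF4; rFX; rFY] [::] s ->
  verdict nb n (prun w decide_shared s).
Proof.
move=> F0 T0 Z0; have tips := tip_small G F S star.
have m2 : 2 %% 2 ^ w = 2 by rewrite modn_small //; have := start_ge nb n; lia.
have par_n x : x < n -> par x < n by move=> /vis/(par_vis G F)/vis_n.
have [P0 [sp0 _ _] [_ sp'0 _ _] _] := F0.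
set s1 := prun w find_D4 s; have F1 := F0; move/(fits_keep (prg := find_D4)): F1.
move=> /(_ isT isT); rewrite -/s1 => F1; have [P1 [sp1 _ _] [_ sp'1 _ _] _] := F1.
have T1 : tri_state p q p' q' s1 by case: T0 => *; split; rewrite /s1 prun_arr.
have Z1 : fresh [:: rANS; rOUT; rFK; rFX; rFY] [::] s1 by apply: fresh_run Z0.
have := @find_correct w n nb IN room rF4 rP rQ (TAnd (shared_test rX) (shared_test rY))
  (fun x y => (p' x != 0) && (p' y != 0)) s P0 (Z0.1 rF4 isT) isT
  (fun t x y _ tx ty ta => ltac:(by rewrite /= ta sp'0 tx ty mod0n)).
cbv beta zeta; rewrite -/find_D4 -/s1 /decide_shared prun_chain -/s1 prun_raised.
case: eqP => f4 E4; last first.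
  left; case/and3P: E4 => pq sP sQ.
  split; first by rewrite run_reg // Z1.1.
  exact: (D4_correct G nbn room tips L P1 T1 (Z1.1 rOUT isT)).
set s2 := prun w find_top s1; have := fits_keep (prg := find_top) isT isT F1.
rewrite -/s2 => F2; have [P2 [sp2 _ _] [_ sp'2 _ _] _] := F2.
have T2 : tri_state p q p' q' s2 by case: T1 => *; split; rewrite /s2 prun_arr.
have Z2 : fresh [:: rANS; rOUT; rFK; rFY] [::] s2 by apply: fresh_run Z1.
(* degrees are recorded for the vertices below [n] only *)
have xyn x y : e x y -> x < n /\ y < n by move=> xy; rewrite (nbn xy) (nbn (y := x)) // eC.
have := @find_correct w n nb IN room rFX rP rQ
  (TAnd nontree (TAnd (shared_test (Get aPAR rX)) (TAnd (big_test rX) (big_test rY))))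
  (fun x y => [&& (par y != x) && (par x != y), p' (par x) != 0, big x & big y])
  s1 P1 (Z1.1 rFX isT) isT
  (fun t x y xy tx ty ta => let: conj xn yn := xyn x y xy in
    ltac:(by rewrite /= ta sp1 sp'1 tx ty mod0n m2 !(p_deg P1))).
cbv beta zeta; rewrite -/find_top -/s2 prun_chain -/s2 prun_raised.
case: eqP => fx EX; last first.
  left; case/andP: EX => pq /and4P[/andP[n1 n2] sP bP bQ].
  pose t := set_reg s2 rU (arrs s2 aPAR (regs s2 rP)).
  rewrite [prun w (Base _) s2](erefl : _ = run w X127_list t).
  split; first by rewrite run_reg // [LHS](Z2.1 rANS isT).
  have tU : regs t rU = par (regs s2 rP) by rewrite -sp2.
  apply: (X127_correct G nbn INnb room tips L) => //; rewrite ?tU //.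
  - by apply: parsed_ext P2.
  - exact: Z2.1 rOUT isT.
  - by apply: (sib_up G F S); rewrite /(sib _ _) pq n1 n2.
set s3 := prun w find_side s2; have := fits_keep (prg := find_side) isT isT F2.
rewrite -/s3 => F3; have [P3 [sp3 _ _] [_ sp'3 _ _] _] := F3.
have T3 : tri_state p q p' q' s3 by case: T2 => *; split; rewrite /s3 prun_arr.
have Z3 : fresh [:: rANS; rOUT; rFK] [::] s3 by apply: fresh_run Z2.
have := @find_correct w n nb IN room rFY rP rQ
  (TAnd nontree (TAnd (shared_test rX) (TAnd (big_test (Get aPAR rX)) (big_test rY))))
  (fun x y => [&& (par y != x) && (par x != y), p' x != 0, big (par x) & big y])
  s2 P2 (Z2.1 rFY isT) isT
  (fun t x y xy tx ty ta => let: conj xn yn := xyn x y xy in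
    ltac:(by rewrite /= ta sp2 sp'2 tx ty mod0n m2 !(p_deg P2) // par_n)).
cbv beta zeta; rewrite -/find_side -/s3 prun_chain -/s3 prun_raised.
case: eqP => fy EY; last first.
  left; case/andP: EY => pq /and4P[/andP[n1 n2] sP bP bQ].
  pose t := set_reg (set_reg s3 rU (regs s3 rP)) rP (arrs s3 aPAR (regs s3 rP)).
  rewrite [prun w (Base _) s3](erefl : _ = run w X127_list t).
  split; first by rewrite run_reg // [LHS](Z3.1 rANS isT).
  have tP : regs t rP = par (regs s3 rP) by rewrite -sp3.
  apply: (X127_correct G nbn INnb room tips L) => //; rewrite ?tP //.
  - by apply: parsed_ext P3.
  - exact: Z3.1 rOUT isT.
  - by rewrite (tri_rot G); apply: (sib_up G F S); rewrite /(sib _ _) pq n1 n2.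
apply: spines_correct => //.
- move=> u a b tu pu; case: (boolP (big a)) => ba; last by left.
  case: (boolP (big b)) => bb; [exfalso | by right].
  case: (triP G F S star tu) => [[ab pa]|[ua pa]|[ub pb]].
  + have [exy E n1 n2 _] := sib_par F S ab; case/and3P: (ab) => _ n3 n4.
    by have := EX a b exy; rewrite n3 n4 pa pu ba bb.
  + have [exy _ _ _ _] := sib_par F S ua; case/and3P: (ua) => _ n3 n4.
    by have := EY u a exy; rewrite n3 n4 pa pu ba bb.
  + have [exy _ _ _ _] := sib_par F S ub; case/and3P: (ub) => _ n3 n4.
    by have := EY u b exy; rewrite n3 n4 pb pu ba bb.
- by move=> u v uv pu pv; have := E4 u v uv; rewrite pu pv.
- by case: T3.
Qed.

End Layered.

Lemma decide_correct s : parsed s ->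
  arrs s aPOS = pos -> arrs s aPAR = par -> arrs s aORD = ord -> regs s rTAIL = tl ->
  fresh [:: rANS; rOUT; rFK; rF4; rFX; rFY; rFV; rCD; rZA; rZB]
    [:: aH1; aH2; aT1A; aT2A; aHP] s ->
  verdict nb n (prun w decide s).
Proof.
move=> P sq sp so tt Z.
have diamond_verdict t : parsed t -> fresh [:: rANS; rOUT; rCD; rZA; rZB] [::] t ->
    blamed nb t -> regs t rFV <> 0 -> verdict nb n (prun w report_diamond t).
  move=> Pt Zt bt fv; left; split; first by rewrite prun_reg // (Zt.1 rANS isT).
  exact: (diamond_correct G nbn INnb room Pt (Zt.1 rOUT isT) (Zt.1 rCD isT)
    (Zt.1 rZA isT) (Zt.1 rZB isT) (bt (introN eqP fv))).
rewrite /decide prun_chain; set s1 := prun w (arc_loop sib_body) s.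
have P1 : parsed s1 by apply: parsed_keep P.
have Z1 : fresh [:: rANS; rOUT; rFK; rF4; rFX; rFY; rCD; rZA; rZB] [:: aT1A; aT2A; aHP] s1.
  by apply: fresh_run Z.
have [B1 R1] := sib_loop_correct G nbn room F P sq sp (Z.2 aH1 isT) (Z.2 aH2 isT) (Z.1 rFV isT).
rewrite -/s1 in B1 R1; rewrite prun_raised; case: eqP => f1; last first.
  by apply: diamond_verdict => //; apply: fresh_sub Z1.
have [H S] := R1 f1; set h1 := arrs s1 aH1 in H; set h2 := arrs s1 aH2 in H.
have sp1 : arrs s1 aPAR = par by rewrite /s1 prun_arr.
rewrite prun_chain; set s2 := prun w (arc_loop tip_body) s1.
have P2 : parsed s2 by apply: parsed_keep P1.
have Z2 : fresh [:: rANS; rOUT; rFK; rF4; rFX; rFY; rCD; rZA; rZB] [:: aT1A; aT2A; aHP] s2.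
  by apply: fresh_run Z1.
have [B2 R2] := tip_loop_correct G nbn room F S P1 sp1 erefl erefl H f1.
rewrite -/s2 in B2 R2; rewrite prun_raised; case: eqP => f2; last first.
  by apply: diamond_verdict => //; apply: fresh_sub Z2.
have star := R2 f2.
have sp2 : arrs s2 aPAR = par by rewrite /s2 prun_arr.
rewrite prun_chain; set s3 := prun w (arc_loop tri_body) s2.
have P3 : parsed s3 by apply: parsed_keep P2.
have Z3 : fresh [:: rANS; rOUT; rFK; rF4; rFX; rFY] [:: aHP] s3 by apply: fresh_run Z2.
have [L C] := tri_loop_correct G nbn room F S star P2 sp2 (Z2.2 aT1A isT) (Z2.2 aT2A isT).
apply: (shared_correct S star H L) => //.
- split=> //.
  + by rewrite /s3 /s2 /s1 !prun_arr.
  + by split=> //; [rewrite /s3 prun_arr // /s2 prun_arr | exact: Z3.2].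
  + by rewrite /s3 /s2 /s1 !prun_reg.
- by apply: fresh_sub Z3.
Qed.

End Decide.

(** * The recognizer *)

Definition rest : prog := Chain sources (Chain bfs_loop decide).
Definition recognizer : cmd := init ;; code sizes ;; set_len ;; code rest.
Definition parse : prog := Chain (Base init) (Chain sizes (Chain (Base set_len) sources)).

Lemma rest_wf : wf rLEN rest. Proof. by vm_compute. Qed.

(** Each edge, a set of two vertices, comes from at most two ordered pairs. *)
Lemma degree_sum (T : finType) (e : rel T) : 
  \sum_(x : T) \sum_(y : T) e x y <= 2 * #|edge_set e|.
Proof.
rewrite pair_big /= (eq_bigr (fun i => if e i.1 i.2 then 1 else 0)); last first.
  by move=> i _; case: (e _ _).
rewrite -big_mkcond /= (partition_big_imset (fun xy => [set xy.1; xy.2])) /=.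
have -> : (fun xy : T * T => [set xy.1; xy.2]) @: (fun i : T * T => e i.1 i.2) = edge_set e.
  by apply/setP => W; apply/imsetP/imsetP => -[z zP ->]; exists z; rewrite // ?inE // in zP *.
rewrite mulnC -sum_nat_const; apply: leq_sum => W /imsetP[[a b] _ ->] /=.
rewrite sum1_card; apply: (leq_trans (n := #|[set (a, b); (b, a)]|)); last first.
  by rewrite cards2; case: (_ != _).
apply/subset_leq_card/subsetP => -[x y] /andP[_ /eqP/setP ab].
have := ab b; have := ab a; have := ab y; have := ab x; rewrite !inE /= !xpair_eqE !eqxx !orbT /=.
move=> /esym /orP[]/eqP -> /esym /orP[]/eqP ->; rewrite ?eqxx ?orbT //=.
- by move=> _; rewrite andbT eq_sym.
- by move=> + _; rewrite andbT eq_sym.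
Qed.

Section Lists.

Variables (n : nat) (e : rel 'I_n) (nbrs : 'I_n -> seq 'I_n).
Hypothesis Ge : simple_graph e.
Hypothesis Ga : adjacency_lists e nbrs.

Definition lists (x : nat) : seq nat :=
  if insub x is Some i then [seq val y | y <- nbrs i] else [::].

Lemma lists_val (i : 'I_n) : lists i = [seq val y | y <- nbrs i].
Proof. by rewrite /lists valK. Qed.

Lemma adj_val (i j : 'I_n) : adj lists i j = e i j.
Proof. by rewrite /adj lists_val (mem_map val_inj) (Ga i).2. Qed.

Lemma adj_bound x y : adj lists x y -> x < n /\ y < n.
Proof.
rewrite /adj /lists; case: insubP => // i _ <- /mapP[j _ ->].
by rewrite !ltn_ord.
Qed.

Lemma adj_ord x y : adj lists x y -> exists i j : 'I_n, [/\ x = i, y = j & e i j].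
Proof.
move=> xy; have [xn yn] := adj_bound xy.
by exists (Ordinal xn), (Ordinal yn); split=> //; rewrite -adj_val.
Qed.

(** Each vertex of the copy has a neighbor, hence is a vertex of the graph. *)
Lemma copy_iso (U : finType) (h : rel U) l : (forall x, exists y, h x y) ->
  copy lists h l -> exists r : seq 'I_n,
    [/\ uniq r, [seq val x | x <- r] = l & induced_iso h e [set x in r]].
Proof.
move=> nh cl; have := copy_uniq cl; case: cl => g [gi gh lE sl] ul.
have gn x : g x < n by have [y] := nh x; rewrite -gh => /adj_bound[].
have rE : [seq val x | x <- pmap insub l : seq 'I_n] = l.
  rewrite pmap_filter; last exact: insubK.
  apply/all_filterP/allP => x; rewrite lE => /mapP[u _ ->].
  by rewrite isSome_insub.
exists (pmap insub l); split=> //; first by rewrite -(map_inj_uniq val_inj) rE.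
exists (fun x => Ordinal (gn x)); split.
- by move=> x y [] /gi.
- apply/setP => i; rewrite inE -(mem_map val_inj) rE lE.
  apply/imsetP/mapP => [[u _ ->]|[u _ E]]; exists u; rewrite ?mem_enum //.
  exact: val_inj.
- by move=> x y; rewrite -gh -adj_val.
Qed.

Lemma lists_chordal : chordal e -> chordal_lists lists.
Proof.
have [eC eI] := Ge; move=> ch; split.
- move=> x; rewrite /lists; case: insubP => // i _ _.
  by rewrite (map_inj_uniq val_inj) (Ga i).1.
- move=> x y; apply/idP/idP => /adj_ord[i [j [-> -> ij]]]; by rewrite adj_val eC.
- move=> x; apply/negP => /adj_ord[i [j [-> /val_inj <-]]]; by rewrite eI.
move=> s [s4 us hs]; have cs : copy lists (@cycle_graph (size s)) s.
  exists (fun i => nth 0 s (val i)); split.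
  - by move=> i j /eqP; rewrite nth_uniq ?ltn_ord // => /eqP/val_inj.
  - by move=> i j; exact: hs (ltn_ord i) (ltn_ord j).
  - by move=> x; rewrite -{1}(mkseq_nth 0 s) /mkseq -val_enum_ord -map_comp.
  - by rewrite card_ord.
have [|r [_ _ iso]] := copy_iso _ cs; last exact: ch iso.
move=> i; have k0 : 0 < size s by apply: leq_trans s4.
by exists (Ordinal (ltn_pmod i.+1 k0)); rewrite /cycle_graph /= eqxx.
Qed.

Lemma obs_obstruction l : obs lists l -> exists r : seq 'I_n,
  [/\ uniq r, [seq val x | x <- r] = l & obstruction e [set x in r]].
Proof.
case=> [[]|||[k k4]] /copy_iso[].
- move=> i; exists (if i == ord0 then ord_max else ord0).
  by rewrite /K4; case: (eqVneq i ord0) => [->|].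
- by move=> r [ur rl iso]; exists r; split=> //; constructor 1; left.
- by case=> -[|[|[|[|[|i]]]]] // hi;
    [exists (inord 1) | exists (inord 0) | exists (inord 0) | exists (inord 0) | exists (inord 2)];
    rewrite /kite /graph_of_edges /= inordK.
- by move=> r [ur rl iso]; exists r; split=> //; constructor 1; right.
- by case=> -[|[|[|[|[|i]]]]] // hi;
    [exists (inord 1) | exists (inord 0) | exists (inord 1) | exists (inord 2) | exists (inord 0)];
    rewrite /gem /graph_of_edges /= inordK.
- by move=> r [ur rl iso]; exists r; split=> //; constructor 2.
- by case=> -[|[|[|[|[|[|[|i]]]]]]] // hi;
    [exists (inord 1) | exists (inord 0) | exists (inord 0) | exists (inord 0) | exists (inord 0) | exists (inord 1) | exists (inord 2)];
    rewrite /X127 /graph_of_edges /= inordK.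
- by move=> r [ur rl iso]; exists r; split=> //; constructor 3.
- case=> [i|j].
    have lt : minn i.-1 (k - 3) < k - 2 by lia.
    by exists (inr (Ordinal lt)) => /=.
  have lt : j.+1 < k by have := ltn_ord j; lia.
  exists (inl (Ordinal lt)) => /=; apply/eqP; have := ltn_ord j; lia.
- by move=> r [ur rl iso]; exists r; split=> //; constructor 4; exists k.
Qed.

Lemma verdict_answer s : verdict lists n s -> certified_answer e s.
Proof.
have [eC eI] := Ge.
case=> [[a0 /obs_obstruction[r [ur rl ob]]]|[a1 [f3 fp fo]]].
  right; split=> //; first exact: obstruction_not_star ob.
  by exists r.
have lt (x : 'I_n) : arrs s aOUT x < 3 by apply: f3.
have sc : star_coloring e (fun x => Ordinal (lt x)).
  apply: star_coloring_only => //.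
    by move=> x y xy; rewrite -val_eqE /=; apply: fp; rewrite adj_val.
  move=> x y; rewrite -adj_val => /fo[o|o]; [left|right] => z; rewrite -adj_val.
    by move=> xz [] /(o _ xz)/val_inj.
  by move=> xz [] /(o _ xz)/val_inj.
left; split=> //; exists (fun x => Ordinal (lt x)); by [].
Qed.

Local Notation start := (start lists).
Local Notation code_of k := (n :: flatten [seq size (lists x) :: lists x | x <- iota 0 k]).

Lemma encodeE : encode_graph nbrs = code_of n.
Proof.
rewrite /encode_graph -[in iota 0 n]val_enum_ord -map_comp; congr (_ :: flatten _).
by apply: eq_map => i /=; rewrite lists_val size_map.
Qed.

Lemma code_size k : size (code_of k) = start k.
Proof.
elim: k => // k IH; rewrite -addn1 iotaD map_cat flatten_cat -cat_cons size_cat IH /=.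
by rewrite cats0 addn1 /= add0n addnS addn1.
Qed.

Lemma code_nth k x i : x < k -> i <= size (lists x) ->
  nth 0 (code_of k) (start x + i) = nth 0 (size (lists x) :: lists x) i.
Proof.
elim: k => // k IH; rewrite ltnS leq_eqVlt => xk ix.
rewrite -addn1 iotaD map_cat flatten_cat -cat_cons nth_cat code_size /= add0n cats0.
case/orP: xk => [/eqP<-|xk].
  by rewrite ltnNge leq_addr /= addKn.
by rewrite (leq_ltn_trans _ (start_lt lists xk)) ?leq_add2l // -IH.
Qed.

Lemma start_edges : start n <= (n + #|edge_set e|).*2.+1.
Proof.
have -> : start n = 1 + n + \sum_(v < n) size (lists v).
  have S k : start k = 1 + k + \sum_(v < k) size (lists v).
    elim: k => [|k IH]; first by rewrite big_ord0.
    by rewrite big_ord_recr /= IH addn1 (addnS 1 k) addSn addnA.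
  exact: S.
suff : \sum_(v < n) size (lists v) <= 2 * #|edge_set e| by lia.
rewrite (leq_trans _ (degree_sum e)) // leq_sum // => x _.
rewrite lists_val size_map -(card_uniqP (Ga x).1) -sum1_card big_mkcond /=.
by apply: leq_sum => y _; rewrite (Ga x).2; case: (e x y).
Qed.

End Lists.

(** By the pigeonhole principle: [pos] is injective and the vertices of the graph
    already take all values from 1 to [n]. *)
Lemma pos_small n (pos : nat -> nat) : (forall x y, 0 < pos x -> pos x = pos y -> x = y) ->
  (forall x, x < n -> 0 < pos x) -> (forall x, 0 < pos x -> pos x <= n) ->
  forall x, 0 < pos x -> x < n.
Proof.
move=> inj vis le x vx; rewrite ltnNge; apply/negP => nx.
have u : uniq [seq pos y | y <- x :: iota 0 n].
  rewrite map_inj_in_uniq.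
    by rewrite cons_uniq iota_uniq andbT mem_iota /= add0n -leqNgt.
  move=> y z; rewrite !inE !mem_iota /= add0n => yin _; apply: inj.
  by case/orP: yin => [/eqP->|/vis].
have sub : {subset [seq pos y | y <- x :: iota 0 n] <= iota 1 n}.
  move=> k /mapP[y yin ->]; have vy : 0 < pos y.
    by move: yin; rewrite inE mem_iota /= add0n => /orP[/eqP->|/vis].
  by rewrite mem_iota vy add1n ltnS le.
by have := uniq_leq_size u sub; rewrite size_map /= !size_iota ltnn.
Qed.

Lemma rest_correct w n (nb : nat -> seq nat) (IN : nat -> nat) s :
  chordal_lists nb -> (forall x y, adj nb x y -> x < n) -> IN 0 = n ->
  (forall x i, x < n -> i < size (nb x) -> IN (start nb x + 1 + i) = nth 0 (nb x) i) ->
  start nb n * 20 < 2 ^ w -> parsed n nb IN s ->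
  fresh [:: rANS; rOUT; rFK; rF4; rFX; rFY; rFV; rCD; rZA; rZB; rHEAD; rTAIL; rJ; rEND; rRR]
    [:: aH1; aH2; aT1A; aT2A; aHP; aPOS; aORD; aPAR] s ->
  verdict nb n (prun w decide (prun w bfs_loop s)).
Proof.
move=> G nbn IN0 INnb room P Z.
have za : forall a, a \in [:: aPOS; aORD; aPAR] -> arrs s a = fun _ => 0.
  by have [//|//|_] := @fresh_sub _ _ [::] [:: aPOS; aORD; aPAR] s _ _ Z.
have zr : forall r, r \in [:: rHEAD; rTAIL; rJ; rEND; rRR] -> regs s r = 0.
  by have [//|//|] := @fresh_sub _ _ [:: rHEAD; rTAIL; rJ; rEND; rRR] [::] s _ _ Z.
have [P1 F vis ordP [posP tln]] := bfs_correct G nbn IN0 INnb room P za zr.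
set s1 := prun w bfs_loop s in P1 F vis ordP posP tln *.
apply: (decide_correct G nbn INnb room F vis _ ordP posP tln P1) => //.
  apply: (pos_small (pos_inj F) vis) => x vx; have [] := ordP x vx; lia.
by apply: fresh_run Z.
Qed.

(** The words must hold numbers up to a fixed multiple of the length of the input,
    which is at most twice the number of vertices and edges, plus one. *)
Lemma recognizer_correct w n (e : rel 'I_n) (nbrs : 'I_n -> seq 'I_n) :
  simple_graph e -> chordal e -> adjacency_lists e nbrs ->
  41 * (n + #|edge_set e| + 1) <= 2 ^ w ->
  exists (t : nat) (s : state),
    [/\ exec w recognizer (input_state nbrs) t s,
        t <= (max_cost init + prog_cost sizes + max_cost set_len + prog_cost rest * 7) *
             (n + #|edge_set e| + 1) &
        certified_answer e s].
Proof.
move=> Ge ch Ga big_w; set m := #|edge_set e| in big_w *.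
pose nb := lists nbrs; pose IN := nth 0 (encode_graph nbrs).
have G : chordal_lists nb by exact: lists_chordal Ge Ga ch.
have nbn x y : adj nb x y -> x < n by case/(adj_bound).
have le := start_edges Ga; rewrite -/nb -/m in le.
have room : start nb n * 20 < 2 ^ w by lia.
have INE x i : x < n -> i <= size (nb x) ->
    IN (start nb x + i) = nth 0 (size (nb x) :: nb x) i.
  by move=> xn ix; rewrite /IN encodeE code_nth.
have INdeg x : x < n -> IN (start nb x) = size (nb x).
  by move=> xn; rewrite -[start nb x]addn0 INE.
have INnb x i : x < n -> i < size (nb x) -> IN (start nb x + 1 + i) = nth 0 (nb x) i.
  by move=> xn ix; rewrite -addnA add1n INE.
pose s0 := input_state nbrs.
pose s1 := run w init s0; pose s2 := prun w sizes s1; pose s3 := run w set_len s2.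
have P : parsed n nb IN (prun w sources s3) by exact: parse_correct.
have n1 : regs s1 rN = n by rewrite /s1 /= mod0n.
have l3 : regs s3 rLEN = len n nb by rewrite -(p_len P) prun_reg.
have nw : n < start nb n := start_ge nb n.
have [t1 le1 e1] := exec_run w s0 (isT : loopfree init).
have [||t2 le2 e2] := @prun_exec w rN sizes s1; [by [] | by rewrite n1; lia |].
have [t3 le3 e3] := exec_run w s2 (isT : loopfree set_len).
have [||t4 le4 e4] := @prun_exec w rLEN rest s3; [exact: rest_wf | by rewrite l3 /len; lia |].
exists (t1 + (t2 + (t3 + t4))), (prun w rest s3); split.
- exact: ExecSeq e1 (ExecSeq e2 (ExecSeq e3 e4)).
- rewrite n1 in le2; rewrite l3 in le4.
  move: (max_cost init) (prog_cost sizes) (max_cost set_len) (prog_cost rest) le1 le2 le3 le4.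
  move=> A B C D le1 le2 le3 le4.
  have h2 : t2 <= B * (n + m + 1) by apply: leq_trans le2 _; rewrite leq_mul2l; lia.
  (* [len] is at most six times the number of vertices and edges, plus three *)
  have h4 : t4 <= D * (7 * (n + m + 1)).
    by apply: leq_trans le4 _; rewrite leq_mul2l /len; lia.
  have h1 : A <= A * (n + m + 1) by rewrite leq_pmulr // addn1.
  have h3 : C <= C * (n + m + 1) by rewrite leq_pmulr // addn1.
  by rewrite !mulnDl -mulnA; lia.
apply: verdict_answer => //.
apply: (rest_correct (IN := IN) G nbn _ INnb room P) => //.
pose Rs := [:: rANS; rOUT; rFK; rF4; rFX; rFY; rFV; rCD; rZA; rZB; rHEAD; rTAIL; rJ; rEND; rRR].
pose As := [:: aH1; aH2; aT1A; aT2A; aHP; aPOS; aORD; aPAR].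
apply: (@fresh_run w parse Rs As _ _ s0) => //; split=> // a ain.
have /negbTE a0 : a != 0 by apply: contraTneq ain => ->.
by apply: functional_extensionality => i /=; rewrite a0.
Qed.

Theorem theorem2p4 :
  exists (p : cmd) (c d : nat),
    forall (n : nat) (e : rel 'I_n) (adj : 'I_n -> seq 'I_n) (w : nat),
      simple_graph e -> chordal e -> adjacency_lists e adj ->
      d * (n + #|edge_set e| + 1) <= 2 ^ w ->
      exists (t : nat) (s : state),
        [/\ exec w p (input_state adj) t s,
            t <= c * (n + #|edge_set e| + 1) &
            certified_answer e s].
Proof.
exists recognizer, (max_cost init + prog_cost sizes + max_cost set_len + prog_cost rest * 7), 41.
move=> n e adj w; exact: recognizer_correct.
Qed.
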